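(* Let $n\ge 2$ be an integer, let $0<\mu<1$, and let $S(x,y)=\sum_{k=1}^{n-1}a_kx^{n-k}y^k$ be a real homogeneous polynomial of degree $n$ on $\mathbb{R}^2$ with $a_1a_{n-1}\neq 0$. Let $\psi\in C_0^\infty(\mathbb{R}^2)$. Let $K(x,y)$ be a function that is $C^2$ away from the diagonal $\{x=y\}$ and satisfies, for some constant $E>0$ and all $x\ne y$, $$|K(x,y)|\le E|x-y|^{-\mu},\qquad |\partial_y^iK(x,y)|\le E|x-y|^{-\mu-i}\quad (i=1,2),$$ and, in addition, $$|\partial_x^iK(x,y)|\le E|x-y|^{-\mu-i}\quad (i=1,2).$$ For $\lambda>0$ define $$Tf(x)=\int_{\mathbb{R}}e^{i\lambda S(x,y)}K(x,y)\psi(x,y)f(y)\,dy .$$ Then for every $p$ with $\frac{n-2\mu}{n-1-\mu}\le p\le\frac{n-2\mu}{1-\mu}$ there is a constant $C=C_{E,S,\psi,\mu,n,p}$, depending only on $E,S,\psi,\mu,n,p$ (in particular not on $\lambda$ or $f$), such that $$\|Tf\|_{L^p(\mathbb{R})}\le C\,\lambda^{-\frac{1-\mu}{n}}\|f\|_{L^p(\mathbb{R})}\qquad\text{for all } f\in L^p(\mathbb{R}).$$ *)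

(* Defs.v *)
From HB Require Import structures.
From mathcomp Require Import all_boot all_order all_algebra.
From mathcomp Require Import all_classical all_reals all_analysis.
From mathcomp Require Import complex.

Set Implicit Arguments.
Unset Strict Implicit.
Unset Printing Implicit Defensive.
Import Order.TTheory GRing.Theory Num.Theory.
Import numFieldNormedType.Exports.

Local Open Scope classical_set_scope.
Local Open Scope ring_scope.

Definition ex {R : realType} : R * R := (1, 0).
Definition ey {R : realType} : R * R := (0, 1).

(* [f] is [C^k] on [U]; this is the usual notion when [U] is open, the only
   case used below. *)
Fixpoint Ck_on {R : realType} (k : nat) (U : set (R * R)) (f : R * R -> R)
    : Prop :=
  (forall z, U z -> {for z, continuous f}) /\
  match k with
  | 0 => True
  | j.+1 => [/\ forall z, U z -> derivable f z ex /\ derivable f z ey,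
                Ck_on j U ('D_ex f) & Ck_on j U ('D_ey f)]
  end.

Definition complex_Ck_on {R : realType} (k : nat) (U : set (R * R))
    (f : R * R -> R[i]) : Prop :=
  Ck_on k U (fun z => complex.Re (f z)) /\
  Ck_on k U (fun z => complex.Im (f z)).

Definition complex_partial {R : realType} (v : R * R) (f : R * R -> R[i])
    (z : R * R) : R[i] :=
  ('D_v (fun w => complex.Re (f w)) z +i*
   'D_v (fun w => complex.Im (f w)) z)%C.

Definition test_function {R : realType} (psi : R * R -> R[i]) : Prop :=
  (forall k, complex_Ck_on k setT psi) /\
  compact (closure [set z | psi z != 0]).

Definition off_diagonal {R : realType} : set (R * R) := [set z | z.1 != z.2].

(* [Normc.normc z] is the modulus of [z] as an element of [R]. *)
Definition complex_Lnorm {R : realType} (p : R) (f : R -> R[i]) : \bar R :=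
  Lnorm (@lebesgue_measure R) p%:E (fun x => (Normc.normc (f x))%:E).

Definition in_complex_Lp {R : realType} (p : R) (f : R -> R[i]) : Prop :=
  [/\ measurable_fun setT (fun x => complex.Re (f x)),
      measurable_fun setT (fun x => complex.Im (f x))
    & (complex_Lnorm p f < +oo)%E].

Definition complex_integral {R : realType} (f : R -> R[i]) : R[i] :=
  (Rintegral (@lebesgue_measure R) setT (fun y => complex.Re (f y)) +i*
   Rintegral (@lebesgue_measure R) setT (fun y => complex.Im (f y)))%C.

Definition expi {R : realType} (t : R) : R[i] := (cos t +i* sin t)%C.

Definition phase {R : realType} (n : nat) (a : nat -> R) (x y : R) : R :=
  \sum_(1 <= k < n) a k * x ^+ (n - k) * y ^+ k.

(* The values of [K] on the diagonal are irrelevant: for fixed [x] they only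
   affect the integrand at the single point [y = x]. *)
Definition osc_op {R : realType} (lambda : R) (S : R -> R -> R)
    (K psi : R * R -> R[i]) (f : R -> R[i]) (x : R) : R[i] :=
  complex_integral
    (fun y => expi (lambda * S x y) * K (x, y) * psi (x, y) * f y).

(* Main.v *)
Require Import Defs.
From HB Require Import structures.
From mathcomp Require Import all_boot all_order all_algebra.
From mathcomp Require Import all_classical all_reals all_analysis.
From mathcomp Require Import measurable_realfun.
From mathcomp Require Import complex.
From mathcomp Require Import ring lra.

Set Implicit Arguments.
Unset Strict Implicit.
Unset Printing Implicit Defensive.
Import Order.TTheory GRing.Theory Num.Theory.
Import numFieldNormedType.Exports.

Local Open Scope classical_set_scope.
Local Open Scope ring_scope.

(** The mixed derivative [S_xy] of the phase is a binary form of degree [n - 2] whose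
    extreme coefficients [(n - 1) a_1] and [(n - 1) a_(n-1)] do not vanish. Over the
    complex numbers it is therefore a product of factors [y - z x] with all [z]
    nonzero ([form_factor]); the factor [y - x] is added to this list to account for
    the singularity of the kernel. The plane is then decomposed dyadically with
    respect to these finitely many lines, starting from the mesh
    [delta = lambda^(-1/n)], the scale at which the phase stops oscillating.

    Within distance about [delta] of one of the lines there is no oscillation to
    exploit. Since every [z] is nonzero, each row and each column meets this region
    in boundedly many intervals of length about [delta], on which [|x - y|^(-mu)] has
    integral at most [C delta^(1-mu)]; Schur's test gives the norm
    [C delta^(1-mu) = C lambda^(-(1-mu)/n)] on every [L^p] ([near_kernel_Lp]).

    The rest is a union of squares of sides [rho = 2^m delta], [m >= 0], each at
    distance at least about [rho] from all the lines, with a bounded number of squares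
    of a given size in each row and column ([grid_partition], [selected_row],
    [selected_col]). On one of them the kernel is at most of size [rho^(-mu)] and [S_xy]
    at least of size [rho^(n-2)]. The kernel of [T^* T] is an oscillatory integral in [x] with
    phase [S (x, y) - S (x, y')], whose derivative is at least
    [c rho^(n-2) |y - y'|]; one integration by parts
    ([oscillatory_integral_bound], [square_kernel_bound]) and Schur's test show that
    the operator has norm at most [C rho^(1-mu) (lambda rho^n)^(-s/2)] on [L^2], for
    any [s < 1] ([osc_square_L2]). All functions in play live on sets of measure
    [rho], so that for [p >= 2] Hoelder's inequality turns this, at no cost in
    [rho], into a bound of the [p]-th power of the [L^p] norm by
    [C rho^((1-mu)p) (lambda rho^n)^(-s)]; for [p < 2] duality gives the same with
    [s (p - 1)] in place of [s] ([kernel_op_Lp], [osc_square_Lp]).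

    With [rho = 2^m delta] this [p]-th power is [C delta^((1-mu)p)] times the [m]-th
    power of [2^((1-mu)p - n s min(1, p-1))]. The range of [p] ensures, even at its
    endpoints, that [(1-mu)p < n min(1, p-1)] ([scaling_exponent]); for [s] close
    to [1] the dyadic pieces decrease geometrically, and the sum obeys the same bound
    as the near part ([far_part_Lp]).

    All this is carried out for real kernels and functions, with a majorant [V] valued
    in the extended reals ([real_osc_Lp]). The complex operator is a combination of
    sixteen such real operators, one for each choice of real or imaginary part in the
    four factors of the integrand ([le_osc_op]). *)

(** * Binary forms and their complex linear factors *)

Section Forms.
Context {R : realType}.
Implicit Types (d : nat) (b : nat -> R) (x y : R).

(** Binary forms of degree [d]; [formX] and [formY] are the coefficients of the partial
    derivatives. *)
Definition form d b x y : R := \sum_(k < d.+1) b k * x ^+ (d - k) * y ^+ k.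

Definition formX d b : nat -> R := fun k => (d - k)%:R * b k.

Definition formY d b : nat -> R :=
  fun k => if (k < d)%N then k.+1%:R * b k.+1 else 0.

Lemma formYX d b : formY d.-1 (formX d b) = formX d.-1 (formY d b).
Proof.
apply/funext => k; rewrite /formY /formX.
case: (ltnP k d.-1) => h1; case: (ltnP k d) => h2; rewrite ?mulr0//.
- by rewrite -subn1 -subnDA add1n; ring.
- by move: h2; rewrite leqNgt (leq_trans h1 (leq_pred _)).
- by rewrite (_ : (d.-1 - k)%N = 0%N) ?mul0r//; apply/eqP; rewrite subn_eq0.
Qed.

Lemma form_sym d b x y : form d b x y = form d (fun k => b (d - k)%N) y x.
Proof.
rewrite /form (reindex_inj rev_ord_inj)/=; apply: eq_bigr => k _.
rewrite subSS subKn; last by rewrite -ltnS.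
by ring.
Qed.

Lemma is_derive_formX d b x y :
  is_derive x (1 : R) (fun t => form d b t y) (form d.-1 (formX d b) x y).
Proof.
pose q : {poly R} := \sum_(k < d.+1) (b k * y ^+ k) *: 'X^(d - k).
have -> : (fun t => form d b t y) = horner q.
  apply/funext => t; rewrite /form /q horner_sum; apply: eq_bigr => k _.
  by rewrite hornerZ hornerXn; ring.
apply: is_derive_eq.
rewrite /q raddf_sum horner_sum big_ord_recr/= subnn expr0 alg_polyC derivC.
rewrite horner0 addr0 /form; case: d q => [|d] q /=.
  by rewrite big_ord0 big_ord1 /formX subnn !mul0r.
apply: eq_bigr => k _; rewrite /formX derivZ derivXn hornerZ hornerMn hornerXn.
have kd : (k <= d)%N by rewrite -ltnS.
by rewrite subSn//= -mulr_natl; ring.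
Qed.

Lemma is_derive_formY d b x y :
  is_derive y (1 : R) (fun t => form d b x t) (form d.-1 (formY d b) x y).
Proof.
have -> : (fun t => form d b x t) = (fun t => form d (fun k => b (d - k)%N) t x).
  by apply/funext => t; rewrite form_sym.
apply: (is_derive_eq (is_derive_formX d _ y x)).
rewrite [RHS]form_sym /form; apply: eq_bigr => k _.
congr (_ * _ * _); rewrite /formX /formY; case: d k => [|d] k /=.
  by rewrite sub0n mul0r.
have kd : (k <= d)%N by rewrite -ltnS.
by rewrite ltnS leq_subr subSn.
Qed.

Lemma continuous_formX d b y : continuous (fun t => form d b t y).
Proof.
move=> x; apply: differentiable_continuous; apply/derivable1_diffP.
by have [] := is_derive_formX d b x y.
Qed.

Lemma poly_eq_nat (F : numFieldType) (p q : {poly F}) :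
  (forall k : nat, p.[k%:R] = q.[k%:R]) -> p = q.
Proof.
move=> pq; apply/eqP; rewrite -subr_eq0; apply/eqP.
pose rs : seq F := [seq k%:R | k <- iota 0 (size (p - q))].
apply: (@roots_geq_poly_eq0 _ _ rs).
- by apply/allP => _ /mapP[k _ ->]; rewrite rootE !hornerE pq subrr.
- rewrite map_inj_uniq ?iota_uniq// => i j /eqP.
  by rewrite eqr_nat => /eqP.
- by rewrite size_map size_iota.
Qed.

Local Notation normc := (@Normc.normc R).
Local Notation "x %:C" := (real_complex R x).

Lemma normc_real x : normc x%:C = `|x|.
Proof. by rewrite /Normc.normc /= expr0n/= addr0 sqrtr_sqr. Qed.

Lemma normc_ge0 (z : R[i]) : 0 <= normc z.
Proof. by case: z => u v; rewrite /Normc.normc sqrtr_ge0. Qed.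

Lemma le_normcD (z w : R[i]) : normc (z + w) <= normc z + normc w.
Proof. exact: (@complex.le_normcD R z w). Qed.

Lemma normcN (z : R[i]) : normc (- z) = normc z.
Proof. exact: (@complex.normcN R z). Qed.

Lemma normc_prod (cs : seq R[i]) (f : R[i] -> R[i]) :
  normc (\prod_(z <- cs) f z) = \prod_(z <- cs) normc (f z).
Proof.
elim: cs => [|z cs ih]; first by rewrite !big_nil Normc.normc1.
by rewrite !big_cons Normc.normcM ih.
Qed.

(** The logarithmic derivative of a product of linear factors is the sum of the
    logarithmic derivatives of the factors. *)
Lemma normc_deriv_prod (cs : seq R[i]) (t : R) (x y : R[i]) :
  0 < t -> (forall z, z \in cs -> t <= normc (y - z * x)) ->
  let q := \prod_(z <- cs) (y%:P - z *: 'X) in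
  normc q^`().[x] <= (\sum_(z <- cs) normc z) / t * normc q.[x].
Proof.
move=> t0; elim: cs => [|z cs ih] tcs /=.
  by rewrite !big_nil derivC horner0 Normc.normc0 !mul0r.
rewrite !big_cons derivM hornerD !hornerM.
set q := \prod_(_ <- _) _ in ih *.
have -> : (y%:P - z *: 'X)^`().[x] = - z.
  by rewrite derivB derivC derivZ derivX sub0r hornerN hornerZ hornerC mulr1.
have lE : (y%:P - z *: 'X).[x] = y - z * x.
  by rewrite hornerD hornerC hornerN hornerZ hornerX.
rewrite lE !Normc.normcM.
apply: le_trans (le_normcD _ _) _; rewrite !Normc.normcM normcN.
have tz : t <= normc (y - z * x) by apply: tcs; rewrite mem_head.
have {}ih := ih (fun w wcs => tcs w (mem_behead (s := z :: cs) wcs)).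
have q0 := normc_ge0 q.[x]; have z0 := normc_ge0 z.
have z1 : 1 <= normc (y - z * x) / t by rewrite ler_pdivlMr ?mul1r.
rewrite mulrDl mulrDl; apply: lerD.
  rewrite [leRHS](_ : _ = (normc z * normc q.[x]) * (normc (y - z * x) / t)).
    by rewrite ler_peMr// mulr_ge0.
  by ring.
rewrite [leRHS]mulrCA ler_wpM2l ?normc_ge0//; exact: ih.
Qed.

(** What the estimates retain of a factorization into linear forms [y - z x]: the
    modulus of the form, and a bound for its logarithmic derivative in [x] at points
    that are at distance at least [t] from the zero lines. *)
Definition form_roots d b (cs : seq R[i]) : Prop :=
  [/\ size cs = d, b d != 0,
    (forall x y, `|form d b x y| =
       `|b d| * \prod_(z <- cs) normc (y%:C - z * x%:C)) &
    (forall x y t, 0 < t -> (forall z, z \in cs -> t <= normc (y%:C - z * x%:C)) ->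
      `|form d.-1 (formX d b) x y| <=
        (\sum_(z <- cs) normc z) / t * `|form d b x y|)].

(** Dehomogenize: the [z] are the roots of the one-variable polynomial with the same
    coefficients, and [b 0 != 0] says that [0] is not among them. *)
Lemma form_factor d b : b 0%N != 0 -> b d != 0 ->
  exists2 cs : seq R[i], form_roots d b cs & forall z, z \in cs -> z != 0.
Proof.
move=> b0 bd.
pose P : {poly R[i]} := \poly_(k < d.+1) (b k)%:C.
have bdC : (b d)%:C != 0 by apply: contra bd => /eqP[->].
have sP : size P = d.+1 by rewrite /P size_poly_eq.
have lP : lead_coef P = (b d)%:C by rewrite lead_coefE sP/= coef_poly ltnSn.
have [cs Pcs] := closed_field_poly_normal P; rewrite lP in Pcs.
have scs : size cs = d.
  by move: sP; rewrite Pcs size_scale// size_prod_XsubC => -[].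
have csn0 z : z \in cs -> z != 0.
  move=> zcs; apply: contra b0 => /eqP z0.
  have : P.[0] = 0.
    rewrite Pcs hornerZ horner_prod (big_rem z)//= z0.
    by rewrite hornerXsubC subrr mul0r mulr0.
  by rewrite horner_coef0 coef_poly/= => -[->].
have key (x y : R[i]) :
  \sum_(k < d.+1) (b k)%:C * x ^+ (d - k) * y ^+ k =
  (b d)%:C * \prod_(z <- cs) (y - z * x).
  have [->|x0] := eqVneq x 0.
    rewrite big_ord_recr/= big1 ?add0r; last first.
      by move=> k _; rewrite expr0n subn_eq0 leqNgt ltn_ord mulr0 mul0r.
    rewrite subnn expr0 mulr1; congr (_ * _).
    under eq_bigr do rewrite mulr0 subr0.
    by rewrite big_const_seq count_predT scs iter_mulr_1.
  have -> : \prod_(z <- cs) (y - z * x) = x ^+ d * \prod_(z <- cs) (y / x - z).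
    have -> : x ^+ d = \prod_(z <- cs) x.
      by rewrite big_const_seq count_predT scs iter_mulr_1.
    rewrite -big_split/=.
    by apply: eq_bigr => z _; rewrite mulrBr mulrCA divff// mulr1 [x * z]mulrC.
  have -> : (b d)%:C * (x ^+ d * \prod_(z <- cs) (y / x - z)) = x ^+ d * P.[y / x].
    rewrite Pcs hornerZ horner_prod mulrCA; congr (_ * (_ * _)).
    by apply: eq_bigr => z _; rewrite !hornerE.
  rewrite horner_poly mulr_sumr; apply: eq_bigr => k _.
  have kd : (k <= d)%N by rewrite -ltnS.
  rewrite -mulrA [RHS]mulrCA; congr (_ * _).
  have -> : x ^+ d = x ^+ (d - k) * x ^+ k by rewrite -exprD subnK.
  by rewrite expr_div_n -mulrA; congr (_ * _); rewrite mulrCA divff ?mulr1// expf_neq0.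
have formC x y : (form d b x y)%:C = (b d)%:C * \prod_(z <- cs) (y%:C - z * x%:C).
  rewrite -key /form rmorph_sum; apply: eq_bigr => k _.
  by rewrite !rmorphM !rmorphXn.
exists cs => //; split => //.
  by move=> x y; rewrite -normc_real formC Normc.normcM normc_prod normc_real.
move=> x y t t0 tcs.
pose q := \prod_(z <- cs) ((y%:C)%:P - z *: 'X).
(* the form as a polynomial in [x], for a fixed [y] *)
pose Q : {poly R[i]} := \sum_(k < d.+1) ((b k)%:C * y%:C ^+ k) *: 'X^(d - k).
have QE w : Q.[w] = \sum_(k < d.+1) (b k)%:C * w ^+ (d - k) * y%:C ^+ k.
  rewrite /Q horner_sum; apply: eq_bigr => k _.
  by rewrite hornerZ hornerXn; ring.
have Qq : Q = (b d)%:C *: q.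
  apply: poly_eq_nat => k; rewrite QE key hornerZ /q horner_prod.
  congr (_ * _); apply: eq_bigr => z _.
  by rewrite hornerD hornerC hornerN hornerZ hornerX.
have Q1 : Q^`().[x%:C] = (form d.-1 (formX d b) x y)%:C.
  rewrite /Q raddf_sum horner_sum big_ord_recr/= subnn expr0 alg_polyC derivC.
  rewrite horner0 addr0 /form rmorph_sum.
  case: (d) => [|d']/=; first by rewrite big_ord0 big_ord1 /formX subnn !mul0r.
  apply: eq_bigr => k _; rewrite /formX derivZ derivXn hornerZ hornerMn hornerXn.
  have kd : (k <= d')%N by rewrite -ltnS.
  by rewrite subSn//= -mulr_natl !rmorphM !rmorphXn/= rmorph_nat; ring.
rewrite -!normc_real -Q1 formC Qq derivZ hornerZ !Normc.normcM mulrCA.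
rewrite ler_wpM2l ?normc_ge0//.
have := normc_deriv_prod t0 tcs => /=.
rewrite -/q => h; apply: (le_trans h); rewrite ler_wpM2l//.
  by rewrite divr_ge0 ?(ltW t0)// sumr_ge0// => z _; exact: normc_ge0.
rewrite /q horner_prod (eq_bigr (fun z => y%:C - z * x%:C))// => z _.
by rewrite hornerD hornerC hornerN hornerZ hornerX.
Qed.

End Forms.

(** * An oscillatory integral *)

Section OscillatoryIntegral.
Context {R : realType}.
Local Notation mu := (@lebesgue_measure R).

Lemma within_continuousM (A : set R) (f g : R -> R) :
  {within A, continuous f} -> {within A, continuous g} ->
  {within A, continuous (fun x => f x * g x)}.
Proof.
move=> cf cg x.
exact: (@continuousM R (subspace A) f g x (cf x) (cg x)).
Qed.

Lemma within_continuousB (A : set R) (f g : R -> R) :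
  {within A, continuous f} -> {within A, continuous g} ->
  {within A, continuous (fun x => f x - g x)}.
Proof.
move=> cf cg x.
exact: (@continuousB R _ (subspace A) f g x (cf x) (cg x)).
Qed.

Lemma within_continuousD (A : set R) (f g : R -> R) :
  {within A, continuous f} -> {within A, continuous g} ->
  {within A, continuous (fun x => f x + g x)}.
Proof.
move=> cf cg x.
exact: (@continuousD R _ (subspace A) f g x (cf x) (cg x)).
Qed.

Lemma within_continuous_integrable (a b : R) (f : R -> R) :
  {within `[a, b], continuous f} -> mu.-integrable `[a, b] (EFin \o f).
Proof.
by move=> cf; apply: continuous_compact_integrable => //; exact: segment_compact.
Qed.

Lemma le_Rintegral_cst (a b : R) (f : R -> R) (M : R) : a <= b ->
  mu.-integrable `[a, b] (EFin \o f) ->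
  (forall x, x \in `[a, b] -> `|f x| <= M) ->
  `|\int[mu]_(x in `[a, b]) f x| <= M * (b - a).
Proof.
move=> ab fi fM; apply: le_trans (le_normr_Rintegral _ fi) _ => //.
have -> : M * (b - a) = \int[mu]_(x in `[a, b]) M.
  rewrite Rintegral_cst//= lebesgue_measure_itv/= lte_fin.
  by move: ab; rewrite le_eqVlt => /predU1P[->|->]//; rewrite ltxx subrr.
apply: le_Rintegral => //.
- by apply: (integrable_norm fi).
- apply/integrableP; split; first exact: measurable_cst.
  rewrite integral_cst//= lebesgue_measure_itv/= lte_fin.
  by case: ifP => _; rewrite ?mule0 ?ltry// -EFinD -EFinM ltry.
Qed.

(** Integration by parts gains the lower bound of the derivative of the phase. The
    hypothesis that the second derivative of the phase is at most [D] times the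
    first one takes the place of the usual monotonicity assumption. *)
Lemma oscillatory_integral_bound (a b L D M : R) (phi phi1 phi2 g g1 : R -> R) :
  a < b -> 0 < L -> 0 <= D ->
  (forall x, is_derive x (1 : R) phi (phi1 x)) ->
  (forall x, is_derive x (1 : R) phi1 (phi2 x)) ->
  continuous phi2 ->
  (forall x, x \in `[a, b] -> is_derive x (1 : R) g (g1 x)) ->
  {within `[a, b], continuous g1} ->
  (forall x, x \in `[a, b] -> L <= `|phi1 x|) ->
  (forall x, x \in `[a, b] -> `|phi2 x| <= D * `|phi1 x|) ->
  (forall x, x \in `[a, b] -> `|g x| <= M) ->
  (forall x, x \in `[a, b] -> `|g1 x| <= D * M) ->
  `|\int[mu]_(x in `[a, b]) (cos (phi x) * g x)| <= (2 + 2 * D * (b - a)) * M / L.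
Proof.
move=> ab L0 D0 dphi dphi1 cphi2 dg cg1 Lphi phi2D gM g1M.
have phi10 x : x \in `[a, b] -> phi1 x != 0.
  by move=> /Lphi h; rewrite -normr_gt0 (lt_le_trans L0).
pose F x := sin (phi x) * (g x * (phi1 x)^-1).
pose f1 x := cos (phi x) * g x.
pose f2 x := sin (phi x) * (g1 x * (phi1 x)^-1 - g x * phi2 x * (phi1 x) ^- 2).
have dsin x : is_derive x (1 : R) (fun t => sin (phi t)) (cos (phi x) * phi1 x).
  exact: (is_derive1_comp (is_derive_sin _)).
have dcos x : is_derive x (1 : R) (fun t => cos (phi t)) (- sin (phi x) * phi1 x).
  exact: (is_derive1_comp (is_derive_cos _)).
have dF x : x \in `[a, b] -> is_derive x (1 : R) F (f1 x + f2 x).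
  move=> xab.
  have h1 := is_deriveV (phi10 x xab) (dphi1 x).
  have h2 := is_deriveM (dg x xab) h1.
  have h3 := is_deriveM (dsin x) h2.
  apply: (is_derive_eq h3); rewrite /f1 /f2 /GRing.scale/=.
  rewrite -[(g * _) x]/(g x * (phi1 x)^-1).
  by field; exact: phi10.
have wc (h : R -> R) (h1 : R -> R) :
    (forall x, x \in `[a, b] -> is_derive x (1 : R) h (h1 x)) ->
    {within `[a, b], continuous h}.
  by move=> dh; apply: derivable_within_continuous => x /dh[].
have cphi1V : {within `[a, b], continuous (fun x => (phi1 x)^-1)}.
  by apply: wc => x xab; exact: is_deriveV (phi10 x xab) (dphi1 x).
have cg := wc _ _ dg.
have csin : {within `[a, b], continuous (fun x => sin (phi x))}.
  by apply: wc => x _; exact: dsin.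
have ccos : {within `[a, b], continuous (fun x => cos (phi x))}.
  by apply: wc => x _; exact: dcos.
have cphi2w : {within `[a, b], continuous phi2} by exact: continuous_subspaceT.
have cf1 : {within `[a, b], continuous f1} by exact: within_continuousM.
have cf2 : {within `[a, b], continuous f2}.
  apply: within_continuousM; first exact: csin.
  apply: within_continuousB; first exact: within_continuousM.
  apply: within_continuousM; first exact: within_continuousM.
  have -> : (fun x => phi1 x ^- 2) = (fun x => (phi1 x)^-1 * (phi1 x)^-1).
    by apply/funext => t; rewrite -expr2 exprVn.
  exact: within_continuousM.
have if1 := within_continuous_integrable cf1.
have if2 := within_continuous_integrable cf2.
have cF := wc _ _ dF.
have ftc : (\int[mu]_(x in `[a, b]) (f1 x + f2 x)%:E = (F b)%:E - (F a)%:E)%E.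
  apply: (@continuous_FTC2 _ (fun x => f1 x + f2 x)) => //.
  - exact: within_continuousD.
  - have := (continuous_within_itvP F ab).1 cF => -[_ Fa Fb]; split => //.
    by move=> x xab; have [] := dF x (subset_itv_oo_cc xab).
  - move=> x xab; rewrite derive1E.
    by have [_ ->] := dF x (subset_itv_oo_cc xab).
have ftcR : \int[mu]_(x in `[a, b]) f1 x =
    F b - F a - \int[mu]_(x in `[a, b]) f2 x.
  apply/eqP; rewrite eq_sym subr_eq -RintegralD//.
  by rewrite /Rintegral ftc.
have M0 : 0 <= M.
  by apply: le_trans (normr_ge0 _) (gM a _); rewrite in_itv/= lexx ltW.
have phiVL x : x \in `[a, b] -> `|(phi1 x)^-1| <= L^-1.
  by move=> xab; rewrite normfV lef_pV2 ?posrE ?Lphi ?normr_gt0 ?phi10.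
have sin1 x : `|sin x| <= 1 :> R.
  by rewrite ler_norml sin_geN1 sin_le1.
have FM x : x \in `[a, b] -> `|F x| <= M / L.
  move=> xab; rewrite /F !normrM -[leRHS]mul1r ler_pM// ?mulr_ge0//.
  by rewrite ler_pM// ?gM// phiVL.
have f2M x : x \in `[a, b] -> `|f2 x| <= 2 * D * M / L.
  move=> xab; rewrite /f2 normrM -[leRHS]mul1r ler_pM//.
  apply: le_trans (ler_normB _ _) _.
  rewrite (_ : 2 * D * M / L = D * M / L + M * D / L); last by ring.
  apply: lerD; first by rewrite normrM ler_pM// ?g1M// phiVL.
  have -> : g x * phi2 x * phi1 x ^- 2 = g x * (phi2 x / phi1 x) * (phi1 x)^-1.
    by field; exact: phi10.
  rewrite normrM ler_pM ?phiVL// normrM ler_pM ?gM//.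
  by rewrite normrM normfV ler_pdivrMr ?phi2D// normr_gt0 phi10.
have aab : a \in `[a, b] by rewrite in_itv/= lexx ltW.
have bab : b \in `[a, b] by rewrite in_itv/= lexx ltW.
rewrite ftcR.
apply: le_trans (ler_normB _ _) _.
rewrite (_ : _ / L = (M / L + M / L) + (2 * D * M / L) * (b - a)); last by ring.
apply: lerD; last by apply: le_Rintegral_cst => //; exact: ltW.
by apply: le_trans (ler_normB _ _) _; apply: lerD; exact: FM.
Qed.

End OscillatoryIntegral.

(** * The phase on a square away from the zero lines of its mixed derivative *)

Section PhaseOnSquares.
Context {R : realType}.
Local Notation mu := (@lebesgue_measure R).
Local Notation "x %:C" := (real_complex R x).

(** A mean value theorem without an order between the two points, and with the
    intermediate point located in a fixed interval only. *)
Lemma MVT_itv (F F1 : R -> R) (a b y y' : R) :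
  (forall t : R, is_derive t (1 : R) F (F1 t)) ->
  y \in `[a, b] -> y' \in `[a, b] ->
  exists2 xi, xi \in `[a, b] & F y - F y' = F1 xi * (y - y').
Proof.
move=> dF.
have cF (u v : R) : {within `[u, v], continuous F}.
  apply: continuous_subspaceT => t.
  by apply: differentiable_continuous; apply/derivable1_diffP; have [] := dF t.
rewrite !in_itv/= => /andP[ay yb] /andP[ay' yb'].
have [yy'|y'y] := leP y y'.
- have [xi] := MVT_segment yy' (fun t _ => dF t) (cF _ _).
  rewrite in_itv/= => /andP[yx xy'] e; exists xi.
    by rewrite in_itv/= (le_trans ay yx) (le_trans xy' yb').
  by rewrite -opprB e -mulrN opprB.
- have [xi] := MVT_segment (ltW y'y) (fun t _ => dF t) (cF _ _).
  rewrite in_itv/= => /andP[yx xy'] e; exists xi => //.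
  by rewrite in_itv/= (le_trans ay' yx) (le_trans xy' yb).
Qed.

(** The phase differences [x |-> S (x, y) - S (x, y')]: by the mean value theorem in
    [y] their first derivative is governed by the mixed derivative [S_xy], and by
    Cauchy's mean value theorem the ratio of their second and first derivatives is a
    value of [S_xxy / S_xy]. *)
Lemma phase_difference_bounds (N : nat) (b : nat -> R) (cs : seq R[i])
    (t ya yb x y y' : R) :
  let c := formY N.+1 (formX N.+2 b) in
  form_roots N c cs -> 0 < t ->
  y \in `[ya, yb] -> y' \in `[ya, yb] ->
  (forall w, w \in `[ya, yb] ->
    forall z, z \in cs -> t <= Normc.normc (w%:C - z * x%:C)) ->
  let G := form N.+1 (formX N.+2 b) x in
  let F := form N (formX N.+1 (formX N.+2 b)) x in
  `|c N| * t ^+ N * `|y - y'| <= `|G y - G y'| /\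
  `|F y - F y'| <= (\sum_(z <- cs) Normc.normc z) / t * `|G y - G y'|.
Proof.
move=> c [scs cN cE cX] t0 yab y'ab tcs G F.
have lbd w : w \in `[ya, yb] -> `|c N| * t ^+ N <= `|form N c x w|.
  move=> wab; rewrite cE ler_wpM2l//.
  have -> : t ^+ N = \prod_(z <- cs) t.
    by rewrite big_const_seq count_predT scs iter_mulr_1.
  rewrite !big_seq; apply: ler_prod => z zcs.
  by rewrite (ltW t0) tcs.
have dG w : is_derive w (1 : R) G (form N c x w) by exact: is_derive_formY.
have dF w : is_derive w (1 : R) F (form N.-1 (formX N c) x w).
  rewrite /c -[N in formX N _]/(N.+1.-1) -formYX; exact: is_derive_formY.
split.
  have [xi xiab ->] := MVT_itv dG yab y'ab.
  by rewrite normrM ler_wpM2r// lbd.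
(* Cauchy's mean value theorem, in multiplicative form: [H y = H y'] *)
pose H w := (G y - G y') * F w - (F y - F y') * G w.
have dH w : is_derive w (1 : R) H
    ((G y - G y') * form N.-1 (formX N c) x w - (F y - F y') * form N c x w).
  by apply: is_deriveB; apply: is_deriveZ.
have [xi xiab] := MVT_itv dH yab y'ab.
have [->|yy'] := eqVneq y y'.
  by move=> _; rewrite !subrr normr0 mulr0.
have -> : H y - H y' = 0 by rewrite /H; ring.
move=> /esym/eqP; rewrite mulf_eq0 (subr_eq0 y) (negbTE yy') orbF subr_eq0.
move=> /eqP e.
have cxi : 0 < `|form N c x xi|.
  by apply: lt_le_trans (lbd _ xiab); rewrite mulr_gt0 ?normr_gt0// exprn_gt0.
rewrite -(ler_pM2r cxi) -normrM -e normrM mulrC [leRHS]mulrAC ler_wpM2r//.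
by apply: cX => //; exact: tcs.
Qed.

Definition kernel_gain (D0 cN : R) : R := 1 + (2 + 2 * D0) / `|cN|.

(** The kernel of [T^* T] on a square. It is bounded trivially when
    [lam * rho ^ N.+1 * |y - y'| <= 1], and by integration by parts otherwise. *)
Lemma square_kernel_bound (N : nat) (b : nat -> R) (cs : seq R[i])
    (D0 D1 M lam rho xa ya y y' : R) (u u1 : R * R -> R) :
  let c := formY N.+1 (formX N.+2 b) in
  form_roots N c cs -> 0 < rho -> 0 < lam ->
  (forall x y, x \in `[xa, xa + rho] -> y \in `[ya, ya + rho] ->
    forall z, z \in cs -> rho <= Normc.normc (y%:C - z * x%:C)) ->
  (forall x y, x \in `[xa, xa + rho] -> y \in `[ya, ya + rho] ->
     [/\ is_derive x (1 : R) (fun s => u (s, y)) (u1 (x, y)),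
         `|u (x, y)| <= M & `|u1 (x, y)| <= D1 / rho * M]) ->
  (forall y, y \in `[ya, ya + rho] ->
     {within `[xa, xa + rho], continuous (fun x => u1 (x, y))}) ->
  \sum_(z <- cs) Normc.normc z <= D0 -> 2 * D1 <= D0 ->
  y \in `[ya, ya + rho] -> y' \in `[ya, ya + rho] ->
  `|\int[mu]_(x in `[xa, xa + rho])
     (cos (lam * (form N.+2 b x y - form N.+2 b x y')) * (u (x, y) * u (x, y')))|
  <= kernel_gain D0 (c N) * M ^+ 2 * rho * (2 / (1 + lam * rho ^+ N.+1 * `|y - y'|)).
Proof.
move=> c croots rho0 lam0 rcs uu1 cu1 csD0 D10 yJ y'J.
have xab : xa < xa + rho by rewrite ltrDl.
have D00 : 0 <= D0.
  by apply: le_trans csD0; apply: sumr_ge0 => z _; exact: normc_ge0.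
have M0 : 0 <= M.
  have xI : xa \in `[xa, xa + rho] by rewrite in_itv/= lexx ltW.
  by have [_ h _] := uu1 _ _ xI yJ; apply: le_trans h.
pose g x := u (x, y) * u (x, y').
pose g1 x := u (x, y) * u1 (x, y') + u (x, y') * u1 (x, y).
have dg x : x \in `[xa, xa + rho] -> is_derive x (1 : R) g (g1 x).
  move=> xI; have [d1 _ _] := uu1 _ _ xI yJ; have [d2 _ _] := uu1 _ _ xI y'J.
  exact: is_deriveM d1 d2.
have cu w : w \in `[ya, ya + rho] ->
    {within `[xa, xa + rho], continuous (fun x => u (x, w))}.
  move=> wJ; apply: derivable_within_continuous => x xI.
  by have [[]] := uu1 _ _ xI wJ.
have cg1 : {within `[xa, xa + rho], continuous g1}.
  by apply: within_continuousD; apply: within_continuousM => //;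
    [exact: cu|exact: cu1|exact: cu|exact: cu1].
have gM x : x \in `[xa, xa + rho] -> `|g x| <= M ^+ 2.
  move=> xI; have [_ h1 _] := uu1 _ _ xI yJ; have [_ h2 _] := uu1 _ _ xI y'J.
  by rewrite /g normrM expr2 ler_pM.
pose phi x := lam * (form N.+2 b x y - form N.+2 b x y').
have ccg : {within `[xa, xa + rho], continuous (fun x => cos (phi x) * g x)}.
  apply: within_continuousM; last by apply: within_continuousM; exact: cu.
  apply: continuous_subspaceT => x.
  apply: continuous_comp; last exact: continuous_cos.
  apply: cvgM; first exact: cvg_cst.
  by apply: cvgB; exact: continuous_formX.
have bnd1 : `|\int[mu]_(x in `[xa, xa + rho]) (cos (phi x) * g x)| <= M ^+ 2 * rho.
  have := @le_Rintegral_cst R xa (xa + rho) (fun x => cos (phi x) * g x) (M ^+ 2).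
  rewrite [xa + rho - xa]addrAC subrr add0r; apply.
  - exact: ltW.
  - exact: within_continuous_integrable.
  move=> x xI; rewrite normrM -[leRHS]mul1r ler_pM ?gM//.
  by rewrite ler_norml cos_geN1 cos_le1.
set I := `|\int[mu]_(x in _) _| in bnd1 *.
set A := lam * rho ^+ N.+1.
have A0 : 0 < A by rewrite mulr_gt0// exprn_gt0.
have cN0 : 0 < `|c N| by case: croots => _ cN _ _; rewrite normr_gt0.
have K1 : 1 <= kernel_gain D0 (c N).
  rewrite /kernel_gain lerDl divr_ge0// addr_ge0// mulr_ge0//.
(* where the phase difference is at most of order one there is nothing to gain *)
have [Ay|Ay] := leP (A * `|y - y'|) 1.
  apply: (le_trans bnd1); rewrite -[leLHS]mulr1; apply: ler_pM => //.
  - by rewrite mulr_ge0 ?sqr_ge0// ltW.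
  - by rewrite -[leLHS]mul1r -mulrA ler_wpM2r// mulr_ge0 ?sqr_ge0// ltW.
  - have : 0 <= A * `|y - y'| by rewrite mulr_ge0// ltW.
    by move=> ?; rewrite ler_pdivlMr; lra.
have yy' : y != y' by apply: contraTneq Ay => ->; rewrite subrr normr0 mulr0 ltr10.
have w0 : 0 < `|y - y'| by rewrite normr_gt0 subr_eq0.
pose L := lam * (`|c N| * rho ^+ N * `|y - y'|).
have L0 : 0 < L by rewrite !mulr_gt0// exprn_gt0.
have bnd2 : I <= (2 + 2 * (D0 / rho) * (xa + rho - xa)) * M ^+ 2 / L.
  apply: (@oscillatory_integral_bound R xa (xa + rho) L (D0 / rho) (M ^+ 2) phi
    (fun x => lam * (form N.+1 (formX N.+2 b) x y - form N.+1 (formX N.+2 b) x y'))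
    (fun x => lam * (form N (formX N.+1 (formX N.+2 b)) x y -
                     form N (formX N.+1 (formX N.+2 b)) x y')) g g1) => //.
  - by rewrite divr_ge0// ltW.
  - by move=> x; apply: is_deriveZ; apply: is_deriveB; exact: is_derive_formX.
  - by move=> x; apply: is_deriveZ; apply: is_deriveB; exact: is_derive_formX.
  - move=> x; apply: cvgM; first exact: cvg_cst.
    by apply: cvgB; exact: continuous_formX.
  - move=> x xI.
    have [h _] := phase_difference_bounds croots rho0 yJ y'J
      (fun w wJ => rcs x w xI wJ).
    by rewrite normrM (gtr0_norm lam0) ler_wpM2l// ltW.
  - move=> x xI.
    have [_ h] := phase_difference_bounds croots rho0 yJ y'J
      (fun w wJ => rcs x w xI wJ).
    rewrite !normrM (gtr0_norm lam0) mulrCA ler_wpM2l ?(ltW lam0)//.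
    apply: (le_trans h); rewrite ler_wpM2r// ler_wpM2r// invr_ge0 ltW//.
  - move=> x xI; have [_ h1 k1] := uu1 _ _ xI yJ; have [_ h2 k2] := uu1 _ _ xI y'J.
    apply: le_trans (ler_normD _ _) _; rewrite !normrM.
    apply: (@le_trans _ _ (M * (D1 / rho * M) + M * (D1 / rho * M))).
      by apply: lerD; apply: ler_pM.
    rewrite (_ : _ + _ = (2 * D1) / rho * M ^+ 2); last by ring.
    by rewrite ler_wpM2r ?sqr_ge0// ler_wpM2r// invr_ge0 ltW.
have LE : L = `|c N| * (A * `|y - y'|) / rho.
  by rewrite /L /A exprS; field; rewrite gt_eqF.
apply: (le_trans bnd2).
rewrite (_ : (_ + _) * _ / L =
    ((2 + 2 * D0) / `|c N|) * M ^+ 2 * rho * (A * `|y - y'|)^-1); last first.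
  by rewrite LE; field; rewrite !gt_eqF.
apply: ler_pM.
- by rewrite !mulr_ge0 ?sqr_ge0 ?invr_ge0 ?addr_ge0 ?mulr_ge0// ltW.
- by rewrite invr_ge0 (le_trans ler01)// ltW.
- by rewrite ler_wpM2r ?(ltW rho0)// ler_wpM2r ?sqr_ge0// /kernel_gain lerDr.
- rewrite -[leLHS]mul1r ler_pdivrMr ?(lt_trans ltr01)//.
  rewrite mulrAC ler_pdivlMr; last by lra.
  lra.
Qed.

End PhaseOnSquares.

(* [discriminate], part of the default closing tactic, unfolds every inequality
   between real numbers it meets, and never succeeds on one. *)
#[local] Ltac done ::=
  trivial; hnf; intros; solve
   [ do ![solve [trivial | apply: sym_equal; trivial]
         | contradiction | split]
   | match goal with
     | H : is_true false |- _ => discriminate H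
     | H : false = true |- _ => discriminate H
     | H : ~ _ |- _ => solve [case H; trivial]
     end ].

(** * Kernel operators, their adjoints and their square functions *)

Section KernelOperators.
Context {d : measure_display} {T : measurableType d} {R : realType}.
Variable mu : {sigma_finite_measure set T -> \bar R}.
Implicit Types (k : T * T -> R) (f g : T -> R) (A B : set T).

Definition kernel_op k f (x : T) : R := \int[mu]_y (k (x, y) * f y).

Definition transpose k : T * T -> R := fun z => k (z.2, z.1).

Lemma measurable_transpose k :
  measurable_fun setT k -> measurable_fun setT (transpose k).
Proof. by move=> mk; exact: (measurableT_comp mk (@measurable_swap _ _ T T)). Qed.

Lemma integrable_measurable (D : set T) f :
  mu.-integrable D (EFin \o f) -> measurable_fun D f.
Proof. by move=> /measurable_int /measurable_EFinP. Qed.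

Lemma integrable_bounded_mul f g (M : R) :
  measurable_fun setT g -> (forall x, `|g x| <= M) ->
  mu.-integrable setT (EFin \o f) ->
  mu.-integrable setT (fun x => (g x * f x)%:E).
Proof.
move=> mg gM fi; have mf := integrable_measurable fi.
apply: (@le_integrable _ _ _ mu setT _ _ (fun x => (M%:E * (f x)%:E)%E)) => //.
- by apply/measurable_EFinP; exact: measurable_funM.
- move=> x _; rewrite -EFinM !abse_EFin lee_fin !normrM ler_wpM2r//.
  by apply: le_trans (gM x) _; rewrite ler_norm.
- exact: integrableZl.
Qed.

Section bounded_kernel.
Variables (k : T * T -> R) (M : R).
Hypothesis mk : measurable_fun setT k.
Hypothesis kM : forall z, `|k z| <= M.

Let M0 : 0 <= M. Proof. exact: le_trans (normr_ge0 _) (kM (point, point)). Qed.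

Let mk1 x : measurable_fun setT (fun y => k (x, y)).
Proof. exact: (measurableT_comp mk (pair1_measurable x)). Qed.

Lemma kernel_op_integrand f x : mu.-integrable setT (EFin \o f) ->
  mu.-integrable setT (fun y => (k (x, y) * f y)%:E).
Proof. by move=> fi; apply: (integrable_bounded_mul (mk1 x) _ fi). Qed.

Lemma le_kernel_op f x : mu.-integrable setT (EFin \o f) ->
  `|kernel_op k f x| <= M * \int[mu]_y `|f y|.
Proof.
move=> fi; have ki := kernel_op_integrand x fi.
have fni : mu.-integrable setT (EFin \o (Num.norm \o f)) by exact: integrable_norm.
apply: le_trans (le_normr_Rintegral _ ki) _ => //.
rewrite -RintegralZl//; apply: le_Rintegral => //.
- exact: (integrable_norm ki).
- by have := integrableZl measurableT M fni; apply: eq_integrable.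
- by move=> y _; rewrite normrM ler_wpM2r.
Qed.

Lemma integrable_kernel_prod f g :
  mu.-integrable setT (EFin \o f) -> mu.-integrable setT (EFin \o g) ->
  (mu \x mu)%E.-integrable setT (fun z : T * T => (g z.1 * (k z * f z.2))%:E).
Proof.
move=> fi gi; have mf := integrable_measurable fi; have mg := integrable_measurable gi.
have mgkf : measurable_fun setT (fun z : T * T => g z.1 * (k z * f z.2)).
  apply: measurable_funM; first exact: measurableT_comp mg measurable_fst.
  by apply: measurable_funM => //; exact: measurableT_comp mf measurable_snd.
apply/integrable12ltyP; first exact/measurable_EFinP.
have /integrableP[_ foo] := fi; have /integrableP[_ goo] := gi.
have mfE : measurable_fun setT (fun y => `|(f y)%:E|%E).
  by apply: measurableT_comp => //; exact/measurable_EFinP.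
have mgE : measurable_fun setT (fun y => `|(g y)%:E|%E).
  by apply: measurableT_comp => //; exact/measurable_EFinP.
set c := (M%:E * \int[mu]_y `|(f y)%:E|)%E.
have c0 : (0 <= c)%E by rewrite mule_ge0 ?lee_fin// integral_ge0.
have coo : (c < +oo)%E.
  by rewrite lte_mul_pinfty// ?lee_fin//.
apply: (@le_lt_trans _ _ (\int[mu]_x (c * `|(g x)%:E|))%E).
  apply: ge0_le_integral => //.
  - by move=> x _; apply: integral_ge0.
  - apply: (@measurable_fun_fubini_tonelli_F _ _ _ _ _ mu
      (fun z : T * T => `|(g z.1 * (k z * f z.2))%:E|%E)) => //.
    by apply: measurableT_comp => //; exact/measurable_EFinP.
  - by apply: emeasurable_funM => //; exact: measurable_cst.
  - move=> x _.
    have -> : (c * `|(g x)%:E| = \int[mu]_y ((M * `|g x|)%:E * `|(f y)%:E|))%E.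
      rewrite ge0_integralZl//; last by rewrite lee_fin mulr_ge0.
      by rewrite /c EFinM -!muleA; congr (_ * _)%E; rewrite muleC.
    apply: ge0_le_integral => //.
    + apply: measurableT_comp => //; apply/measurable_EFinP.
      exact: (measurableT_comp mgkf (pair1_measurable x)).
    + by apply: emeasurable_funM => //; exact: measurable_cst.
    + move=> y _; rewrite /= -EFinM lee_fin !normrM mulrA ler_wpM2r//.
      by rewrite mulrC ler_wpM2r.
by rewrite ge0_integralZl// lte_mul_pinfty// ge0_fin_numE.
Qed.

(** Fubini's theorem. *)
Lemma kernel_op_adjoint f g :
  mu.-integrable setT (EFin \o f) -> mu.-integrable setT (EFin \o g) ->
  \int[mu]_x (g x * kernel_op k f x) =
  \int[mu]_y (f y * kernel_op (transpose k) g y).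
Proof.
move=> fi gi.
have H := integrable_kernel_prod fi gi.
have mf := integrable_measurable fi; have mg := integrable_measurable gi.
have := Fubini H => /= HF.
rewrite /Rintegral.
rewrite (_ : (\int[mu]_x (g x * kernel_op k f x)%:E)%E =
  (\int[mu]_x \int[mu]_y (g x * (k (x, y) * f y))%:E)%E); last first.
  apply: eq_integral => x _.
  under eq_integral do rewrite EFinM.
  rewrite integralZl//; last exact: kernel_op_integrand.
  by rewrite EFinM /kernel_op /Rintegral fineK// integrable_fin_num//;
    exact: kernel_op_integrand.
rewrite HF; congr fine; apply: eq_integral => y _.
have gki : mu.-integrable setT (fun x => (k (x, y) * g x)%:E).
  apply: (@integrable_bounded_mul g (fun x => k (x, y)) M) => //.
  exact: (measurableT_comp mk (pair2_measurable y)).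
under eq_integral => x _.
  rewrite (_ : g x * (k (x, y) * f y) = f y * (k (x, y) * g x)); last by ring.
  rewrite EFinM.
  over.
rewrite integralZl//.
rewrite EFinM /kernel_op /Rintegral fineK// integrable_fin_num//.
Qed.

End bounded_kernel.

Lemma integrable_indic_finite A : measurable A -> (mu A < +oo)%E ->
  mu.-integrable setT (EFin \o (\1_A : T -> R)).
Proof.
move=> mA Afin; apply/integrableP; split; first by apply/measurable_EFinP.
under eq_integral => x _ do rewrite /= ger0_norm//.
by rewrite integral_indic// setIT.
Qed.

(** Carried by [A `*` B]: with [A] and [B] of finite measure, all the integrals below
    converge absolutely. *)
Definition box_kernel (M : R) A B k :=
  [/\ measurable_fun setT k, (forall z, `|k z| <= M),
      (forall z, ~ A z.1 -> k z = 0) & (forall z, ~ B z.2 -> k z = 0)].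

Lemma box_kernel_transpose M A B k :
  box_kernel M A B k -> box_kernel M B A (transpose k).
Proof.
move=> [mk kM kA kB]; split.
- exact: measurable_transpose.
- by move=> z; exact: kM.
- by move=> z Bz; exact: kB.
- by move=> z Az; exact: kA.
Qed.

Lemma integrable_kernel_op M A B k f : box_kernel M A B k ->
  measurable A -> (mu A < +oo)%E -> mu.-integrable setT (EFin \o f) ->
  mu.-integrable setT (EFin \o kernel_op k f).
Proof.
move=> [mk kM kA _] mA Afin fi.
have := integrable_fubini_F
  (integrable_kernel_prod mk kM fi (integrable_indic_finite mA Afin)).
apply: eq_integrable => // x _ /=.
rewrite /fubini_F/= /kernel_op /Rintegral fineK; last first.
  by rewrite integrable_fin_num//; exact: (kernel_op_integrand mk kM).
apply: eq_integral => y _; rewrite indicE.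
case: (boolP (x \in A)) => [_|/negP xA]; first by rewrite mul1r.
by rewrite kA ?mul0r// => /mem_set.
Qed.

Lemma integrable_mul_bounded f g (M : R) :
  mu.-integrable setT (EFin \o f) -> mu.-integrable setT (EFin \o g) ->
  (forall x, `|g x| <= M) -> mu.-integrable setT (fun x => (g x * f x)%:E).
Proof.
by move=> fi gi gM; apply: integrable_bounded_mul gM fi; exact: integrable_measurable.
Qed.

Section square_function.
Variables (M : R) (A B : set T).
Hypothesis mA : measurable A.
Hypothesis mB : measurable B.
Hypothesis Afin : (mu A < +oo)%E.
Hypothesis Bfin : (mu B < +oo)%E.

Lemma integrable_section k y : box_kernel M A B k ->
  mu.-integrable setT (EFin \o (fun x => k (x, y))).
Proof.
move=> [mk kM kA _].
have := integrable_bounded_mul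
  (measurableT_comp mk (pair2_measurable y)) (fun x => kM (x, y))
  (integrable_indic_finite mA Afin).
apply: eq_integrable => // x _ /=; rewrite indicE.
case: (boolP (x \in A)) => [_|/negP xA]; first by rewrite mulr1.
by rewrite kA ?mul0r// => /mem_set.
Qed.

(** The kernel of [T^* T]. *)
Definition gram k (y y' : T) := \int[mu]_x (k (x, y) * k (x, y')).

Lemma gram_kernel_op k y : gram k y = kernel_op (transpose k) (fun x => k (x, y)).
Proof.
by apply/funext => y'; apply: eq_Rintegral => x _; rewrite /transpose/= mulrC.
Qed.

Lemma gram_integrand k y y' : box_kernel M A B k ->
  mu.-integrable setT (fun x => (k (x, y) * k (x, y'))%:E).
Proof.
move=> bk; have [mk kM _ _] := bk.
exact: integrable_mul_bounded (integrable_section y' bk) (integrable_section y bk)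
  (fun x => kM (x, y)).
Qed.

Lemma integrable_gram k f y : box_kernel M A B k ->
  mu.-integrable setT (EFin \o f) ->
  mu.-integrable setT (fun y' => (f y' * gram k y y')%:E).
Proof.
move=> bk fi; have btk := box_kernel_transpose bk; have [mtk tkM _ _] := btk.
have si := integrable_section y bk.
have := integrable_mul_bounded fi (integrable_kernel_op btk mB Bfin si)
  (fun y' => le_kernel_op mtk tkM y' si).
by apply: eq_integrable => // y' _ /=; rewrite gram_kernel_op mulrC.
Qed.

(** The identity between [(T f, T f)] and [(f, T^* T f)]. *)
Lemma sqr_kernel_op k f : box_kernel M A B k -> mu.-integrable setT (EFin \o f) ->
  [/\ mu.-integrable setT (fun x => (kernel_op k f x ^+ 2)%:E),
    \int[mu]_x (kernel_op k f x ^+ 2) =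
      \int[mu]_y (f y * \int[mu]_y' (f y' * gram k y y')) &
    mu.-integrable setT (fun y => (f y * \int[mu]_y' (f y' * gram k y y'))%:E)].
Proof.
move=> bk fi; have btk := box_kernel_transpose bk; have [mtk tkM _ _] := btk.
have [mk kM _ _] := bk.
have opi := integrable_kernel_op bk mA Afin fi.
have opM := fun x => le_kernel_op mk kM x fi.
have inner y : \int[mu]_y' (f y' * gram k y y') =
    kernel_op (transpose k) (kernel_op k f) y.
  have -> : kernel_op (transpose k) (kernel_op k f) y =
     \int[mu]_x (k (x, y) * kernel_op k f x) by [].
  rewrite (kernel_op_adjoint mk kM fi (integrable_section y bk)).
  by apply: eq_Rintegral => y' _; rewrite gram_kernel_op.
have iopi := integrable_kernel_op btk mB Bfin opi.
split.
- have := integrable_mul_bounded opi opi opM; exact: eq_integrable.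
- under eq_Rintegral do rewrite expr2.
  rewrite (kernel_op_adjoint mk kM fi opi).
  by apply: eq_Rintegral => y _; rewrite inner.
- have := integrable_mul_bounded fi iopi (fun y => le_kernel_op mtk tkM y opi).
  by apply: eq_integrable => // y _ /=; rewrite inner mulrC.
Qed.

(** A cosine and a sine kernel are treated together, because the sum of their Gram
    kernels contains the cosine of the difference of the phases and no cosine of
    their sum. *)
Lemma sqr_kernel_op_pair k1 k2 f : box_kernel M A B k1 -> box_kernel M A B k2 ->
  mu.-integrable setT (EFin \o f) ->
  [/\ mu.-integrable setT (fun x => (kernel_op k1 f x ^+ 2 + kernel_op k2 f x ^+ 2)%:E),
   mu.-integrable setT
     (fun y => (f y * \int[mu]_y' (f y' * (gram k1 y y' + gram k2 y y')))%:E) &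
   \int[mu]_x (kernel_op k1 f x ^+ 2 + kernel_op k2 f x ^+ 2) =
   \int[mu]_y (f y * \int[mu]_y' (f y' * (gram k1 y y' + gram k2 y y')))].
Proof.
move=> bk1 bk2 fi.
have [i1 e1 j1] := sqr_kernel_op bk1 fi.
have [i2 e2 j2] := sqr_kernel_op bk2 fi.
have inner y : f y * \int[mu]_y' (f y' * (gram k1 y y' + gram k2 y y')) =
    f y * \int[mu]_y' (f y' * gram k1 y y') + f y * \int[mu]_y' (f y' * gram k2 y y').
  rewrite -mulrDr -RintegralD//.
  - by congr (_ * _); apply: eq_Rintegral => y' _; rewrite mulrDr.
  - exact: integrable_gram.
  - exact: integrable_gram.
split.
- exact: (integrableD _ i1 i2).
- by have := integrableD measurableT j1 j2; apply: eq_integrable => // y _ /=; rewrite inner.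
- have eD := RintegralD measurableT i1 i2.
  rewrite e1 e2 in eD; rewrite {}eD.
  have eD := RintegralD measurableT j1 j2.
  rewrite -{}eD; apply: eq_Rintegral => y _; exact/esym/inner.
Qed.

(** Schur's test for the quadratic form, by the elementary inequality
    [2 s t <= s^2 + t^2] and Tonelli's theorem. *)
Lemma sqr_kernel_op_schur k1 k2 f (W : T * T -> R) (c : R) : 0 <= c ->
  box_kernel M A B k1 -> box_kernel M A B k2 ->
  mu.-integrable setT (EFin \o f) -> (forall y, ~ B y -> f y = 0) ->
  measurable_fun setT W -> (forall z, 0 <= W z) ->
  (forall y y', W (y, y') = W (y', y)) ->
  (forall y y', B y -> B y' -> `|gram k1 y y' + gram k2 y y'| <= W (y, y')) ->
  (forall y, B y -> (\int[mu]_(y' in B) (W (y, y'))%:E <= c%:E)%E) ->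
  (\int[mu]_x (kernel_op k1 f x ^+ 2 + kernel_op k2 f x ^+ 2)%:E <=
   c%:E * \int[mu]_y (f y ^+ 2)%:E)%E.
Proof.
move=> c0 bk1 bk2 fi fB mW W0 Wsym kW Wc.
have mf := integrable_measurable fi.
have [opi gi e] := sqr_kernel_op_pair bk1 bk2 fi.
have -> : (\int[mu]_x (kernel_op k1 f x ^+ 2 + kernel_op k2 f x ^+ 2)%:E =
    \int[mu]_y (f y * \int[mu]_y' (f y' * (gram k1 y y' + gram k2 y y')))%:E)%E.
  by move: (congr1 EFin e); rewrite /Rintegral !fineK// integrable_fin_num.
apply: le_trans (lee_abs _) _.
apply: le_trans (le_abse_integral _ _ _) _ => //; first exact: measurable_int gi.
pose W1 (z : T * T) := W z * (\1_B z.1 * \1_B z.2).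
have mB1 : measurable_fun setT (fun z : T * T => \1_B z.1 : R).
  exact: (measurableT_comp (measurable_indic mB) measurable_fst).
have mB2 : measurable_fun setT (fun z : T * T => \1_B z.2 : R).
  exact: (measurableT_comp (measurable_indic mB) measurable_snd).
have mW1 : measurable_fun setT W1.
  by apply: measurable_funM => //; exact: measurable_funM.
have W10 z : 0 <= W1 z by rewrite /W1 !mulr_ge0.
pose H (z : T * T) := W1 z * (f z.1 ^+ 2).
have mH : measurable_fun setT H.
  apply: measurable_funM => //; apply: measurable_funX.
  exact: measurableT_comp mf measurable_fst.
have H0 z : 0 <= H z by rewrite /H mulr_ge0 ?sqr_ge0.
pose H' (z : T * T) := W1 z * (f z.2 ^+ 2).
have mH' : measurable_fun setT H'.
  apply: measurable_funM => //; apply: measurable_funX.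
  exact: measurableT_comp mf measurable_snd.
have H'0 z : 0 <= H' z by rewrite /H' mulr_ge0 ?sqr_ge0.
have sect (h : T * T -> R) y : measurable_fun setT h ->
    measurable_fun setT (fun y' => (h (y, y'))%:E).
  move=> mh; apply/measurable_EFinP.
  exact: (measurableT_comp mh (pair1_measurable y)).
have HH' : (\int[mu]_y \int[mu]_y' (H (y, y'))%:E = \int[mu]_y \int[mu]_y' (H' (y, y'))%:E)%E.
  have mHE : measurable_fun setT (fun z => (H z)%:E) by exact/measurable_EFinP.
  have HE0 z : (0 <= (H z)%:E)%E by rewrite lee_fin.
  have ft := @fubini_tonelli _ _ _ _ _ mu mu _ mHE HE0.
  apply: (etrans ft); apply: eq_integral => y _; apply: eq_integral => y' _.
  by rewrite /H /H' /W1 /= Wsym; congr (EFin _); ring.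
have Hle : (\int[mu]_y \int[mu]_y' (H (y, y'))%:E <= c%:E * \int[mu]_y (f y ^+ 2)%:E)%E.
  rewrite -ge0_integralZl//; last 2 first.
  - by apply/measurable_EFinP; exact: measurable_funX.
  - by move=> y _; rewrite lee_fin sqr_ge0.
  apply: ge0_le_integral => //.
  - by move=> y _; apply: integral_ge0 => y' _; rewrite lee_fin.
  - apply: (measurable_fun_fubini_tonelli_F (m2 := mu) (fun z => (H z)%:E)).
      exact/measurable_EFinP.
    by move=> z; rewrite lee_fin.
  - apply/measurable_EFinP; apply: measurable_funM => //; exact: measurable_funX.
  move=> y _; have [By|nBy] := pselect (B y); last first.
    rewrite fB// expr0n/= mule0.
    by rewrite integral0_eq// => y' _; rewrite /H fB//= expr0n mulr0.
  have -> : (\int[mu]_y' (H (y, y'))%:E =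
      (f y ^+ 2)%:E * \int[mu]_(y' in B) (W (y, y'))%:E)%E.
    rewrite [in RHS]integral_mkcond -ge0_integralZl//.
    - apply: eq_integral => y' _; rewrite /H /W1/= patchE !indicE (mem_set By).
      case: (y' \in B).
        by rewrite -EFinM; congr EFin; rewrite !mulr1; exact: mulrC.
      by rewrite !mulr0 mul0r; exact/esym/mule0.
    - apply: (measurable_restrictT _ _).1 => //.
      by apply: measurable_funTS; exact: sect.
    - by move=> y' _; apply: erestrict_ge0 => ? _; rewrite lee_fin.
    - by rewrite lee_fin sqr_ge0.
  by rewrite muleC lee_wpmul2r ?lee_fin ?sqr_ge0// Wc.
have HH0 (z : T * T) : 0 <= 2^-1 * H z + 2^-1 * H' z.
  by rewrite addr_ge0// mulr_ge0.
have mHH' : measurable_fun setT (fun z : T * T => 2^-1 * H z + 2^-1 * H' z).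
  by apply: measurable_funD; apply: measurable_funM.
apply: (@le_trans _ _ (\int[mu]_y \int[mu]_y' ((2^-1 * H (y, y') + 2^-1 * H' (y, y'))%:E))%E).
  apply: ge0_le_integral => //.
  - by apply: measurableT_comp => //; exact: measurable_int gi.
  - apply: (measurable_fun_fubini_tonelli_F (m2 := mu)
      (fun z => (2^-1 * H z + 2^-1 * H' z)%:E)).
      exact/measurable_EFinP.
    by move=> z; rewrite lee_fin; exact: HH0.
  move=> y _; rewrite EFinM abseM.
  have ig1 := integrable_gram y bk1 fi; have ig2 := integrable_gram y bk2 fi.
  have ig : mu.-integrable setT (fun y' => (f y' * (gram k1 y y' + gram k2 y y'))%:E).
    have := integrableD measurableT ig1 ig2; apply: eq_integrable => // y' _ /=.
    by rewrite mulrDr.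
  have -> : (`|(\int[mu]_y' (f y' * (gram k1 y y' + gram k2 y y')))%:E| =
     `|\int[mu]_y' (f y' * (gram k1 y y' + gram k2 y y'))%:E|)%E.
    by rewrite /Rintegral fineK// integrable_fin_num.
  apply: (@le_trans _ _ (`|(f y)%:E| *
    \int[mu]_y' `|(f y' * (gram k1 y y' + gram k2 y y'))%:E|)%E).
    by rewrite lee_wpmul2l// le_abse_integral//; exact: measurable_int ig.
  have mig := measurable_int _ ig.
  rewrite -ge0_integralZl//; last exact: measurableT_comp.
  apply: ge0_le_integral => //.
  - by apply: emeasurable_funM => //; exact: measurableT_comp.
  - exact: (sect (fun z => 2^-1 * H z + 2^-1 * H' z)).
  move=> y' _; rewrite !abse_EFin -EFinM lee_fin !normrM.
  have [By|nBy] := pselect (B y); last first.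
    by rewrite (fB y)// normr0 mul0r; exact: HH0.
  have [By'|nBy'] := pselect (B y'); last first.
    by rewrite (fB y')// normr0 mul0r mulr0; exact: HH0.
  rewrite /H /H' /W1/=.
  rewrite !indicE (mem_set By) (mem_set By')/= !mulr1.
  rewrite -(real_normK (num_real (f y))) -(real_normK (num_real (f y'))).
  have k12 := kW _ _ By By'.
  apply: (@le_trans _ _ (`|f y| * `|f y'| * W (y, y'))).
    by rewrite mulrA ler_wpM2l ?mulr_ge0.
  have := mulr_ge0 (W0 (y, y')) (sqr_ge0 (`|f y| - `|f y'|)).
  by rewrite sqrrB -subr_ge0 => h; rewrite -subr_ge0; lra.
have eq2 : (\int[mu]_y \int[mu]_y' (2^-1 * H (y, y') + 2^-1 * H' (y, y'))%:E =
   \int[mu]_y \int[mu]_y' (H (y, y'))%:E)%E.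
  have half (h : T * T -> R) : measurable_fun setT h -> (forall z, 0 <= h z) ->
     (\int[mu]_y \int[mu]_y' (2^-1 * h (y, y'))%:E =
      2^-1%:E * \int[mu]_y \int[mu]_y' (h (y, y'))%:E)%E.
    move=> mh h0; rewrite -ge0_integralZl//; last 2 first.
    - apply: (measurable_fun_fubini_tonelli_F (m2 := mu) (fun z => (h z)%:E)).
        exact/measurable_EFinP.
      by move=> z; rewrite lee_fin.
    - by move=> y _; apply: integral_ge0 => y' _; rewrite lee_fin.
    apply: eq_integral => y _; rewrite -ge0_integralZl//; first exact: sect.
    by move=> y' _; rewrite lee_fin.
  have mhalf (h : T * T -> R) : measurable_fun setT h ->
      measurable_fun setT (fun z => 2^-1 * h z).
    by move=> mh; apply: measurable_funM.
  under eq_integral => y _.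
    rewrite (_ : (\int[mu]_y' _ = \int[mu]_y' (2^-1 * H (y, y'))%:E +
       \int[mu]_y' (2^-1 * H' (y, y'))%:E)%E); last first.
      rewrite -ge0_integralD//.
      - by move=> y' _; rewrite lee_fin mulr_ge0.
      - by apply: (sect (fun z => 2^-1 * H z)); exact: mhalf.
      - by move=> y' _; rewrite lee_fin mulr_ge0.
      - by apply: (sect (fun z => 2^-1 * H' z)); exact: mhalf.
    over.
  rewrite ge0_integralD//; last 4 first.
  - by move=> y _; apply: integral_ge0 => y' _; rewrite lee_fin mulr_ge0.
  - apply: (measurable_fun_fubini_tonelli_F (m2 := mu) (fun z => (2^-1 * H z)%:E)).
      by apply/measurable_EFinP; exact: mhalf.
    by move=> z; rewrite lee_fin mulr_ge0.
  - by move=> y _; apply: integral_ge0 => y' _; rewrite lee_fin mulr_ge0.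
  - apply: (measurable_fun_fubini_tonelli_F (m2 := mu) (fun z => (2^-1 * H' z)%:E)).
      by apply/measurable_EFinP; exact: mhalf.
    by move=> z; rewrite lee_fin mulr_ge0.
  rewrite half// half// -HH' -ge0_muleDl ?lee_fin//.
  by rewrite -EFinD (_ : 2^-1 + 2^-1 = 1) ?mul1e//; lra.
by rewrite eq2.
Qed.

End square_function.

Lemma kernel_op_out k f A B (M : R) x : box_kernel M A B k -> ~ A x ->
  kernel_op k f x = 0.
Proof.
move=> [_ _ kA _] nA; rewrite /kernel_op /Rintegral integral0_eq// => y _.
by rewrite kA// mul0r.
Qed.

End KernelOperators.

(** * From square integrability to other exponents *)

Section LebesgueExponents.
Context {d : measure_display} {T : measurableType d} {R : realType}.
Variable mu : {sigma_finite_measure set T -> \bar R}.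
Implicit Types (k : T * T -> R) (f g : T -> R) (A B : set T).
Local Notation kernel_op := (kernel_op mu).

(** Compare [v] with [A]. With [A] chosen afterwards, this elementary inequality does
    the work of Hoelder's inequality between the exponents [r] and [p]. *)
Lemma powR_split (A v p r : R) : 0 < A -> 0 <= v -> 0 < r -> r <= p ->
  v `^ r <= A `^ r + A `^ (r - p) * v `^ p.
Proof.
move=> A0 v0 r0 rp; have p0 : 0 < p := lt_le_trans r0 rp.
have [vA|Av] := leP v A.
  apply: (@le_trans _ _ (A `^ r)); first by rewrite ge0_ler_powR// ?nnegrE ltW.
  by rewrite lerDl mulr_ge0// powR_ge0.
have v0' : 0 < v := lt_trans A0 Av.
apply: (@le_trans _ _ (A `^ (r - p) * v `^ p)); last by rewrite lerDr powR_ge0.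
have -> : v `^ r = v `^ (r - p) * v `^ p.
  by rewrite -powRD ?subrK//; apply/implyP; rewrite (gt_eqF v0').
rewrite ler_wpM2r ?powR_ge0//.
rewrite -(opprB p r) !powRN lef_pV2 ?posrE ?powR_gt0//.
by rewrite ge0_ler_powR ?nnegrE ?subr_ge0// ltW.
Qed.

Lemma measurable_powR_norm f (r : R) : measurable_fun setT f ->
  measurable_fun setT (fun x => (`|f x| `^ r)%:E).
Proof.
move=> mf; apply/measurable_EFinP.
apply: (measurableT_comp (measurable_powR r)).
exact: measurableT_comp.
Qed.

Lemma integral_powR_split f B (A p r : R) : measurable B ->
  measurable_fun setT f -> (forall y, ~ B y -> f y = 0) ->
  0 < A -> 0 < r -> r <= p ->
  (\int[mu]_y (`|f y| `^ r)%:E <=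
   (A `^ r)%:E * mu B + (A `^ (r - p))%:E * \int[mu]_y (`|f y| `^ p)%:E)%E.
Proof.
move=> mB mf fB A0 r0 rp; have p0 : 0 < p := lt_le_trans r0 rp.
have mfp := measurable_powR_norm p mf.
have m1 : measurable_fun setT (fun y => ((A `^ r) * \1_B y)%:E).
  by apply/measurable_EFinP; apply: measurable_funM => //; exact: measurable_indic.
have m2 : measurable_fun setT (fun y => ((A `^ (r - p)) * `|f y| `^ p)%:E).
  apply/measurable_EFinP; apply: measurable_funM => //; exact/measurable_EFinP.
have -> : ((A `^ r)%:E * mu B = \int[mu]_y ((A `^ r) * \1_B y)%:E)%E.
  under eq_integral do rewrite EFinM.
  rewrite ge0_integralZl//; first by rewrite integral_indic// setIT.
    by apply/measurable_EFinP; exact: measurable_indic.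
  by rewrite lee_fin powR_ge0.
have -> : ((A `^ (r - p))%:E * \int[mu]_y (`|f y| `^ p)%:E =
    \int[mu]_y ((A `^ (r - p)) * `|f y| `^ p)%:E)%E.
  under [RHS]eq_integral do rewrite EFinM.
  rewrite ge0_integralZl//; last by rewrite lee_fin powR_ge0.
have n1 y : 0 <= A `^ r * \1_B y by rewrite mulr_ge0// powR_ge0.
have n2 y : 0 <= A `^ (r - p) * `|f y| `^ p by rewrite mulr_ge0// powR_ge0.
rewrite -ge0_integralD//; last 2 first.
- by move=> y _; rewrite lee_fin.
- by move=> y _; rewrite lee_fin.
apply: ge0_le_integral => //.
- exact: measurable_powR_norm.
- exact: emeasurable_funD.
move=> y _; rewrite -EFinD lee_fin; have [By|nBy] := pselect (B y).
  by rewrite indicE (mem_set By) mulr1; exact: powR_split.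
by rewrite fB// normr0 powR0 ?gt_eqF// addr_ge0// mulr_ge0 ?powR_ge0.
Qed.

Lemma Lp_integrable f B (p : R) : measurable B -> (mu B < +oo)%E ->
  measurable_fun setT f -> (forall y, ~ B y -> f y = 0) -> 1 <= p ->
  (\int[mu]_y (`|f y| `^ p)%:E < +oo)%E -> mu.-integrable setT (EFin \o f).
Proof.
move=> mB Bfin mf fB p1 fp; apply/integrableP; split; first exact/measurable_EFinP.
have := integral_powR_split mB mf fB ltr01 ltr01 p1.
have -> : (\int[mu]_y (`|f y| `^ 1)%:E = \int[mu]_y `|(EFin \o f) y|)%E.
  by apply: eq_integral => y _; rewrite powRr1.
move=> h; apply: (le_lt_trans h); rewrite !powR1 !mul1e.
by rewrite lte_add_pinfty.
Qed.

(** On a set of finite measure, the trivial [L^1 -> L^oo] bound and an [L^2] bound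
    interpolate without loss of scale: both sides of each Hoelder inequality live
    on sets of the same measure. *)
Lemma kernel_op_Lp_ge2 k f A B (M c rho p : R) :
  box_kernel M A B k -> measurable A -> (mu A < +oo)%E -> measurable B ->
  mu B = rho%:E -> 0 < rho -> 0 <= c -> 2 <= p ->
  measurable_fun setT f -> (forall y, ~ B y -> f y = 0) ->
  (\int[mu]_y (`|f y| `^ p)%:E < +oo)%E ->
  (\int[mu]_x (kernel_op k f x ^+ 2)%:E <= c%:E * \int[mu]_y (f y ^+ 2)%:E)%E ->
  (\int[mu]_x (`|kernel_op k f x| `^ p)%:E <=
   (2 `^ (p - 1) * (M * rho) `^ (p - 2) * c)%:E * \int[mu]_y (`|f y| `^ p)%:E)%E.
Proof.
move=> bk mA Afin mB Brho rho0 c0 p2 mf fB fp L2.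
have Bfin : (mu B < +oo)%E by rewrite Brho ltry.
have p1 : 1 <= p by apply: le_trans p2; rewrite ler1n.
have p0 : 0 < p by exact: lt_le_trans p1.
have fi := Lp_integrable mB Bfin mf fB p1 fp.
have [mk kM _ _] := bk.
have M0 : 0 <= M by exact: le_trans (normr_ge0 _) (kM (point, point)).
set X := (\int[mu]_y (`|f y| `^ p)%:E)%E in fp *.
have X0 : (0 <= X)%E by apply: integral_ge0 => y _; rewrite lee_fin powR_ge0.
have Xfin : X \is a fin_num by rewrite ge0_fin_numE.
rewrite -(fineK Xfin); set x := fine X.
have x0 : 0 <= x by exact: fine_ge0.
set K := 2 `^ (p - 1) * _ * c.
have K0 : 0 <= K by rewrite /K !mulr_ge0// powR_ge0.
suff H : forall e : R, 0 < e ->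
    (\int[mu]_x (`|kernel_op k f x| `^ p)%:E <= (K * (x + e))%:E)%E.
  apply/lee_addgt0Pr => e e0; rewrite -EFinM -EFinD.
  apply: (le_trans (H (e / (K + 1)) _)); first by rewrite divr_gt0// ltr_wpDl.
  rewrite lee_fin mulrDr lerD2l mulrA ler_pdivrMr ?ltr_wpDl//.
  by rewrite mulrC ler_wpM2l ?lerDl// ltW.
move=> e e0.
have xe0 : 0 < x + e by rewrite ltr_wpDl.
(* the level at which both terms of [integral_powR_split] are equal; [e] keeps it
   positive *)
pose a := ((x + e) / rho) `^ p^-1.
have a0 : 0 < a by rewrite powR_gt0// divr_gt0.
have aE : a `^ p * rho = x + e.
  by rewrite /a -powRrM mulVf ?gt_eqF// powRr1 ?divfK ?gt_eqF// divr_ge0// ltW.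
have Nr r : 0 < r -> r <= p ->
    (\int[mu]_y (`|f y| `^ r)%:E <= (2 * a `^ r * rho)%:E)%E.
  move=> r0 rp; apply: (le_trans (integral_powR_split mB mf fB a0 r0 rp)).
  rewrite -/X -(fineK Xfin) -/x Brho -!EFinM -EFinD lee_fin.
  have -> : 2 * a `^ r * rho = a `^ r * rho + a `^ (r - p) * (x + e).
    rewrite -aE mulrA -powRD; last by apply/implyP; rewrite (gt_eqF a0).
    by rewrite subrK; ring.
  by rewrite lerD2l ler_wpM2l ?powR_ge0// lerDl ltW.
have N1 : \int[mu]_y `|f y| <= 2 * a * rho.
  have := Nr 1 ltr01 p1; rewrite powRr1 ?(ltW a0)//.
  have -> : (\int[mu]_y (`|f y| `^ 1)%:E = \int[mu]_y (`|f y|)%:E)%E.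
    by apply: eq_integral => y _; rewrite powRr1.
  by rewrite /Rintegral -lee_fin fineK// integrable_fin_num//; exact: integrable_norm.
have N2 : (\int[mu]_y (f y ^+ 2)%:E <= (2 * a ^+ 2 * rho)%:E)%E.
  have h2 : 0 < 2 :> R by [].
  have := Nr 2 h2 p2; rewrite -powR_mulrn ?(ltW a0)//.
  have -> : (\int[mu]_y (`|f y| `^ 2)%:E = \int[mu]_y (f y ^+ 2)%:E)%E.
    by apply: eq_integral => y _; rewrite powR_mulrn// real_normK// num_real.
  by [].
have opM y : `|kernel_op k f y| <= 2 * M * a * rho.
  apply: (le_trans (le_kernel_op mk kM y fi)).
  by rewrite (_ : 2 * M * a * rho = M * (2 * a * rho)); [rewrite ler_wpM2l|ring].
have mop := integrable_measurable (integrable_kernel_op bk mA Afin fi).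
set b := 2 * M * a * rho in opM.
have b0 : 0 <= b by exact: le_trans (opM point).
have p20 : 0 <= p - 2 by rewrite subr_ge0.
apply: (@le_trans _ _ (\int[mu]_y ((b `^ (p - 2))%:E * (kernel_op k f y ^+ 2)%:E))%E).
  apply: ge0_le_integral => //.
  - exact: measurable_powR_norm.
  - apply: emeasurable_funM => //; apply/measurable_EFinP; exact: measurable_funX.
  move=> y _; rewrite -EFinM lee_fin.
  have -> : `|kernel_op k f y| `^ p =
      `|kernel_op k f y| `^ (p - 2) * kernel_op k f y ^+ 2.
    rewrite -(real_normK (num_real (kernel_op k f y))) -powR_mulrn//.
    have [->|n0] := eqVneq `|kernel_op k f y| 0.
      by rewrite [_ `^ 2%:R]powR0// mulr0 powR0// gt_eqF.
    by rewrite -powRD ?subrK// n0 implybT.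
  by rewrite ler_wpM2r ?sqr_ge0// ge0_ler_powR// ?nnegrE.
rewrite ge0_integralZl//; last 3 first.
- by apply/measurable_EFinP; exact: measurable_funX.
- by move=> y _; rewrite lee_fin sqr_ge0.
- by rewrite lee_fin powR_ge0.
apply: (@le_trans _ _ ((b `^ (p - 2))%:E * (c%:E * (2 * a ^+ 2 * rho)%:E))%E).
  rewrite lee_wpmul2l ?lee_fin ?powR_ge0//; apply: (le_trans L2).
  by rewrite lee_wpmul2l// lee_fin.
rewrite -!EFinM lee_fin -aE.
have -> : b = 2 * (M * rho) * a by rewrite /b; ring.
rewrite powRM ?mulr_ge0 ?(ltW a0) ?(ltW rho0)//.
rewrite powRM ?mulr_ge0 ?(ltW rho0)//.
have -> : a `^ p = a `^ (p - 2) * a ^+ 2.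
  rewrite -powR_mulrn ?(ltW a0)// -powRD ?subrK//.
  by apply/implyP; rewrite (gt_eqF a0).
rewrite /K; have -> : 2 `^ (p - 1) = 2 `^ (p - 2) * 2 :> R.
  rewrite -[X in _ = _ * X]powRr1// -powRD; last by apply/implyP; rewrite pnatr_eq0.
  by congr powR; ring.
by rewrite [leLHS](_ : _ = 2 `^ (p - 2) * 2 * (M * rho) `^ (p - 2) * c *
  (a `^ (p - 2) * a ^+ 2 * rho)) //; ring.
Qed.

(** Young's inequality with a parameter, by comparison of [v] with
    [(t * u) ^ (p - 1)]. *)
Lemma young_split (t u v p : R) : 0 < t -> 0 <= u -> 0 <= v -> 1 < p ->
  u * v <= t `^ (p - 1) * u `^ p + t^-1 * v `^ (p / (p - 1)).
Proof.
move=> t0 u0 v0 p1; have p10 : 0 < p - 1 by rewrite subr_gt0.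
have p0 : 0 < p by exact: lt_trans p1.
have qE : p / (p - 1) = (p - 1)^-1 + 1 by field; rewrite gt_eqF.
have [vt|tv] := leP v ((t * u) `^ (p - 1)).
  apply: (@le_trans _ _ (t `^ (p - 1) * u `^ p)); last first.
    by rewrite lerDl mulr_ge0 ?powR_ge0// invr_ge0 ltW.
  apply: (@le_trans _ _ (u * (t * u) `^ (p - 1))); first by rewrite ler_wpM2l.
  rewrite powRM ?(ltW t0)// mulrCA ler_wpM2l ?powR_ge0//.
  have [->|un0] := eqVneq u 0; first by rewrite mul0r powR_ge0.
  rewrite -[X in X * _]powRr1// -powRD; last by rewrite un0 implybT.
  by rewrite addrC subrK.
apply: (@le_trans _ _ (t^-1 * v `^ (p / (p - 1)))); last first.
  by rewrite lerDr mulr_ge0// powR_ge0.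
have vgt0 : 0 < v by apply: le_lt_trans tv; exact: powR_ge0.
rewrite qE powRD; last by rewrite (gt_eqF vgt0) implybT.
rewrite powRr1// mulrA ler_wpM2r// mulrC ler_pdivlMr// mulrC.
have h : 0 <= t * u by rewrite mulr_ge0// ltW.
have -> : t * u = ((t * u) `^ (p - 1)) `^ (p - 1)^-1.
  by rewrite -powRrM mulfV ?gt_eqF// powRr1.
by rewrite ge0_ler_powR ?nnegrE ?powR_ge0 ?invr_ge0 ?(ltW p10) ?(ltW tv).
Qed.

(** The range [p < 2] follows from the conjugate exponent by testing against
    [|F|^(p - 2) F]. *)
Lemma kernel_op_Lp_dual k f A B (M K p : R) :
  box_kernel M A B k -> measurable A -> (mu A < +oo)%E ->
  measurable B -> (mu B < +oo)%E -> 1 < p -> 0 < K ->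
  (forall g, measurable_fun setT g -> (forall x, ~ A x -> g x = 0) ->
    (\int[mu]_x (`|g x| `^ (p / (p - 1)))%:E < +oo)%E ->
    (\int[mu]_y (`|kernel_op (transpose k) g y| `^ (p / (p - 1)))%:E <=
     K%:E * \int[mu]_x (`|g x| `^ (p / (p - 1)))%:E)%E) ->
  measurable_fun setT f -> (forall y, ~ B y -> f y = 0) ->
  (\int[mu]_y (`|f y| `^ p)%:E < +oo)%E ->
  (\int[mu]_x (`|kernel_op k f x| `^ p)%:E <=
   (2 * (2 * K) `^ (p - 1))%:E * \int[mu]_y (`|f y| `^ p)%:E)%E.
Proof.
move=> bk mA Afin mB Bfin p1 K0 hK mf fB fp.
set q := p / (p - 1) in hK.
have p10 : 0 < p - 1 by rewrite subr_gt0.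
have p0 : 0 < p by exact: lt_trans p1.
have q1 : 1 <= q by rewrite ler_pdivlMr// mul1r gerBl.
have q0 : 0 < q := lt_le_trans ltr01 q1.
have fi := Lp_integrable mB Bfin mf fB (ltW p1) fp.
have [mk kM _ _] := bk.
set F := kernel_op k f.
have Fi : mu.-integrable setT (EFin \o F) := integrable_kernel_op bk mA Afin fi.
have mF := integrable_measurable Fi.
have FA x : ~ A x -> F x = 0 by move=> nA; exact: kernel_op_out bk nA.
pose b := M * \int[mu]_y `|f y|.
have Fb x : `|F x| <= b := le_kernel_op mk kM x fi.
have b0 : 0 <= b by apply: le_trans (Fb point).
have mFp := measurable_powR_norm p mF.
have Voo : (\int[mu]_x (`|F x| `^ p)%:E < +oo)%E.
  apply: (@le_lt_trans _ _ (\int[mu]_x ((b `^ p)%:E * (\1_A x)%:E))%E).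
    apply: ge0_le_integral => //.
    - apply: emeasurable_funM => //; apply/measurable_EFinP.
      exact: measurable_indic.
    move=> x _; rewrite -EFinM lee_fin indicE.
    case: (boolP (x \in A)) => [_|/negP xA].
      by rewrite mulr1 ge0_ler_powR ?nnegrE// ltW.
    by rewrite FA ?normr0 ?powR0 ?mulr0// ?gt_eqF// => /mem_set.
  rewrite ge0_integralZl ?lee_fin ?powR_ge0//; last first.
    by apply/measurable_EFinP; exact: measurable_indic.
  by rewrite integral_indic// setIT lte_mul_pinfty// ?lee_fin ?powR_ge0.
set V := (\int[mu]_x (`|F x| `^ p)%:E)%E in Voo *.
have V0 : (0 <= V)%E by apply: integral_ge0 => x _; rewrite lee_fin powR_ge0.
have Vfin : V \is a fin_num by rewrite ge0_fin_numE.
(* the extremal function in the duality of [L^p] *)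
pose G x := F x * `|F x| `^ (p - 2).
have GF x : G x * F x = `|F x| `^ p.
  rewrite /G mulrAC -expr2 -(real_normK (num_real (F x))) -powR_mulrn//.
  have [->|n0] := eqVneq `|F x| 0.
    by rewrite [_ `^ 2%:R]powR0// mul0r powR0// gt_eqF.
  by rewrite -powRD ?n0 ?implybT// addrC subrK.
have Gq x : `|G x| `^ q = `|F x| `^ p.
  rewrite /G normrM (ger0_norm (powR_ge0 _ _)).
  have [->|n0] := eqVneq `|F x| 0.
    by rewrite mul0r !powR0// gt_eqF.
  rewrite -[X in X * _]powRr1// -powRD ?n0 ?implybT//.
  rewrite -powRrM; congr powR; rewrite /q; field; rewrite gt_eqF//.
have mG : measurable_fun setT G.
  apply: measurable_funM => //; apply: (measurableT_comp (measurable_powR _)).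
  exact: measurableT_comp.
have GA x : ~ A x -> G x = 0 by move=> nA; rewrite /G FA// mul0r.
have GqE : (\int[mu]_x (`|G x| `^ q)%:E = V)%E.
  by apply: eq_integral => x _; rewrite Gq.
have Gi : mu.-integrable setT (EFin \o G).
  by apply: (Lp_integrable mA Afin mG GA q1); rewrite GqE.
have := hK G mG GA; rewrite GqE => /(_ Voo).
set H := kernel_op (transpose k) G => HV.
have Hi : mu.-integrable setT (EFin \o H).
  exact: integrable_kernel_op (box_kernel_transpose bk) mB Bfin Gi.
have mH := integrable_measurable Hi.
have fHi : mu.-integrable setT (fun y => (f y * H y)%:E).
  have [mtk tkM _ _] := box_kernel_transpose bk.
  have := integrable_mul_bounded fi Hi (fun y => le_kernel_op mtk tkM y Gi).
  by apply: eq_integrable => // y _ /=; rewrite mulrC.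
have VE : V = (\int[mu]_y (f y * H y)%:E)%E.
  have := kernel_op_adjoint mk kM fi Gi; rewrite -/H -/F /Rintegral.
  have -> : (\int[mu]_x (G x * F x)%:E = V)%E.
    by apply: eq_integral => x _; rewrite GF.
  by move=> e; rewrite -(fineK Vfin) e fineK// integrable_fin_num.
set X := (\int[mu]_y (`|f y| `^ p)%:E)%E in fp *.
have X0 : (0 <= X)%E by apply: integral_ge0 => x _; rewrite lee_fin powR_ge0.
have Xfin : X \is a fin_num by rewrite ge0_fin_numE.
have K20 : 0 < 2 * K by rewrite mulr_gt0.
have mfp := measurable_powR_norm p mf.
have mHq := measurable_powR_norm q mH.
have V1 : (V <= ((2 * K) `^ (p - 1))%:E * X + ((2 * K)^-1)%:E * (K%:E * V))%E.
  apply: (@le_trans _ _ (\int[mu]_y `|(f y * H y)%:E|)%E).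
    rewrite VE; apply: le_trans (lee_abs _) _.
    by apply: le_abse_integral => //; exact: measurable_int fHi.
  apply: (@le_trans _ _ (((2 * K) `^ (p - 1))%:E * X +
     ((2 * K)^-1)%:E * \int[mu]_y (`|H y| `^ q)%:E)%E); last first.
    by rewrite leeD2l// lee_wpmul2l// lee_fin invr_ge0 ltW.
  rewrite /X -ge0_integralZl ?lee_fin ?powR_ge0//.
  rewrite -ge0_integralZl ?lee_fin ?invr_ge0 ?(ltW K20)//.
  rewrite -ge0_integralD//.
  - apply: ge0_le_integral => //.
    + by apply: measurableT_comp => //; exact: measurable_int fHi.
    + by apply: emeasurable_funD; apply: emeasurable_funM.
    move=> y _; rewrite abse_EFin -!EFinM -EFinD lee_fin normrM.
    exact: young_split.
  - by move=> y _; rewrite -EFinM lee_fin mulr_ge0 ?powR_ge0.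
  - by apply: emeasurable_funM.
  - by move=> y _; rewrite -EFinM lee_fin mulr_ge0 ?powR_ge0// invr_ge0 ltW.
  - by apply: emeasurable_funM.
move: V1; rewrite -(fineK Vfin) -(fineK Xfin) -!EFinM -EFinD !lee_fin => V1.
have e : (2 * K)^-1 * (K * fine V) = fine V / 2 by field; rewrite gt_eqF.
by rewrite e in V1; lra.
Qed.

End LebesgueExponents.

(** * Integrable singularities and measurability in the plane *)

Section SingularIntegral.
Context {R : realType}.
Local Notation mu := (@lebesgue_measure R).

Lemma integral_indicT (D : set R) : measurable D ->
  (\int[mu]_x (\1_D x)%:E = mu D)%E.
Proof. by move=> mD; rewrite integral_indic// setIT. Qed.

Lemma geometric_partial_le (z c : R) (n : nat) : 0 <= z < 1 -> 0 <= c ->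
  \sum_(0 <= k < n) c * z ^+ k <= c / (1 - z).
Proof.
move=> /andP[z0 z1] c0; have z1' : 0 < 1 - z by rewrite subr_gt0.
suff -> : \sum_(0 <= k < n) c * z ^+ k = c * (1 - z ^+ n) / (1 - z).
  rewrite ler_wpM2r ?invr_ge0 ?(ltW z1')// -[leRHS]mulr1 ler_wpM2l//.
  by rewrite gerBl exprn_ge0.
elim: n => [|n ih]; first by rewrite big_nil expr0 subrr mulr0 mul0r.
rewrite big_nat_recr//= ih exprS; field; rewrite gt_eqF//.
Qed.

Lemma nneseries_geometric_le (z c : R) : 0 <= z < 1 -> 0 <= c ->
  (\sum_(0 <= k <oo) (c * z ^+ k)%:E <= (c / (1 - z))%:E)%E.
Proof.
move=> z01 c0; have /andP[z0 _] := z01.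
apply: lime_le.
  by apply: is_cvg_nneseries => k _ _; rewrite lee_fin mulr_ge0// exprn_ge0.
apply: nearW => n; rewrite sumEFin lee_fin; exact: geometric_partial_le.
Qed.

Lemma powR_half_exp (s : R) (k : nat) : (2^-1 ^+ k) `^ (- s) = (2 `^ s) ^+ k.
Proof.
elim: k => [|k ih]; first by rewrite !expr0 powR1.
rewrite !exprS powRM ?exprn_ge0 ?invr_ge0// ih; congr (_ * _).
by rewrite -powR_inv1// -powRrM mulN1r opprK.
Qed.

Lemma dyadic_shell (l w : R) : 0 < w -> w <= l ->
  exists k : nat, l * 2^-1 ^+ k.+1 < w /\ w <= l * 2^-1 ^+ k.
Proof.
move=> w0 wl; have l0 : 0 < l := lt_le_trans w0 wl.
have ex : exists k : nat, l * 2^-1 ^+ k.+1 < w.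
  have h := archi_boundP (ltW (divr_gt0 l0 w0)).
  exists (Num.bound (l / w)); rewrite exprVn ltr_pdivrMr ?exprn_gt0//.
  rewrite -ltr_pdivrMl// mulrC; apply: (lt_le_trans h).
  rewrite -natrX ler_nat; apply: leq_trans (ltnW (ltn_expl _ (ltnSn 1))) _.
  by rewrite leq_exp2l.
exists (ex_minn ex); case: ex_minnP => k lk kmin; split => //.
case: k lk kmin => [|k] lk kmin; first by rewrite expr0 mulr1.
by rewrite leNgt; apply/negP => /kmin; rewrite ltnn.
Qed.

Lemma measurable_dist_powR (x : R) (r : R) : measurable_fun setT
  (fun y : R => (`|x - y| `^ r)%:E).
Proof.
apply/measurable_EFinP; apply: (measurableT_comp (measurable_powR r)).
by apply: measurableT_comp => //; exact: measurable_funB.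
Qed.

(** On the dyadic shell [|x - y| ~ l * 2^(-k)] the integrand is about
    [(l * 2^(-k))^(-s)]; the contributions form a geometric series because [s < 1]. *)
Lemma singular_integral_centered (s : R) : 0 < s < 1 ->
  exists2 C : R, 0 <= C & forall x l : R, 0 < l ->
    (\int[mu]_(y in `[(x - l)%R, (x + l)%R]) (`|x - y| `^ (- s))%:E <=
     (C * l `^ (1 - s))%:E)%E.
Proof.
move=> /andP[s0 s1].
(* the ratio of the contributions of consecutive shells *)
pose z : R := 2 `^ s / 2.
have z01 : 0 <= z < 1.
  rewrite /z divr_ge0 ?powR_ge0//= ltr_pdivrMr// mul1r.
  have h1 : 1 < 2 `^ (1 - s) :> R.
    have e1 : 1 `^ (1 - s) = 1 :> R by rewrite powR1.
    rewrite -[X in X < _]e1.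
    by apply: gt0_ltr_powR; rewrite ?nnegrE ?subr_gt0// ltr1n.
  have h2 : 2 `^ s * 2 `^ (1 - s) = 2 :> R.
    rewrite -powRD; last by rewrite pnatr_eq0 implybT.
    by rewrite addrC subrK powRr1.
  by rewrite -[X in _ < X]h2 ltr_pMr// powR_gt0.
exists (2 * 2 `^ s / (1 - z)).
  have /andP[_ z1] := z01.
  by rewrite divr_ge0 ?mulr_ge0 ?powR_ge0// subr_ge0 ltW.
move=> x l l0.
pose I k := `[x - l * 2^-1 ^+ k, x + l * 2^-1 ^+ k]%classic.
pose u (k : nat) (y : R) := (((l * 2^-1 ^+ k.+1) `^ (- s)) * \1_(I k) y)%:E.
have u0 k y : (0 <= u k y)%E by rewrite lee_fin mulr_ge0 ?powR_ge0.
have mI k : measurable (I k) by exact: measurable_itv.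
have mu_ k : measurable_fun setT (u k).
  by apply/measurable_EFinP; apply: measurable_funM => //; exact: measurable_indic.
apply: (@le_trans _ _ (\int[mu]_y (\sum_(0 <= k <oo) u k y))%E).
  rewrite integral_mkcond; apply: ge0_le_integral => //.
  - by move=> y _; apply: erestrict_ge0 => ? _; rewrite lee_fin powR_ge0.
  - apply: (measurable_restrictT _ _).1; first exact: measurable_itv.
    by apply: measurable_funTS; exact: measurable_dist_powR.
  - by apply: ge0_emeasurable_sum => [k y _ _|k _]; [exact: u0|exact: mu_].
  move=> y _; rewrite patchE.
  have S0 : (0 <= \sum_(0 <= k <oo) u k y)%E by exact: nneseries_ge0.
  case: ifPn => // /set_mem /=; rewrite in_itv/= => /andP[xly yxl].
  have [yx|yx] := eqVneq (`|x - y|) 0.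
    by rewrite yx powR0// oppr_eq0 gt_eqF.
  have w0 : 0 < `|x - y| by rewrite lt_def yx normr_ge0.
  have wl : `|x - y| <= l by rewrite ler_norml; lra.
  have [k [k1 k2]] := dyadic_shell w0 wl.
  apply: (@le_trans _ _ (u k y)); last first.
    have := @nneseries_lim_ge R (fun k => u k y) xpredT 0 k.+1 (fun n _ _ => u0 n y).
    apply: le_trans; rewrite big_nat_recr//= leeDr// sume_ge0//.
  rewrite /u lee_fin indicE mem_set; last first.
    by rewrite /I/= in_itv/=; move: k2; rewrite ler_norml => /andP[]; lra.
  rewrite mulr1 !powRN lef_pV2 ?posrE ?powR_gt0//; last first.
    by rewrite mulr_gt0// exprn_gt0// invr_gt0.
  by rewrite ge0_ler_powR ?nnegrE// ?(ltW s0) ?(ltW k1)// mulr_ge0 ?exprn_ge0 ?invr_ge0 ?(ltW l0).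
rewrite integral_nneseries//.
have uE k : (\int[mu]_y u k y = ((2 * 2 `^ s * l `^ (1 - s)) * z ^+ k)%:E)%E.
  rewrite /u; under eq_integral do rewrite EFinM.
  rewrite ge0_integralZl ?lee_fin ?powR_ge0//; last first.
    by apply/measurable_EFinP; exact: (measurable_indic (mI k)).
  have lk0 : 0 < l * 2^-1 ^+ k by rewrite mulr_gt0// exprn_gt0// invr_gt0.
  have muI : mu (I k) = (2 * (l * 2^-1 ^+ k))%:E.
    rewrite /I lebesgue_measure_itv/= lte_fin ifT; last by lra.
    by rewrite -EFinD; congr EFin; ring.
  rewrite (integral_indicT (mI k)) muI.
  rewrite -EFinM; congr EFin.
  rewrite powRM ?exprn_ge0 ?invr_ge0 ?(ltW l0)// powR_half_exp exprS.
  have -> : l `^ (1 - s) = l `^ (- s) * l.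
    rewrite -[X in _ = _ * X]powRr1 ?(ltW l0)// -powRD; last by rewrite (gt_eqF l0) implybT.
    by rewrite addrC.
  by rewrite /z expr_div_n exprVn; field; rewrite expf_neq0.
under eq_eseriesr do rewrite uE.
have c0 : 0 <= 2 * 2 `^ s * l `^ (1 - s) by rewrite !mulr_ge0 ?powR_ge0.
by apply: (le_trans (nneseries_geometric_le z01 c0)); rewrite lee_fin mulrAC.
Qed.

(** Off the interval of radius [l] centered at the singularity, the integrand is at
    most [l^(-s)]. *)
Lemma singular_integral (s : R) : 0 < s < 1 ->
  exists2 C : R, 0 <= C & forall x t l : R, 0 < l ->
    (\int[mu]_(y in `[(t - l)%R, (t + l)%R]) (`|x - y| `^ (- s))%:E <=
     (C * l `^ (1 - s))%:E)%E.
Proof.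
move=> s01; have /andP[s0 s1] := s01.
have [C C0 HC] := singular_integral_centered s01.
exists (C + 2); first by rewrite addr_ge0.
move=> x t l l0.
pose I := `[x - l, x + l]%classic; pose J := `[t - l, t + l]%classic.
have mI : measurable I by exact: measurable_itv.
have mJ : measurable J by exact: measurable_itv.
have mf := measurable_dist_powR x (- s).
pose g1 y : \bar R := ((`|x - y| `^ (- s))%:E * (\1_I y)%:E)%E.
pose g2 y : \bar R := ((l `^ (- s))%:E * (\1_J y)%:E)%E.
have mg1 : measurable_fun setT g1.
  by apply: emeasurable_funM => //; apply/measurable_EFinP; exact: measurable_indic.
have mg2 : measurable_fun setT g2.
  by apply: emeasurable_funM => //; apply/measurable_EFinP; exact: measurable_indic.
have g10 y : (0 <= g1 y)%E by rewrite /g1 -EFinM lee_fin mulr_ge0 ?powR_ge0.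
have g20 y : (0 <= g2 y)%E by rewrite /g2 -EFinM lee_fin mulr_ge0 ?powR_ge0.
apply: (@le_trans _ _ (\int[mu]_y (g1 y + g2 y))%E).
  rewrite integral_mkcond; apply: ge0_le_integral => //.
  - by move=> y _; apply: erestrict_ge0 => ? _; rewrite lee_fin powR_ge0.
  - by apply: (measurable_restrictT _ _).1 => //; exact: measurable_funTS.
  - exact: emeasurable_funD.
  move=> y _; rewrite patchE -/J; case: ifPn => [yJ|_]; last by rewrite adde_ge0.
  rewrite /g1 /g2 indicE [in leRHS]indicE yJ.
  case: (boolP (y \in I)) => [_|yI]; rewrite -?EFinM -?EFinD lee_fin !mulr1.
    by rewrite lerDl powR_ge0.
  rewrite mulr0 add0r !powRN lef_pV2 ?posrE ?powR_gt0//; last first.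
    rewrite normr_gt0 subr_eq0; apply: contraNneq yI => xy.
    by apply/mem_set; rewrite /I/= in_itv/= -xy; lra.
  rewrite ge0_ler_powR ?nnegrE ?(ltW s0) ?(ltW l0)//.
  rewrite leNgt; apply: contra yI => h; apply/mem_set; rewrite /I/= in_itv/=.
  by move: h; rewrite ltr_norml => /andP[]; lra.
rewrite ge0_integralD// mulrDl EFinD leeD//.
  apply: le_trans (HC x l l0); rewrite [leRHS]integral_mkcond -/I.
  rewrite le_eqVlt; apply/orP; left; apply/eqP; apply: eq_integral => y _.
  by rewrite patchE /g1 indicE; case: (y \in I); rewrite ?mule1 ?mule0.
rewrite ge0_integralZl ?lee_fin ?powR_ge0//; last first.
  by apply/measurable_EFinP; exact: measurable_indic.
have muJ : mu J = (2 * l)%:E.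
  rewrite /J lebesgue_measure_itv/= lte_fin ifT; last by lra.
  by rewrite -EFinD; congr EFin; ring.
rewrite (integral_indicT mJ) muJ.
rewrite -EFinM lee_fin.
have -> : l `^ (1 - s) = l `^ (- s) * l.
  rewrite -[X in _ = _ * X]powRr1 ?(ltW l0)// -powRD; last by rewrite (gt_eqF l0) implybT.
  by rewrite addrC.
by rewrite le_eqVlt; apply/orP; left; apply/eqP; ring.
Qed.

End SingularIntegral.

Section ProductMeasurability.
Context {R : realType}.

(** The plane has a countable base of products of balls. *)
Lemma open_measurable_prod (U : set (R * R)) : open U -> measurable U.
Proof.
move=> oU.
pose box (c : rat * rat * nat) : set (R * R) :=
  ball (ratr c.1.1 : R) (c.2.+1%:R^-1) `*` ball (ratr c.1.2 : R) (c.2.+1%:R^-1).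
pose F (n : nat) : set (R * R) :=
  if @unpickle (rat * rat * nat)%type n is Some c then
    (if pselect (box c `<=` U) then box c else set0) else set0.
have mF n : measurable (F n).
  rewrite /F; case: unpickle => [c|]; last exact: measurable0.
  case: pselect => [_|_] /=; last exact: measurable0.
  by apply: measurableX; exact: measurable_ball.
suff -> : U = \bigcup_n F n by exact: bigcupT_measurable.
apply/seteqP; split => [z Uz|z [n _]]; last first.
  by rewrite /F; case: unpickle => [c|//]; case: pselect => [h /h|].
have /nbhs_ballP[e /= e0 eU] : nbhs z U by exact: open_nbhs_nbhs.
pose k := Num.bound (2 / e).
have ke : 2 * k.+1%:R^-1 < e.
  have := archi_boundP (ltW (divr_gt0 (ltr0Sn R 1) e0)); rewrite -/k => h.
  rewrite ltr_pdivrMr// -ltr_pdivrMl// mulrC; apply: (lt_le_trans h).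
  by rewrite ler_nat.
have k0 : 0 < k.+1%:R^-1 :> R by rewrite invr_gt0.
have near_rat (t h : R) : 0 < h -> exists q : rat, `|ratr q - t| < h.
  move=> h0; have tt : t - h < t + h by lra.
  have [q] := rat_in_itvoo tt.
  by rewrite in_itv/= => /andP[h1 h2]; exists q; rewrite ltr_norml; lra.
have [a ha] := near_rat z.1 _ k0; have [b hb] := near_rat z.2 _ k0.
have bU : box (a, b, k) `<=` U.
  move=> w [/= w1 w2]; apply: eU; split => /=.
    rewrite /ball/= in w1 *; apply: (@le_lt_trans _ _ (`|z.1 - ratr a| + `|ratr a - w.1|)).
      by rewrite -{1}(subrKA (ratr a)) ler_normD.
    by apply: lt_trans ke; rewrite mulrDl mul1r; apply: ltrD; [rewrite distrC|].
  rewrite /ball/= in w2 *; apply: (@le_lt_trans _ _ (`|z.2 - ratr b| + `|ratr b - w.2|)).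
    by rewrite -{1}(subrKA (ratr b)) ler_normD.
  by apply: lt_trans ke; rewrite mulrDl mul1r; apply: ltrD; [rewrite distrC|].
have FE : F (pickle (a, b, k)) = box (a, b, k).
  by rewrite /F pickleK; case: pselect.
exists (pickle (a, b, k)); first exact: I.
by rewrite FE; split.
Qed.

Lemma open_continuous_measurable_prod (U : set (R * R)) (f : R * R -> R) :
  open U -> (forall z, U z -> {for z, continuous f}) -> measurable_fun U f.
Proof.
move=> oU cf; apply: (measurability _ (RGenOInfty.measurableE R)).
move=> /= _ [_ [a ->]] <-; apply: open_measurable_prod.
rewrite openE => z [Uz az]; rewrite /interior.
apply: filterI; first exact: open_nbhs_nbhs.
have := cf z Uz => /(_ `]a, +oo[%classic); apply.
apply: open_nbhs_nbhs; split; [exact: interval_open|exact: az].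
Qed.

End ProductMeasurability.

(** * Schur's test and interpolation on a square *)

Section SchurLp.
Context {d : measure_display} {T : measurableType d} {R : realType}.
Variable mu : {sigma_finite_measure set T -> \bar R}.
Implicit Types (k : T * T -> R) (f g : T -> R) (A B : set T).
Local Notation kernel_op := (kernel_op mu).

(** Optimization in the free parameter [a]; a small [e] added to [X] keeps the optimal
    value positive. *)
Lemma poweR_le_of_split (N X : \bar R) (B p : R) :
  (0 <= N)%E -> (0 <= X)%E -> 0 < B -> 1 < p ->
  (forall a : R, 0 < a -> (N <= (a * B)%:E + (a `^ (1 - p))%:E * X)%E) ->
  (N `^ p <= (2 `^ p * B `^ (p - 1))%:E * X)%E.
Proof.
move=> N0 X0 B0 p1 H; have p0 : 0 < p by exact: lt_trans p1.
set K := 2 `^ p * _; have K0 : 0 < K by rewrite mulr_gt0// powR_gt0.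
have [->|Xfin] := eqVneq X +oo%E; first by rewrite gt0_muley ?lte_fin// leey.
have {}Xfin : X \is a fin_num by rewrite ge0_fin_numE// lt_neqAle Xfin leey.
rewrite -(fineK Xfin) in H *; set x := fine X in H *.
have x0 : 0 <= x by exact: fine_ge0.
suff H1 : forall e : R, 0 < e -> (N `^ p <= (K * (x + e))%:E)%E.
  apply/lee_addgt0Pr => e e0; rewrite -EFinM -EFinD.
  apply: (le_trans (H1 (e / K) _)); first by rewrite divr_gt0.
  by rewrite lee_fin mulrDr lerD2l mulrC divfK// gt_eqF.
move=> e e0; have xe0 : 0 < x + e by rewrite ltr_wpDl.
(* the two terms of the hypothesis balance at this point *)
pose a := ((x + e) / B) `^ p^-1.
have a0 : 0 < a by rewrite powR_gt0// divr_gt0.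
have aE : a `^ p * B = x + e.
  by rewrite /a -powRrM mulVf ?gt_eqF// powRr1 ?divfK ?gt_eqF// divr_ge0// ltW.
have NaB : (N <= (2 * a * B)%:E)%E.
  apply: (le_trans (H a a0)); rewrite -EFinM -EFinD lee_fin.
  have -> : 2 * a * B = a * B + a `^ (1 - p) * (x + e).
    rewrite -aE mulrA -powRD; last by rewrite (gt_eqF a0) implybT.
    by rewrite subrK powRr1 ?(ltW a0)//; ring.
  by rewrite lerD2l ler_wpM2l ?powR_ge0// lerDl ltW.
have aB0 : 0 <= 2 * a * B by rewrite !mulr_ge0// ltW.
apply: (@le_trans _ _ ((2 * a * B)%:E `^ p)%E).
  by apply: gt0_ler_poweR; rewrite ?(ltW p0)// ?in_itv/= ?leey ?andbT// lee_fin.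
rewrite poweR_EFin lee_fin /K -aE.
have -> : B `^ (p - 1) = B `^ p / B.
  by rewrite powRB ?powRr1 ?(ltW B0)// (gt_eqF B0) implybT.
rewrite powRM ?mulr_ge0 ?(ltW a0) ?(ltW B0)// powRM ?(ltW a0)//.
by rewrite le_eqVlt; apply/orP; left; apply/eqP; field; rewrite gt_eqF.
Qed.

(** Split [|f|] by [powR_split] with a parameter [a] that is optimized at each [x]: the
    first term is controlled by the row integrals of [nu]. The second one becomes,
    after exchange of the integrals, controlled by the column integrals. *)
Lemma schur_Lp (nu : T * T -> R) f (B p : R) : 0 < B -> 1 < p ->
  measurable_fun setT nu -> (forall z, 0 <= nu z) ->
  (forall x, (\int[mu]_y (nu (x, y))%:E <= B%:E)%E) ->
  (forall y, (\int[mu]_x (nu (x, y))%:E <= B%:E)%E) ->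
  measurable_fun setT f ->
  (\int[mu]_x ((\int[mu]_y (nu (x, y) * `|f y|)%:E) `^ p) <=
   ((2 * B) `^ p)%:E * \int[mu]_y (`|f y| `^ p)%:E)%E.
Proof.
move=> B0 p1 mnu nu0 nux nuy mf; have p0 : 0 < p by exact: lt_trans p1.
have mnf (r : R) : measurable_fun setT (fun z : T * T => (nu z * `|f z.2| `^ r)%:E).
  apply/measurable_EFinP; apply: measurable_funM => //.
  apply: (measurableT_comp (measurable_powR _)).
  by apply: measurableT_comp => //; exact: (measurableT_comp mf measurable_snd).
have nf0 (r : R) z : (0 <= (nu z * `|f z.2| `^ r)%:E)%E.
  by rewrite lee_fin mulr_ge0 ?powR_ge0.
pose N x := (\int[mu]_y (nu (x, y) * `|f y|)%:E)%E.
pose X x := (\int[mu]_y (nu (x, y) * `|f y| `^ p)%:E)%E.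
have NE x : N x = (\int[mu]_y (nu (x, y) * `|f y| `^ 1)%:E)%E.
  by apply: eq_integral => y _; rewrite powRr1.
have mN : measurable_fun setT N.
  have := measurable_fun_fubini_tonelli_F (m2 := mu) _ (mnf 1) (nf0 1).
  by apply: eq_measurable_fun => x _; rewrite NE.
have mX : measurable_fun setT X.
  exact: (measurable_fun_fubini_tonelli_F (m2 := mu) _ (mnf p) (nf0 p)).
have mnux x : measurable_fun setT (fun y => (nu (x, y))%:E).
  by apply/measurable_EFinP; exact: (measurableT_comp mnu (pair1_measurable x)).
have mnfx (r : R) x : measurable_fun setT (fun y => (nu (x, y) * `|f y| `^ r)%:E).
  exact: (measurableT_comp (mnf r) (pair1_measurable x)).
have N0 x : (0 <= N x)%E.
  by apply: integral_ge0 => y _; rewrite lee_fin mulr_ge0.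
have X0 x : (0 <= X x)%E by apply: integral_ge0 => y _; exact: (nf0 p (x, y)).
have key x : (N x `^ p <= (2 `^ p * B `^ (p - 1))%:E * X x)%E.
  apply: poweR_le_of_split => // a a0.
  apply: (@le_trans _ _ (\int[mu]_y (a%:E * (nu (x, y))%:E +
      (a `^ (1 - p))%:E * (nu (x, y) * `|f y| `^ p)%:E))%E).
    rewrite NE; apply: ge0_le_integral => //.
    - by apply: emeasurable_funD; apply: emeasurable_funM.
    move=> y _; rewrite -!EFinM -EFinD lee_fin.
    rewrite [leRHS](_ : _ = nu (x, y) * (a + a `^ (1 - p) * `|f y| `^ p)); last by ring.
    rewrite ler_wpM2l//.
    have := powR_split a0 (normr_ge0 (f y)) ltr01 (ltW p1).
    by rewrite !powRr1// ltW.
  rewrite ge0_integralD//; last 4 first.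
  - by move=> y _; rewrite mule_ge0// lee_fin// ltW.
  - by apply: emeasurable_funM.
  - by move=> y _; rewrite mule_ge0 ?lee_fin ?powR_ge0// mulr_ge0 ?powR_ge0.
  - by apply: emeasurable_funM.
  apply: leeD.
    rewrite ge0_integralZl ?lee_fin ?(ltW a0)//; last by move=> y _; rewrite lee_fin.
    by rewrite EFinM lee_wpmul2l// lee_fin ltW.
  by rewrite ge0_integralZl ?lee_fin ?powR_ge0.
apply: (@le_trans _ _ (\int[mu]_x ((2 `^ p * B `^ (p - 1))%:E * X x))%E).
  apply: ge0_le_integral => //.
  - by move=> x _; exact: poweR_ge0.
  - exact: (measurableT_comp (measurable_poweR p) mN).
  - by apply: emeasurable_funM.
  - by move=> x _; exact: key.
rewrite ge0_integralZl ?lee_fin ?mulr_ge0 ?powR_ge0//.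
apply: (@le_trans _ _ ((2 `^ p * B `^ (p - 1))%:E *
    (B%:E * \int[mu]_y (`|f y| `^ p)%:E))%E); last first.
  rewrite muleA -EFinM powRM ?(ltW B0)//.
  have -> : 2 `^ p * B `^ (p - 1) * B = 2 `^ p * B `^ p.
    rewrite -mulrA -[X in _ * (_ * X)]powRr1 ?(ltW B0)// -powRD ?subrK//.
    by rewrite (gt_eqF B0) implybT.
  by [].
rewrite lee_wpmul2l ?lee_fin ?mulr_ge0 ?powR_ge0//.
have ft := @fubini_tonelli _ _ _ _ _ mu mu _ (mnf p) (nf0 p).
rewrite [leLHS]ft -ge0_integralZl ?lee_fin ?(ltW B0)//; last exact: measurable_powR_norm.
apply: ge0_le_integral => //.
- by move=> y _; apply: integral_ge0 => x _; exact: (nf0 p (x, y)).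
- exact: (measurable_fun_fubini_tonelli_G (m1 := mu) _ (mnf p) (nf0 p)).
- by apply: emeasurable_funM => //; exact: measurable_powR_norm.
move=> y _ /=; under eq_integral do rewrite mulrC EFinM.
rewrite ge0_integralZl ?lee_fin ?powR_ge0//.
- by rewrite muleC lee_wpmul2r// lee_fin powR_ge0.
- by apply/measurable_EFinP; exact: (measurableT_comp mnu (pair2_measurable y)).
- by move=> x _; rewrite lee_fin.
Qed.

Lemma transposeK k : transpose (transpose k) = k.
Proof. by apply/funext => -[x y]. Qed.

(** The power of the [L^2] gain that survives in the [p]-th power of the [L^p] norm. *)
Definition interp_exponent (p : R) : R := if 2 <= p then 1 else p - 1.

Definition interp_constant (c p : R) : R :=
  if 2 <= p then 2 `^ (p - 1) * c
  else 2 * (2 * (2 `^ (p / (p - 1) - 1) * (4 * c))) `^ (p - 1).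

Lemma sqr_powR2 (x : R) : `|x| `^ 2 = x ^+ 2.
Proof. by rewrite powR_mulrn// real_normK// num_real. Qed.

(** From [L^2] to [L^p]: above the exponent [2] this is [kernel_op_Lp_ge2]; below,
    pass to the adjoint, which has the same [L^2] norm and falls in the first case
    for the conjugate exponent. *)
Lemma kernel_op_Lp k f A B (M c rho theta p : R) :
  box_kernel M A B k ->
  measurable A -> mu A = rho%:E -> measurable B -> mu B = rho%:E ->
  0 < M -> 0 < rho -> 0 < c -> 0 < theta -> 1 < p ->
  (forall g, mu.-integrable setT (EFin \o g) -> (forall y, ~ B y -> g y = 0) ->
    (\int[mu]_x (kernel_op k g x ^+ 2)%:E <=
     (c * (M * rho) ^+ 2 * theta)%:E * \int[mu]_y (g y ^+ 2)%:E)%E) ->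
  measurable_fun setT f -> (forall y, ~ B y -> f y = 0) ->
  (\int[mu]_y (`|f y| `^ p)%:E < +oo)%E ->
  (\int[mu]_x (`|kernel_op k f x| `^ p)%:E <=
   (interp_constant c p * (M * rho) `^ p * theta `^ interp_exponent p)%:E *
     \int[mu]_y (`|f y| `^ p)%:E)%E.
Proof.
move=> bk mA Arho mB Brho M0 rho0 c0 th0 p1 L2 mf fB fp.
have Afin : (mu A < +oo)%E by rewrite Arho ltry.
have Bfin : (mu B < +oo)%E by rewrite Brho ltry.
have m0 : 0 < M * rho by rewrite mulr_gt0.
have mpow (q : R) : (M * rho) `^ q = (M * rho) `^ (q - 2) * (M * rho) ^+ 2.
  rewrite -powR_mulrn ?(ltW m0)// -powRD ?subrK//.
  by rewrite (gt_eqF m0) implybT.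
have C0 : 0 < c * (M * rho) ^+ 2 * theta by rewrite !mulr_gt0// exprn_gt0.
rewrite /interp_constant /interp_exponent; case: (lerP 2 p) => [p2|p2].
  have fi := Lp_integrable mB Bfin mf fB (ltW p1) fp.
  have := kernel_op_Lp_ge2 bk mA Afin mB Brho rho0 (ltW C0) p2 mf fB fp (L2 f fi fB).
  congr (_ <= _%:E * _)%E; rewrite powRr1 ?(ltW th0)// (mpow p).
  by rewrite /GRing.exp/=; ring.
set q := p / (p - 1).
have p10 : 0 < p - 1 by rewrite subr_gt0.
have q2 : 2 <= q by rewrite ler_pdivlMr//; lra.
have btk := box_kernel_transpose bk.
set K := 2 `^ (q - 1) * (M * rho) `^ (q - 2) * (4 * (c * (M * rho) ^+ 2 * theta)).
have K0 : 0 < K by rewrite /K !mulr_gt0 ?powR_gt0// exprn_gt0.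
have := kernel_op_Lp_dual bk mA Afin mB Bfin p1 K0.
move=> /(_ f); rewrite -/q => H.
have {}H := H _ mf fB fp.
have e : 2 * (2 * K) `^ (p - 1) = 2 * (2 * (2 `^ (q - 1) * (4 * c))) `^ (p - 1) *
    (M * rho) `^ p * theta `^ (p - 1).
  have -> : 2 * K = 2 * (2 `^ (q - 1) * (4 * c)) * (M * rho) `^ q * theta.
    by rewrite (mpow q) /K; ring.
  rewrite powRM ?mulr_ge0 ?powR_ge0 ?(ltW c0) ?(ltW th0)//.
  rewrite powRM ?mulr_ge0 ?powR_ge0 ?(ltW c0)//.
  rewrite -(powRrM (M * rho)) (_ : q * (p - 1) = p); last by rewrite divfK// gt_eqF.
  by ring.
rewrite -e; apply: H => g mg gA gq.
have gi := Lp_integrable mA Afin mg gA (le_trans (ler1n _ 2) q2) gq.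
apply: (kernel_op_Lp_ge2 btk mB Bfin mA Arho rho0 _ q2 mg gA gq).
  by rewrite mulr_ge0// ltW.
(* the adjoint has the same L^2 bound, by duality at the exponent 2 *)
have [g2|g2] := eqVneq (\int[mu]_y (g y ^+ 2)%:E)%E +oo%E.
  by rewrite g2 gt0_muley ?leey// lte_fin mulr_gt0.
have q22 : 2 / (2 - 1) = 2 :> R.
  by rewrite (_ : 2 - 1 = 1 :> R) ?divr1//; lra.
have h12 : 1 < 2 :> R by lra.
have := kernel_op_Lp_dual btk mB Bfin mA Afin h12 C0.
rewrite transposeK q22 => /(_ g) HH.
have : (\int[mu]_x (`|kernel_op (transpose k) g x| `^ 2)%:E <=
  (2 * (2 * (c * (M * rho) ^+ 2 * theta)) `^ (2 - 1))%:E *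
  \int[mu]_y (`|g y| `^ 2)%:E)%E.
  apply: HH => //.
    move=> h mh hB h2.
    have hi := Lp_integrable mB Bfin mh hB (ltW h12) h2.
    have := L2 h hi hB.
    under eq_integral do rewrite -sqr_powR2.
    by under [in leRHS]eq_integral do rewrite -sqr_powR2.
  under eq_integral do rewrite sqr_powR2.
  by rewrite lt_neqAle g2 leey.
under eq_integral do rewrite sqr_powR2.
under [in leRHS]eq_integral do rewrite sqr_powR2.
rewrite (_ : 2 - 1 = 1 :> R); last by lra.
rewrite powRr1; last by rewrite mulr_ge0// ltW.
by rewrite (_ : 2 * (2 * _) = 4 * (c * (M * rho) ^+ 2 * theta))//; ring.
Qed.

End SchurLp.

(** * Oscillatory kernels on a square *)

Section OscillatorySquares.
Context {R : realType}.
Local Notation mu := (@lebesgue_measure R).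
Local Notation "x %:C" := (real_complex R x).
Implicit Types (u v : R * R -> R) (al E lam rho xa ya : R).

(** The real form of the hypotheses on the kernel, with the one derivative that the
    integration by parts in [x] consumes. *)
Definition singular_kernel (al E : R) (u u1 : R * R -> R) : Prop :=
  [/\ measurable_fun setT u,
      (forall x y : R, x != y -> `|u (x, y)| <= E * `|x - y| `^ (- al)),
      (forall x y : R, x != y -> is_derive x (1 : R) (fun s => u (s, y)) (u1 (x, y))),
      (forall x y : R, x != y -> `|u1 (x, y)| <= E * `|x - y| `^ (- al - 1)) &
      (forall x y : R, x != y -> {for x, continuous (fun s => u1 (s, y))})].

(** Half-open, so that the sides of a grid partition the line. *)
Definition side (a rho : R) : set R := `[a, a + rho[%classic.

Lemma measurable_side a rho : measurable (side a rho).
Proof. exact: measurable_itv. Qed.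

Lemma side_measure a rho : 0 < rho -> mu (side a rho) = rho%:E.
Proof.
move=> rho0; rewrite /side lebesgue_measure_itv/= lte_fin ltrDl rho0.
by rewrite -EFinD addrAC subrr add0r.
Qed.

Lemma side_cc a rho x : side a rho x -> x \in `[a, a + rho].
Proof. by rewrite /side/= !in_itv/= => /andP[-> /ltW]. Qed.

Definition osc_kernel (trig : R -> R) (lam : R) (d : nat) (b : nat -> R) u
    (xa ya rho : R) : R * R -> R :=
  fun z => \1_(side xa rho) z.1 * \1_(side ya rho) z.2 *
           (trig (lam * form d b z.1 z.2) * u z).

Lemma measurable_form d (b : nat -> R) :
  measurable_fun setT (fun z : R * R => form d b z.1 z.2).
Proof.
apply: measurable_sum => k.
apply: measurable_funM; last exact: (measurable_funX _ measurable_snd).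
apply: measurable_funM => //; exact: (measurable_funX _ measurable_fst).
Qed.

Lemma osc_kernel_in (trig : R -> R) lam d b u xa ya rho (x y : R) :
  side xa rho x -> side ya rho y ->
  osc_kernel trig lam d b u xa ya rho (x, y) = trig (lam * form d b x y) * u (x, y).
Proof.
by move=> xA yB; rewrite /osc_kernel !indicE (mem_set xA) (mem_set yB) !mul1r.
Qed.

Lemma trig_bounded (trig : R -> R) : trig = cos \/ trig = sin ->
  continuous trig /\ forall t, `|trig t| <= 1.
Proof.
case=> ->; split.
- exact: continuous_cos.
- by move=> t; rewrite ler_norml cos_geN1 cos_le1.
- exact: continuous_sin.
- by move=> t; rewrite ler_norml sin_geN1 sin_le1.
Qed.

Lemma box_osc_kernel (trig : R -> R) lam d b u (u1 : R * R -> R) al E xa ya rho :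
  continuous trig -> (forall t, `|trig t| <= 1) ->
  singular_kernel al E u u1 -> 0 < al -> 0 <= E -> 0 < rho ->
  (forall x y : R, x \in `[xa, xa + rho] -> y \in `[ya, ya + rho] -> rho <= `|x - y|) ->
  box_kernel (E * rho `^ (- al)) (side xa rho) (side ya rho)
    (osc_kernel trig lam d b u xa ya rho).
Proof.
move=> ctrig trig1 [mu_ uE _ _ _] al0 E0 rho0 far; split.
- apply: measurable_funM.
    apply: measurable_funM.
      exact: (measurableT_comp (measurable_indic (measurable_side xa rho)) measurable_fst).
    exact: (measurableT_comp (measurable_indic (measurable_side ya rho)) measurable_snd).
  apply: measurable_funM => //.
  apply: (measurableT_comp (continuous_measurable_fun ctrig)).
  by apply: measurable_funM => //; exact: measurable_form.
- case=> x y.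
  have [xA|nA] := pselect (side xa rho x); last first.
    rewrite /osc_kernel indicE memNset// !mul0r normr0.
    by rewrite mulr_ge0// powR_ge0.
  have [yB|nB] := pselect (side ya rho y); last first.
    rewrite /osc_kernel [\1_(side ya rho) _]indicE memNset// mulr0 mul0r normr0.
    by rewrite mulr_ge0// powR_ge0.
  rewrite osc_kernel_in// normrM -[leRHS]mul1r ler_pM//.
  have h := far x y (side_cc xA) (side_cc yB).
  have xy0 : 0 < `|x - y| := lt_le_trans rho0 h.
  apply: (le_trans (uE x y _)); first by rewrite -subr_eq0 -normr_gt0.
  rewrite ler_wpM2l// !powRN lef_pV2 ?posrE ?powR_gt0//.
  by rewrite ge0_ler_powR ?nnegrE ?(ltW al0) ?(ltW rho0).
- by move=> z nA; rewrite /osc_kernel indicE memNset// !mul0r.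
- by move=> z nB; rewrite /osc_kernel [\1_(side ya rho) _]indicE memNset// mulr0 mul0r.
Qed.

(** The kernel [1 / (1 + A w)] has a logarithmically divergent tail. Replaced by a power
    [(A w)^(-s)] with [s < 1], it has scale invariant integrals over intervals. *)
Lemma gain_powR (A w s : R) : 0 < A -> 0 < w -> 0 < s < 1 ->
  2 / (1 + A * w) <= 2 * (A `^ (- s) * w `^ (- s)).
Proof.
move=> A0 w0 /andP[s0 s1]; have Aw : 0 < A * w by rewrite mulr_gt0.
rewrite -powRM ?(ltW A0) ?(ltW w0)// powRN ler_wpM2l//.
rewrite lef_pV2 ?posrE ?powR_gt0 ?addr_gt0//.
have [h|h] := leP (A * w) 1.
  apply: (@le_trans _ _ (1 `^ s)).
    by rewrite ge0_ler_powR ?nnegrE ?(ltW s0) ?(ltW Aw).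
  by rewrite powR1 lerDl ltW.
apply: (@le_trans _ _ ((A * w) `^ 1)); first by rewrite ler_powR// ltW.
by rewrite powRr1 ?lerDr// ltW.
Qed.

(** Schur's test applied to the bound [square_kernel_bound] for the kernel of
    [T^* T]. *)
Lemma osc_square_L2 (N : nat) (b : nat -> R) (cs : seq R[i]) (s C : R)
    al E u (u1 : R * R -> R) lam rho xa ya (g : R -> R) :
  let D0 := \sum_(z <- cs) Normc.normc z + 2 in
  let cN := formY N.+1 (formX N.+2 b) N in
  let kc := osc_kernel cos lam N.+2 b u xa ya rho in
  let ks := osc_kernel sin lam N.+2 b u xa ya rho in
  form_roots N (formY N.+1 (formX N.+2 b)) cs ->
  0 < s < 1 -> 0 < C ->
  (forall x t l : R, 0 < l ->
    (\int[mu]_(y in `[(t - l)%R, (t + l)%R]) (`|x - y| `^ (- s))%:E <=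
     (C * l `^ (1 - s))%:E)%E) ->
  singular_kernel al E u u1 -> 0 < al -> 0 <= E -> 0 < rho -> 0 < lam ->
  (forall x y : R, x \in `[xa, xa + rho] -> y \in `[ya, ya + rho] ->
    rho <= `|x - y| /\ (forall z, z \in cs -> rho <= Normc.normc (y%:C - z * x%:C))) ->
  mu.-integrable setT (EFin \o g) -> (forall y, ~ side ya rho y -> g y = 0) ->
  (\int[mu]_x (kernel_op mu kc g x ^+ 2 + kernel_op mu ks g x ^+ 2)%:E <=
   (2 * C * kernel_gain D0 cN * (E * rho `^ (- al) * rho) ^+ 2 *
    (lam * rho ^+ N.+2) `^ (- s))%:E * \int[mu]_y (g y ^+ 2)%:E)%E.
Proof.
move=> D0 cN kc ks croots s01 C0 HC ku al0 E0 rho0 lam0 sq gi gB.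
have far x y : x \in `[xa, xa + rho] -> y \in `[ya, ya + rho] -> rho <= `|x - y|.
  by move=> xI yJ; have [] := sq x y xI yJ.
have [ccos cos1] := @trig_bounded cos (or_introl erefl).
have [csin sin1] := @trig_bounded sin (or_intror erefl).
have bc : box_kernel (E * rho `^ (- al)) (side xa rho) (side ya rho) kc.
  exact: box_osc_kernel ccos cos1 ku al0 E0 rho0 far.
have bs : box_kernel (E * rho `^ (- al)) (side xa rho) (side ya rho) ks.
  exact: box_osc_kernel csin sin1 ku al0 E0 rho0 far.
have mA := measurable_side xa rho; have mB := measurable_side ya rho.
have Afin : (mu (side xa rho) < +oo)%E by rewrite side_measure ?ltry.
have Bfin : (mu (side ya rho) < +oo)%E by rewrite side_measure ?ltry.
set M := E * rho `^ (- al) in bc bs *.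
have M0 : 0 <= M by rewrite mulr_ge0// powR_ge0.
pose A0 := lam * rho ^+ N.+1.
have A00 : 0 < A0 by rewrite mulr_gt0// exprn_gt0.
pose Kg := kernel_gain D0 cN.
have Kg0 : 0 <= Kg.
  rewrite /Kg /kernel_gain addr_ge0// divr_ge0// addr_ge0// mulr_ge0// addr_ge0//.
  by apply: sumr_ge0 => z _; exact: normc_ge0.
(* the majorant of [square_kernel_bound] *)
pose W (z : R * R) := Kg * M ^+ 2 * rho * (2 / (1 + A0 * `|z.1 - z.2|)).
have den0 (t : R) : 0 < 1 + A0 * `|t| by rewrite ltr_wpDr// mulr_ge0// ltW.
have W0 z : 0 <= W z.
  rewrite /W; apply: mulr_ge0; last by rewrite divr_ge0// ltW.
  by rewrite mulr_ge0 ?(ltW rho0)// mulr_ge0 ?sqr_ge0.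
have mW : measurable_fun setT W.
  have cw : continuous (fun t : R => 2 / (1 + A0 * `|t|)).
    move=> t; apply: cvgM; first exact: cvg_cst.
    apply: cvgV; first by rewrite gt_eqF.
    apply: cvgD; first exact: cvg_cst.
    apply: cvgM; first exact: cvg_cst.
    exact: norm_continuous.
  apply: measurable_funM => //.
  apply: (measurableT_comp (continuous_measurable_fun cw)).
  exact: (measurable_funB measurable_fst measurable_snd).
have Wsym y y' : W (y, y') = W (y', y) by rewrite /W/= distrC.
have [mu_ uE du u1E cu1] := ku.
have gramW y y' : side ya rho y -> side ya rho y' ->
    `|gram mu kc y y' + gram mu ks y y'| <= W (y, y').
  move=> yB y'B.
  have ic := gram_integrand (mu := mu) mA Afin y y' bc.
  have is_ := gram_integrand (mu := mu) mA Afin y y' bs.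
  pose h x := cos (lam * (form N.+2 b x y - form N.+2 b x y')) * (u (x, y) * u (x, y')).
  have hE x : kc (x, y) * kc (x, y') + ks (x, y) * ks (x, y') = (h \_ (side xa rho)) x.
    rewrite patchE; case: ifPn => [/set_mem xA|/negP nA].
      rewrite /kc /ks !osc_kernel_in// /h mulrBr cosB; ring.
    have nA' : ~ side xa rho x by move=> /mem_set.
    by rewrite /kc /ks /osc_kernel [\1_(side xa rho) _]indicE/= memNset// !mul0r addr0.
  have hi : mu.-integrable (side xa rho) (EFin \o h).
    apply/integrable_mkcond; first exact: mA.
    have := integrableD measurableT ic is_; apply: eq_integrable => // x _.
    by rewrite restrict_EFin; exact: (congr1 EFin (hE x)).
  have -> : gram mu kc y y' + gram mu ks y y' =
      \int[mu]_(x in `[xa, xa + rho]) h x.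
    rewrite -Rintegral_itv_bndo_bndc; last exact: hi.
    rewrite /gram -(RintegralD measurableT ic is_).
    by rewrite [RHS]Rintegral_mkcond; apply: eq_Rintegral => x _; exact: hE.
  have ynx x w : x \in `[xa, xa + rho] -> w \in `[ya, ya + rho] -> x != w.
    by move=> xI wJ; rewrite -subr_eq0 -normr_gt0 (lt_le_trans rho0)// far.
  have powle x w (e : R) : 0 < e -> x \in `[xa, xa + rho] -> w \in `[ya, ya + rho] ->
      `|x - w| `^ (- e) <= rho `^ (- e).
    move=> e0 xI wJ; have h1 := far _ _ xI wJ.
    rewrite !powRN lef_pV2 ?posrE ?powR_gt0 ?(lt_le_trans rho0)//.
    by rewrite ge0_ler_powR ?nnegrE ?(ltW e0) ?(ltW rho0).
  apply: (@square_kernel_bound R N b cs D0 1 M lam rho xa ya y y' u u1) => //.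
  - by move=> x w xI wJ; have [] := sq x w xI wJ.
  - move=> x w xI wJ; have xw := ynx _ _ xI wJ; split.
    + exact: du.
    + by apply: (le_trans (uE _ _ xw)); rewrite ler_wpM2l// powle.
    + apply: (le_trans (u1E _ _ xw)).
      rewrite (_ : - al - 1 = - (al + 1)); last by ring.
      have -> : 1 / rho * M = E * rho `^ (- (al + 1)).
        rewrite opprD powRD; last by rewrite (gt_eqF rho0) implybT.
        by rewrite powR_inv1 ?(ltW rho0)// /M; field; rewrite gt_eqF.
      by rewrite ler_wpM2l// powle// addr_gt0.
  - move=> w wJ; apply: continuous_in_subspaceT => x /set_mem xI.
    by apply: cu1; apply: ynx.
  - by rewrite lerDl.
  - by rewrite mulr1 lerDr; apply: sumr_ge0 => z _; exact: normc_ge0.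
  - exact: side_cc.
  - exact: side_cc.
have Z0 : 0 < lam * rho ^+ N.+2 by rewrite mulr_gt0// exprn_gt0.
apply: (sqr_kernel_op_schur (mu := mu) mA mB Afin Bfin _ bc bs gi gB mW W0 Wsym gramW).
  by rewrite !mulr_ge0 ?sqr_ge0 ?powR_ge0// ltW.
move=> y yB.
have mWy : measurable_fun setT (fun y' => (W (y, y'))%:E).
  apply/measurable_EFinP; exact: (measurableT_comp mW (pair1_measurable y)).
pose J : set R := `[y - rho, y + rho]%classic.
have mJ : measurable J by exact: measurable_itv.
apply: (@le_trans _ _ (\int[mu]_(y' in J) (W (y, y'))%:E)%E).
  apply: ge0_subset_integral => //.
  - exact: measurable_funTS.
  - by move=> y' _; rewrite lee_fin.
  - move=> y'; rewrite /J/= in_itv/=; move: yB; rewrite /side/= !in_itv/=.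
    by move=> /andP[? ?] /andP[? ?]; lra.
have mJy : measurable (J `\ y) by exact: measurableD.
rewrite -(@integral_setD1 _ _ y)//; last exact: measurable_funTS.
pose c1 := Kg * M ^+ 2 * rho * 2 * A0 `^ (- s).
have c10 : 0 <= c1 by rewrite /c1 !mulr_ge0 ?sqr_ge0 ?powR_ge0// ltW.
have mpow := measurable_dist_powR y (- s).
apply: (@le_trans _ _ (\int[mu]_(y' in J `\ y) (c1%:E * (`|y - y'| `^ (- s))%:E))%E).
  apply: ge0_le_integral => //.
  - by move=> y' _; rewrite lee_fin.
  - exact: measurable_funTS.
  - by apply: measurable_funTS; apply: emeasurable_funM.
  move=> y' [_ /= yy']; rewrite -EFinM lee_fin /W/=.
  have w0 : 0 < `|y - y'| by rewrite normr_gt0 subr_eq0; apply/eqP => /esym.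
  rewrite /c1 -[leRHS]mulrA -[leRHS]mulrA ler_wpM2l; last exact: gain_powR.
    by [].
  by rewrite mulr_ge0 ?(ltW rho0)// mulr_ge0 ?sqr_ge0.
rewrite ge0_integralZl ?lee_fin//; last exact: measurable_funTS.
apply: (@le_trans _ _ (c1%:E * (C * rho `^ (1 - s))%:E)%E).
  rewrite lee_wpmul2l ?lee_fin// integral_setD1//; first exact: HC.
  exact: measurable_funTS.
rewrite -EFinM lee_fin.
have -> : lam * rho ^+ N.+2 = A0 * rho by rewrite /A0 [in LHS]exprSr mulrA.
rewrite powRM ?(ltW A00) ?(ltW rho0)//.
have -> : rho `^ (1 - s) = rho * rho `^ (- s).
  rewrite -[X in _ = X * _]powRr1 ?(ltW rho0)// -powRD//.
  by rewrite (gt_eqF rho0) implybT.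
by rewrite le_eqVlt; apply/orP; left; apply/eqP; rewrite /c1 /Kg; ring.
Qed.

(** With respect to the trivial bound [rho^(1 - al)], the norm on a square of side [rho]
    at distance at least [rho] from the diagonal and from the zero lines gains a
    power of [lam * rho ^ n]. *)
Lemma osc_square_Lp (N : nat) (b : nat -> R) (cs : seq R[i]) (s p al E : R) :
  form_roots N (formY N.+1 (formX N.+2 b)) cs ->
  0 < s < 1 -> 1 < p -> 0 < al -> 0 < E ->
  exists2 K : R, 0 < K & forall (trig : R -> R) u (u1 : R * R -> R) lam rho xa ya (f : R -> R),
  trig = cos \/ trig = sin ->
  singular_kernel al E u u1 -> 0 < rho -> 0 < lam ->
  (forall x y : R, x \in `[xa, xa + rho] -> y \in `[ya, ya + rho] ->
    rho <= `|x - y| /\ (forall z, z \in cs -> rho <= Normc.normc (y%:C - z * x%:C))) ->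
  measurable_fun setT f -> (forall y, ~ side ya rho y -> f y = 0) ->
  (\int[mu]_y (`|f y| `^ p)%:E < +oo)%E ->
  (\int[mu]_x (`|kernel_op mu (osc_kernel trig lam N.+2 b u xa ya rho) f x| `^ p)%:E <=
   (K * rho `^ ((1 - al) * p) * (lam * rho ^+ N.+2) `^ (- s * interp_exponent p))%:E *
     \int[mu]_y (`|f y| `^ p)%:E)%E.
Proof.
move=> croots s01 p1 al0 E0.
have [C' C'0 HC'] := singular_integral s01.
pose C := C' + 1; have C0 : 0 < C by rewrite ltr_wpDl.
have HC x t l : 0 < l ->
    (\int[mu]_(y in `[(t - l)%R, (t + l)%R]) (`|x - y| `^ (- s))%:E <=
     (C * l `^ (1 - s))%:E)%E.
  move=> l0; apply: (le_trans (HC' x t l l0)).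
  by rewrite lee_fin ler_wpM2r ?powR_ge0// lerDl.
pose D0 := \sum_(z <- cs) Normc.normc z + 2.
pose cN := formY N.+1 (formX N.+2 b) N.
pose c := 2 * C * kernel_gain D0 cN.
have D00 : 0 <= D0 by rewrite addr_ge0//; apply: sumr_ge0 => z _; exact: normc_ge0.
have c0 : 0 < c.
  rewrite !mulr_gt0// /kernel_gain ltr_wpDr// divr_ge0// addr_ge0// mulr_ge0//.
have p10 : 0 < p - 1 by rewrite subr_gt0.
exists (interp_constant c p * E `^ p).
  rewrite mulr_gt0 ?powR_gt0// /interp_constant.
  case: ifP => _; first by rewrite mulr_gt0 ?powR_gt0.
  by rewrite mulr_gt0// powR_gt0// mulr_gt0// mulr_gt0 ?powR_gt0// mulr_gt0.
move=> trig u u1 lam rho xa ya f trigE ku rho0 lam0 sq mf fB fp.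
have far x y : x \in `[xa, xa + rho] -> y \in `[ya, ya + rho] -> rho <= `|x - y|.
  by move=> xI yJ; have [] := sq x y xI yJ.
have [ctrig trig1] := trig_bounded trigE.
have bk := box_osc_kernel lam N.+2 b ctrig trig1 ku al0 (ltW E0) rho0 far.
have mA := measurable_side xa rho; have mB := measurable_side ya rho.
have M0 : 0 < E * rho `^ (- al) by rewrite mulr_gt0// powR_gt0.
have Z0 : 0 < lam * rho ^+ N.+2 by rewrite mulr_gt0// exprn_gt0.
have th0 : 0 < (lam * rho ^+ N.+2) `^ (- s) by rewrite powR_gt0.
have := kernel_op_Lp (mu := mu) bk mA (side_measure xa rho0) mB (side_measure ya rho0)
  M0 rho0 c0 th0 p1.
move=> /(_ f) H.
have -> : interp_constant c p * E `^ p * rho `^ ((1 - al) * p) *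
    (lam * rho ^+ N.+2) `^ (- s * interp_exponent p) =
  interp_constant c p * (E * rho `^ (- al) * rho) `^ p *
    ((lam * rho ^+ N.+2) `^ (- s)) `^ interp_exponent p.
  rewrite -powRrM -!mulrA; congr (_ * _); rewrite !mulrA; congr (_ * _).
  rewrite -mulrA powRM ?mulr_ge0 ?powR_ge0 ?(ltW E0) ?(ltW rho0)//.
  congr (_ * _); rewrite -[X in _ = (_ * X) `^ _]powRr1 ?(ltW rho0)//.
  rewrite -powRD; last by rewrite (gt_eqF rho0) implybT.
  by rewrite -powRrM; congr powR; ring.
apply: H => // g gi gB.
have L2 := osc_square_L2 croots s01 C0 HC ku al0 (ltW E0) rho0 lam0 sq gi gB.
rewrite -/D0 -/cN -/c in L2.
apply: le_trans L2.
have icn tr : tr = cos \/ tr = sin -> measurable_fun setT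
    (fun x => (kernel_op mu (osc_kernel tr lam N.+2 b u xa ya rho) g x ^+ 2)%:E).
  move=> trE; have [ctr tr1] := trig_bounded trE.
  apply/measurable_EFinP; apply: measurable_funX.
  have bk' := box_osc_kernel lam N.+2 b ctr tr1 ku al0 (ltW E0) rho0 far.
  have Afin : (mu (side xa rho) < +oo)%E by rewrite side_measure ?ltry.
  exact: integrable_measurable (integrable_kernel_op (mu := mu) bk' mA Afin gi).
apply: ge0_le_integral => //.
- by move=> x _; rewrite lee_fin sqr_ge0.
- exact: icn.
- under eq_fun do rewrite EFinD.
  by apply: emeasurable_funD; apply: icn; [left|right].
move=> x _; rewrite lee_fin; case: trigE => ->.
  by rewrite lerDl sqr_ge0.
by rewrite lerDr sqr_ge0.
Qed.

End OscillatorySquares.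

(** * The dyadic decomposition of the plane relative to finitely many lines *)

(** A level, a column and a row in one of [M] square grids around the origin. *)
Notation cells B M := ('I_M * 'I_(B.*2) * 'I_(B.*2))%type.

Section Grid.
Context {R : realType}.
Local Notation "x %:C" := (real_complex R x).
Local Notation normc := (@Normc.normc R).
Implicit Types (r : seq R[i]) (i j : int) (x y t : R).

Lemma normc_ge_Re (z : R[i]) : `|complex.Re z| <= normc z.
Proof.
by case: z => a b; rewrite /Normc.normc/= -sqrtr_sqr ler_wsqrtr// lerDl sqr_ge0.
Qed.

Lemma Re_lin (z : R[i]) x y : complex.Re (y%:C - z * x%:C) = y - complex.Re z * x.
Proof. by case: z => a b; rewrite /= mulr0 subr0. Qed.

(** Real parts turn a complex line into a real one. The second band, obtained after
    division by [z], is what controls the columns. *)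
Lemma normc_band (z : R[i]) x y (c : R) : z != 0 -> normc (y%:C - z * x%:C) < c ->
  `|y - complex.Re z * x| < c /\ `|x - complex.Re z^-1 * y| < c * normc z^-1.
Proof.
move=> z0 h; split.
  by apply: le_lt_trans h; rewrite -Re_lin normc_ge_Re.
have zV0 : 0 < normc z^-1.
  rewrite lt_neqAle normc_ge0 andbT eq_sym; apply/eqP => /Normc.eq0_normc /eqP.
  by rewrite invr_eq0 (negbTE z0).
rewrite -Re_lin; apply: (le_lt_trans (normc_ge_Re _)).
have -> : x%:C - z^-1 * y%:C = - (z^-1 * (y%:C - z * x%:C)).
  by rewrite mulrBr mulrA mulVf// mul1r opprB.
by rewrite normcN Normc.normcM mulrC ltr_pM2r.
Qed.

(** Moving a point within a unit cell changes [y - z x] by at most [1 + |z|]; one more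
    unit is the distance that remains. *)
Definition grid_gap r : R := 2 + \sum_(z <- r) normc z.

Lemma grid_gap_ge r z : z \in r -> 2 + normc z <= grid_gap r.
Proof.
move=> zr; rewrite /grid_gap lerD2l (big_rem z)//= lerDl.
by apply: sumr_ge0 => w _; exact: normc_ge0.
Qed.

Lemma grid_gap_ge2 r : 2 <= grid_gap r.
Proof. by rewrite lerDl; apply: sumr_ge0 => w _; exact: normc_ge0. Qed.

(** The cell [(i, j)] of the unit grid is far, relative to its size, from all the lines
    [y = z x] with [z] in [r]. *)
Definition good r i j : bool :=
  all (fun z => grid_gap r <= normc (j%:~R%:C - z * i%:~R%:C)) r.

(** The index of the dyadic parent. *)
Definition half i : int := Num.floor (i%:~R / 2 : R).

(** The maximal good dyadic cells. *)
Definition selected r i j : bool := good r i j && ~~ good r (half i) (half j).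

Lemma half_bounds i : 0 <= (i%:~R - 2 * (half i)%:~R : R) <= 1.
Proof.
have /andP[h1 h2] := floor_itv (i%:~R / 2 : R).
rewrite -/(half i) in h1 h2; rewrite intrD mulr1z in h2.
have h1' : 2 * (half i)%:~R <= i%:~R :> R by lra.
have h3 : i%:~R < (2 * (half i) + 2)%:~R :> R by rewrite intrD intrM; lra.
have : (i <= 2 * half i + 1)%R.
  move: h3; rewrite ltr_int => h3; rewrite -ltzD1; apply: (lt_le_trans h3).
  by rewrite -addrA.
rewrite -(ler_int R) intrD intrM => h4; lra.
Qed.

Lemma floor_half t : Num.floor (t / 2) = half (Num.floor t).
Proof.
apply: floor_def; have /andP[h1 h2] := floor_itv t.
have /andP[h3 h4] := half_bounds (Num.floor t).
rewrite intrD mulr1z in h2; rewrite intrD mulr1z.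
have h5 : (Num.floor t)%:~R <= 2 * (half (Num.floor t))%:~R + 1 :> R by lra.
by apply/andP; split; [lra|lra].
Qed.

Lemma lin_perturb (z : R[i]) (e x y x' y' a b : R) :
  `|x - e * x'| <= a -> `|y - e * y'| <= b -> 0 <= e ->
  e * normc (y'%:C - z * x'%:C) - b - normc z * a <= normc (y%:C - z * x%:C).
Proof.
move=> xa yb e0.
have h : e%:C * (y'%:C - z * x'%:C) =
    (y%:C - z * x%:C) + (- (y - e * y')%:C + z * (x - e * x')%:C).
  by rewrite !rmorphB !rmorphM/=; ring.
have h2 : e * normc (y'%:C - z * x'%:C) <=
    normc (y%:C - z * x%:C) + (b + normc z * a).
  rewrite -{1}(ger0_norm e0) -normc_real -Normc.normcM h.
  apply: (le_trans (le_normcD _ _)); rewrite lerD2l.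
  apply: (le_trans (le_normcD _ _)); rewrite normcN Normc.normcM !normc_real.
  by rewrite lerD// ler_wpM2l// normc_ge0.
by lra.
Qed.

(** The distance to the lines doubles when the parent is measured in units of the
    child, which more than compensates the displacement of the corner. *)
Lemma good_half r i j : good r (half i) (half j) -> good r i j.
Proof.
move=> /allP g; apply/allP => z zr; have := g z zr.
have /andP[i1 i2] := half_bounds i; have /andP[j1 j2] := half_bounds j.
have hi : `|i%:~R - 2 * (half i)%:~R| <= 1 :> R by rewrite ger0_norm.
have hj : `|j%:~R - 2 * (half j)%:~R| <= 1 :> R by rewrite ger0_norm.
have := lin_perturb z hi hj (ler0n _ 2); have := grid_gap_ge zr.
have := normc_ge0 z; lra.
Qed.

Lemma good_far r i j (rho x y : R) z : good r i j -> 0 < rho ->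
  x \in `[i%:~R * rho, i%:~R * rho + rho] ->
  y \in `[j%:~R * rho, j%:~R * rho + rho] -> z \in r ->
  rho <= normc (y%:C - z * x%:C).
Proof.
move=> /allP g rho0; rewrite !in_itv/= => /andP[x1 x2] /andP[y1 y2] zr.
have := g z zr; have := grid_gap_ge zr.
have hx : `|x - rho * i%:~R| <= rho by rewrite ger0_norm; lra.
have hy : `|y - rho * j%:~R| <= rho by rewrite ger0_norm; lra.
have h1 := lin_perturb z hx hy (ltW rho0).
set n := normc (j%:~R%:C - _) in h1 *; move=> L1 L2.
have : rho * (2 + normc z) <= rho * n by rewrite ler_pM2l// (le_trans L1).
by rewrite mulrDr; lra.
Qed.

Lemma not_good_near r (delta x y : R) : 0 < delta ->
  ~~ good r (Num.floor (x / delta)) (Num.floor (y / delta)) ->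
  exists2 z, z \in r & normc (y%:C - z * x%:C) < 2 * grid_gap r * delta.
Proof.
move=> d0 /allPn[z zr]; rewrite -ltNge => h; exists z => //.
set i := Num.floor (x / delta) in h *; set j := Num.floor (y / delta) in h *.
have fl t : `|(Num.floor (t / delta))%:~R - delta^-1 * t| <= 1 :> R.
  have /andP[h1 h2] := floor_itv (t / delta); rewrite intrD mulr1z in h2.
  by rewrite [_^-1 * t]mulrC ler_norml; lra.
have dV : 0 <= delta^-1 by rewrite invr_ge0 ltW.
have h1 := lin_perturb z (fl x) (fl y) dV.
rewrite -/i -/j in h1; have := grid_gap_ge zr => h2.
have h3 : delta^-1 * normc (y%:C - z * x%:C) < 2 * grid_gap r.
  by have := normc_ge0 z; lra.
by rewrite -ltr_pdivrMr// [_ / delta]mulrC.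
Qed.

(** The diagonal passes close to the cells around the origin. *)
Lemma not_good_small r i j : 1 \in r -> (-1 <= i <= 0)%R -> (-1 <= j <= 0)%R ->
  ~~ good r i j.
Proof.
move=> r1; rewrite -!(ler_int R) => /andP[i1 i2] /andP[j1 j2].
apply/negP => /allP /(_ _ r1); apply/negP; rewrite -ltNge mul1r -rmorphB normc_real.
apply: (@lt_le_trans _ _ 2); last exact: grid_gap_ge2.
by rewrite ltr_norml; lra.
Qed.

Definition grid_width r : R :=
  3 * grid_gap r * (1 + \sum_(z <- r) normc z^-1).

Lemma grid_width_ge r z : z \in r ->
  3 * grid_gap r <= grid_width r /\ 3 * grid_gap r * normc z^-1 <= grid_width r.
Proof.
move=> zr; have g0 : 0 <= 3 * grid_gap r.
  by rewrite mulr_ge0// (le_trans _ (grid_gap_ge2 r)).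
have s0 : 0 <= \sum_(z <- r) normc z^-1 by apply: sumr_ge0 => w _; exact: normc_ge0.
rewrite /grid_width; split; first by rewrite ler_peMr// lerDl.
rewrite ler_wpM2l// (big_rem z)//=.
have : 0 <= \sum_(y <- rem z r) normc y^-1.
  by apply: sumr_ge0 => w _; exact: normc_ge0.
by have := normc_ge0 z^-1; lra.
Qed.

(** The parent of a selected cell is close to one of the lines, hence so is the
    cell. *)
Lemma selected_close r i j : (forall z, z \in r -> z != 0) -> selected r i j ->
  exists2 z, z \in r & `|j%:~R - complex.Re z * i%:~R| < grid_width r /\
                       `|i%:~R - complex.Re z^-1 * j%:~R| < grid_width r.
Proof.
move=> rn0 /andP[_ /allPn[z zr]]; rewrite -ltNge => h; exists z => //.
have /andP[i1 i2] := half_bounds i; have /andP[j1 j2] := half_bounds j.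
have hi : `|(half i)%:~R - 2^-1 * i%:~R| <= 2^-1 :> R by rewrite ler_norml; lra.
have hj : `|(half j)%:~R - 2^-1 * j%:~R| <= 2^-1 :> R by rewrite ler_norml; lra.
have e0 : 0 <= 2^-1 :> R by [].
have h1 := lin_perturb z hi hj e0; have h2 := grid_gap_ge zr.
have h3 : normc (j%:~R%:C - z * i%:~R%:C) < 3 * grid_gap r.
  by have := normc_ge0 z; lra.
have [h4 h5] := normc_band (rn0 _ zr) h3; have [g1 g2] := grid_width_ge zr.
by split; [exact: lt_le_trans h4 g1|exact: lt_le_trans h5 g2].
Qed.

(** Indices shifted so that ordinals enumerate the cells around the origin. *)
Definition idx (B k : nat) : int := k%:Z - B%:Z.

Lemma idx_inj B : injective (idx B).
Proof. by move=> k l /addIr []. Qed.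

(** Consecutive integers starting at the smallest solution contain all the
    solutions. *)
Lemma count_close (B n K : nat) t (w : R) : 2 * w <= K%:R ->
  \sum_(l < n) (`|(idx B l)%:~R - t| < w)%R%:R <= K%:R :> R.
Proof.
move=> wK; pose P (l : nat) := `|(idx B l)%:~R - t| < w.
rewrite -natr_sum ler_nat.
have -> : (\sum_(l < n) (`|(idx B l)%:~R - t| < w)%R = size [seq l <- iota 0 n | P l])%N.
  by rewrite size_filter -sum1_count [in RHS]big_mkcond/=
    -(big_mkord xpredT (fun l => nat_of_bool (P l)))
    /index_iota subn0; apply: eq_bigr => l _; rewrite /P; case: ifP.
have [[a Pa]|nP] := pselect (exists a, P a); last first.
  rewrite (_ : [seq l <- _ | _] = [::])//.
  apply/eqP; rewrite -size_eq0 size_filter -leqn0 leqNgt -has_count.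
  by apply/hasPn => l _; apply/negP => Pl; apply: nP; exists l.
have ex : exists a, P a by exists a.
case: (ex_minnP ex) => a0 Pa0 amin.
rewrite -(size_iota a0 K); apply: uniq_leq_size; first by rewrite filter_uniq// iota_uniq.
move=> l; rewrite mem_filter mem_iota => /andP[Pl _].
rewrite mem_iota amin//= -(ltr_nat R) natrD.
move: Pl Pa0; rewrite /P /idx !intrB !ltr_norml -!pmulrn.
by move=> /andP[? ?] /andP[? ?]; lra.
Qed.

(** A bound for the number of selected cells in a row or a column. *)
Definition grid_count r : nat := (size r * Num.bound (2 * grid_width r))%N.

Lemma bound_grid_width r : 2 * grid_width r <= (Num.bound (2 * grid_width r))%:R.
Proof.
apply/ltW/archi_boundP; rewrite mulr_ge0// mulr_ge0//.
  by rewrite mulr_ge0// (le_trans _ (grid_gap_ge2 r)).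
by rewrite addr_ge0//; apply: sumr_ge0 => w _; exact: normc_ge0.
Qed.

Lemma sum_bool_le_seq (n : nat) (b : 'I_n -> bool) (I : eqType) (s : seq I)
    (c : I -> 'I_n -> bool) (K : R) :
  (forall l, b l -> exists2 z, z \in s & c z l) ->
  (forall z, z \in s -> \sum_(l < n) (c z l)%:R <= K) ->
  \sum_(l < n) (b l)%:R <= (size s)%:R * K.
Proof.
move=> bc cK; apply: (@le_trans _ _ (\sum_(z <- s) \sum_(l < n) (c z l)%:R)).
  rewrite exchange_big/=; apply: ler_sum => l _.
  case: (boolP (b l)) => [/bc[z zs czl]|_]; last by apply: sumr_ge0.
  by rewrite (big_rem z)//= czl lerDl; apply: sumr_ge0.
apply: (@le_trans _ _ (\sum_(z <- s) K)).
  by rewrite !big_seq; apply: ler_sum => z /cK.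
by rewrite big_const_seq count_predT iter_addr_0 mulr_natl.
Qed.

Lemma selected_row r (B n : nat) i : (forall z, z \in r -> z != 0) ->
  \sum_(l < n) (selected r i (idx B l))%:R <= (grid_count r)%:R :> R.
Proof.
move=> rn0; rewrite natrM.
apply: (@sum_bool_le_seq n _ _ r (fun z (l : 'I_n) =>
   `|(idx B l)%:~R - complex.Re z * i%:~R| < grid_width r)).
  by move=> l /(selected_close rn0)[z zr [h _]]; exists z.
by move=> z _; apply: count_close; exact: bound_grid_width.
Qed.

Lemma selected_col r (B n : nat) j : (forall z, z \in r -> z != 0) ->
  \sum_(k < n) (selected r (idx B k) j)%:R <= (grid_count r)%:R :> R.
Proof.
move=> rn0; rewrite natrM.
apply: (@sum_bool_le_seq n _ _ r (fun z (k : 'I_n) =>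
   `|(idx B k)%:~R - complex.Re z^-1 * j%:~R| < grid_width r)).
  by move=> l /(selected_close rn0)[z zr [_ h]]; exists z.
by move=> z _; apply: count_close; exact: bound_grid_width.
Qed.

Lemma sum_idx (B : nat) (F : int -> R) i : (- B%:Z <= i < B%:Z)%R ->
  \sum_(k < B.*2) F (idx B k) * (i == idx B k)%:R = F i.
Proof.
move=> /andP[i1 i2].
have iB : (0 <= i + B%:Z)%R by rewrite -lerBlDr sub0r.
have kE : (`|(i + B%:Z)%R|%N)%:Z = i + B%:Z by rewrite gez0_abs.
have kB : (`|(i + B%:Z)%R| < B.*2)%N.
  by rewrite -ltz_nat kE -addnn PoszD ltrD2r.
pose k0 := Ordinal kB.
have k0E : idx B k0 = i by rewrite /idx/= kE addrK.
rewrite (bigD1 k0)//= k0E eqxx mulr1 big1 ?addr0// => k kk0.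
rewrite -k0E (inj_eq (@idx_inj B)).
by rewrite (_ : (_ == _) = false) ?mulr0//; apply/negbTE; rewrite eq_sym.
Qed.

(** The indicator of the cells that are good at level [m] telescopes: a good cell is
    either selected or has a good parent. At level [0] the remainder is the
    neighbourhood of the lines. At level [M] the cells of the points considered touch
    the origin, and are not good. *)
Lemma grid_partition r (B M : nat) (delta D x y : R) : 1 \in r -> 0 < delta ->
  `|x| < D -> `|y| < D -> D <= B%:R * delta -> D <= 2 ^+ M * delta ->
  let fl (m : nat) t := Num.floor (t / (2 ^+ m * delta)) in
  (~~ good r (fl 0%N x) (fl 0%N y))%:R +
  \sum_(t : cells B M)
    (selected r (idx B t.1.2) (idx B t.2))%:R *
    ((fl t.1.1 x == idx B t.1.2)%:R * (fl t.1.1 y == idx B t.2)%:R) = 1 :> R.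
Proof.
move=> r1 d0 xD yD DB DM fl.
have rho0 m : 0 < 2 ^+ m * delta by rewrite mulr_gt0// exprn_gt0.
have flS m t : fl m.+1 t = half (fl m t).
  rewrite /fl -floor_half; congr Num.floor; rewrite exprS; field.
  by rewrite expf_neq0 ?pnatr_eq0// gt_eqF.
have flB m t : `|t| < D -> (- B%:Z <= fl m t < B%:Z)%R.
  move=> tD; have tB : `|t / (2 ^+ m * delta)| < B%:R.
    rewrite normrM normfV (gtr0_norm (rho0 m)) ltr_pdivrMr//.
    apply: (lt_le_trans tD); apply: (le_trans DB); rewrite ler_wpM2l//.
    by rewrite ler_peMl ?(ltW d0)// exprn_ege1// ler1n.
  move: tB; rewrite ltr_norml => /andP[h1 h2].
  rewrite floor_ge_int floor_lt_int; apply/andP; split.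
    by rewrite mulrNz -pmulrn ltW.
  by rewrite -pmulrn.
have flM t : `|t| < D -> (-1 <= fl M t <= 0)%R.
  move=> tD; have : `|t / (2 ^+ M * delta)| < 1.
    rewrite normrM normfV (gtr0_norm (rho0 M)) ltr_pdivrMr// mul1r.
    exact: lt_le_trans tD DM.
  rewrite ltr_norml => /andP[h1 h2]; rewrite floor_ge_int floor_le0 h2 andbT.
  by rewrite ltW.
have lev m : \sum_(k < B.*2) \sum_(l < B.*2)
    (selected r (idx B k) (idx B l))%:R *
      ((fl m x == idx B k)%:R * (fl m y == idx B l)%:R) =
    (good r (fl m x) (fl m y))%:R - (good r (fl m.+1 x) (fl m.+1 y))%:R :> R.
  under eq_bigr => k _.
    under eq_bigr => l _.
      rewrite (_ : _ * (_ * _) = (fl m x == idx B k)%:R *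
        ((selected r (idx B k) (idx B l))%:R * (fl m y == idx B l)%:R)); last by ring.
      over.
    rewrite -mulr_sumr (sum_idx (fun j => (selected r (idx B k) j)%:R) (flB m y yD)).
    rewrite mulrC.
    over.
  rewrite (sum_idx (fun i => (selected r i (fl m y))%:R) (flB m x xD)).
  rewrite !flS /selected.
  have := @good_half r (fl m x) (fl m y).
  case: (good r (half _) _) => [/(_ isT) ->|_]; first by rewrite subrr.
  by rewrite andbT subr0.
have -> : \sum_(t : cells B M)
    (selected r (idx B t.1.2) (idx B t.2))%:R *
    ((fl t.1.1 x == idx B t.1.2)%:R * (fl t.1.1 y == idx B t.2)%:R) =
  \sum_(m < M) \sum_(k < B.*2) \sum_(l < B.*2)
    (selected r (idx B k) (idx B l))%:R *
      ((fl m x == idx B k)%:R * (fl m y == idx B l)%:R) :> R.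
  by rewrite pair_big/= pair_big/=.
under eq_bigr do rewrite lev.
rewrite -(big_mkord xpredT (fun m => (good r (fl m x) (fl m y))%:R -
  (good r (fl m.+1 x) (fl m.+1 y))%:R)).
have -> : \sum_(0 <= m < M) ((good r (fl m x) (fl m y))%:R -
    (good r (fl m.+1 x) (fl m.+1 y))%:R) =
    (good r (fl 0%N x) (fl 0%N y))%:R - (good r (fl M x) (fl M y))%:R :> R.
  elim: (M) => [|M' ih]; first by rewrite big_nil subrr.
  by rewrite big_nat_recr//= ih addrA subrK.
rewrite (negbTE (not_good_small r1 (flM x xD) (flM y yD))) subr0.
by case: (good _ _ _); rewrite ?add0r ?addr0.
Qed.

End Grid.

(** * The kernel near the lines, and the weights of the dyadic squares *)

Section Assembly.
Context {R : realType}.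
Local Notation mu := (@lebesgue_measure R).
Local Notation "x %:C" := (real_complex R x).
Implicit Types (r : seq R[i]) (f : R -> R) (al E w p : R).

(** The bands in both variables are kept, so that rows and columns are symmetric. *)
Definition near_line al E w (z : R[i]) (q : R * R) : R :=
  E * `|q.1 - q.2| `^ (- al) *
    (\1_(`[- w, w]%classic) (q.2 - complex.Re z * q.1) *
     \1_(`[- w, w]%classic) (q.1 - complex.Re z^-1 * q.2)).

Definition near_kernel r al E w (q : R * R) : R := \sum_(z <- r) near_line al E w z q.

Lemma near_line_ge0 al E w z q : 0 <= E -> 0 <= near_line al E w z q.
Proof. by move=> E0; rewrite !mulr_ge0 ?powR_ge0. Qed.

Lemma near_kernel_ge0 r al E w q : 0 <= E -> 0 <= near_kernel r al E w q.
Proof. by move=> E0; apply: sumr_ge0 => z _; exact: near_line_ge0. Qed.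

Lemma measurable_near_line al E w z : measurable_fun setT (near_line al E w z).
Proof.
have mI : measurable_fun setT (\1_(`[- w, w]%classic) : R -> R).
  by apply: measurable_indic; exact: measurable_itv.
have mz (a : R) : measurable_fun setT (fun q : R * R => q.2 - a * q.1).
  by apply: measurable_funB; [exact: measurable_snd|exact: measurable_funM].
have mz' (a : R) : measurable_fun setT (fun q : R * R => q.1 - a * q.2).
  by apply: measurable_funB; [exact: measurable_fst|exact: measurable_funM].
apply: measurable_funM.
  apply: measurable_funM => //; apply: (measurableT_comp (measurable_powR _)).
  by apply: measurableT_comp => //; exact: (measurable_funB measurable_fst measurable_snd).
by apply: measurable_funM; exact: (measurableT_comp mI).
Qed.

Lemma measurable_near_kernel r al E w : measurable_fun setT (near_kernel r al E w).
Proof. by apply: measurable_sum => z; exact: measurable_near_line. Qed.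

Lemma near_marginal r (K w al E : R) (G : R[i] -> R -> R) (c : R[i] -> R) (x : R) :
  0 <= E ->
  (forall z, measurable_fun setT (G z)) ->
  (forall z y, 0 <= G z y) ->
  (forall z y, G z y <= E * `|x - y| `^ (- al) * \1_(`[c z - w, c z + w]%classic) y) ->
  (forall z, (\int[mu]_(y in `[(c z - w)%R, (c z + w)%R]) (`|x - y| `^ (- al))%:E <= K%:E)%E) ->
  (\int[mu]_y (\sum_(z <- r) G z y)%:E <= ((size r)%:R * (E * K))%:E)%E.
Proof.
move=> E0 mG G0 GE GK.
under eq_integral do rewrite -sumEFin.
rewrite ge0_integral_sum//; last 2 first.
- by move=> z; apply/measurable_EFinP; exact: mG.
- by move=> z y _; rewrite lee_fin.
rewrite mulr_natl -iter_addr_0 -count_predT -big_const_seq -sumEFin.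
apply: lee_sum => z _.
have mJ : measurable (`[c z - w, c z + w]%classic : set R) by exact: measurable_itv.
have md := measurable_dist_powR x (- al).
apply: (@le_trans _ _ (\int[mu]_y (E%:E * (`|x - y| `^ (- al) *
    \1_(`[c z - w, c z + w]%classic) y)%:E))%E).
  apply: ge0_le_integral => //.
  - by move=> y _; rewrite lee_fin.
  - by apply/measurable_EFinP; exact: mG.
  - apply: emeasurable_funM => //; apply/measurable_EFinP; apply: measurable_funM.
      exact/measurable_EFinP.
    exact: measurable_indic.
  - by move=> y _; rewrite -EFinM lee_fin mulrA.
rewrite ge0_integralZl ?lee_fin//; last first.
  apply/measurable_EFinP; apply: measurable_funM; first exact/measurable_EFinP.
  exact: measurable_indic.
rewrite EFinM lee_wpmul2l ?lee_fin//; apply: le_trans (GK z).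
rewrite [leRHS]integral_mkcond; apply: ge0_le_integral => //.
- apply/measurable_EFinP; apply: measurable_funM; first exact/measurable_EFinP.
  exact: measurable_indic.
- by apply/(measurable_restrictT _ mJ); exact: measurable_funTS.
- move=> y _; rewrite patchE indicE; case: (y \in _); first by rewrite mulr1.
  by rewrite mulr0.
Qed.

(** Each row and each column meets a band in an interval of length [2 * w], over which
    the singularity has integral at most [C * w ^ (1 - al)], whatever its position. *)
Lemma near_kernel_Lp r al E p : 0 < al < 1 -> 0 < E -> 1 < p ->
  exists2 K : R, 0 < K & forall w f, 0 < w -> measurable_fun setT f ->
  (\int[mu]_x ((\int[mu]_y (near_kernel r al E w (x, y) * `|f y|)%:E) `^ p) <=
    (K * w `^ ((1 - al) * p))%:E * \int[mu]_y (`|f y| `^ p)%:E)%E.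
Proof.
move=> al01 E0 p1; have [C C0 HC] := singular_integral al01.
pose N := (size r)%:R * (E * C) + 1.
have N0 : 0 < N by rewrite ltr_wpDl// !mulr_ge0// ltW.
exists ((2 * N) `^ p); first by rewrite powR_gt0// mulr_gt0.
move=> w f w0 mf.
have wal0 : 0 < w `^ (1 - al) by rewrite powR_gt0.
have -> : (2 * N) `^ p * w `^ ((1 - al) * p) = (2 * (N * w `^ (1 - al))) `^ p.
  by rewrite mulrA [in RHS]powRM ?mulr_ge0 ?(ltW N0) ?powR_ge0// powRrM.
have le1 : (size r)%:R * (E * (C * w `^ (1 - al))) <= N * w `^ (1 - al).
  by rewrite /N mulrDl mul1r !mulrA lerDl ltW.
have ind1 (t : R) : \1_(`[- w, w]%classic) t <= 1 :> R.
  by rewrite indicE lern1 leq_b1.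
have indE (t c y : R) : y - c = t -> \1_(`[- w, w]%classic) t = \1_(`[c - w, c + w]%classic) y :> R.
  move=> <-; rewrite !indicE; congr (_%:R); congr nat_of_bool.
  by apply/idP/idP; rewrite !inE/= !in_itv/= => /andP[? ?]; apply/andP; split; lra.
apply: schur_Lp => //.
- by rewrite mulr_gt0.
- exact: measurable_near_kernel.
- by move=> z; apply: near_kernel_ge0; exact: ltW.
- move=> x; apply: (@le_trans _ _ ((size r)%:R * (E * (C * w `^ (1 - al))))%:E); last first.
    by rewrite lee_fin.
  apply: (@near_marginal r _ w al E _ (fun z => complex.Re z * x) x) => //.
  + exact: ltW.
  + by move=> z; exact: (measurableT_comp (measurable_near_line _ _ _ z) (pair1_measurable x)).
  + by move=> z y; apply: near_line_ge0; exact: ltW.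
  + move=> z y; rewrite /near_line ler_wpM2l ?mulr_ge0 ?powR_ge0 ?(ltW E0)//=.
    rewrite (indE _ (complex.Re z * x) y)// -[leRHS]mulr1 ler_wpM2l//.
  + by move=> z; exact: HC.
- move=> y; apply: (@le_trans _ _ ((size r)%:R * (E * (C * w `^ (1 - al))))%:E); last first.
    by rewrite lee_fin.
  apply: (@near_marginal r _ w al E _ (fun z => complex.Re z^-1 * y) y) => //.
  + exact: ltW.
  + by move=> z; exact: (measurableT_comp (measurable_near_line _ _ _ z) (pair2_measurable y)).
  + by move=> z x; apply: near_line_ge0; exact: ltW.
  + move=> z x; rewrite /near_line distrC ler_wpM2l ?mulr_ge0 ?powR_ge0 ?(ltW E0)//=.
    rewrite (indE (x - complex.Re z^-1 * y) (complex.Re z^-1 * y) x)//.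
    by rewrite -[leRHS]mul1r ler_wpM2r.
  + by move=> z; exact: HC.
Qed.

(** Hoelder's inequality for sums with the maximum of the [q i] in place of their
    [l^p] mean: each [q i] is at most the [p]-th root of the sum. *)
Lemma powR_sum_weighted (I : finType) (a w q : I -> R) (W p : R) :
  1 <= p -> 0 <= W -> (forall i, 0 <= a i) -> (forall i, 0 <= w i) ->
  (forall i, 0 <= q i) -> (forall i, a i <= w i * q i) -> \sum_i w i <= W ->
  (\sum_i a i) `^ p <= W `^ p * \sum_i q i `^ p.
Proof.
move=> p1 W0 a0 w0 q0 awq wW; have p0 : 0 < p by exact: lt_le_trans p1.
set S := \sum_i q i `^ p.
have S0 : 0 <= S by apply: sumr_ge0 => i _; exact: powR_ge0.
have qS i : q i <= S `^ p^-1.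
  have -> : q i = (q i `^ p) `^ p^-1 by rewrite -powRrM mulfV ?gt_eqF// powRr1.
  rewrite ge0_ler_powR ?nnegrE ?powR_ge0 ?invr_ge0 ?(ltW p0)//.
  by rewrite /S (bigD1 i)//= lerDl; apply: sumr_ge0 => j _; exact: powR_ge0.
have : \sum_i a i <= W * S `^ p^-1.
  apply: (@le_trans _ _ (\sum_i w i * S `^ p^-1)).
    by apply: ler_sum => i _; apply: (le_trans (awq i)); rewrite ler_wpM2l.
  by rewrite -mulr_suml ler_wpM2r ?powR_ge0.
move=> h; have -> : W `^ p * S = (W * S `^ p^-1) `^ p.
  by rewrite powRM ?powR_ge0// -powRrM mulVf ?gt_eqF// powRr1.
rewrite ge0_ler_powR ?nnegrE ?(ltW p0)//; first by apply: sumr_ge0.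
by rewrite mulr_ge0// powR_ge0.
Qed.

Lemma sum_idx_le1 (B n : nat) (i : int) :
  \sum_(k < n) (i == idx B k)%:R <= 1 :> R.
Proof.
rewrite -natr_sum lern1.
have [[k0 /eqP k0E]|nk] := pselect (exists k : 'I_n, i == idx B k).
  rewrite (bigD1 k0)//= k0E eqxx big1// => k kk0.
  rewrite (inj_eq (@idx_inj B)) (_ : (_ == _) = false)//.
  by apply/negbTE; rewrite eq_sym.
by rewrite big1// => k _; case: eqP => // /eqP ik; case: nk; exists k.
Qed.

(** At each level a point belongs to at most one strip of cells, and a strip contains at
    most [grid_count r] selected cells. *)
Lemma weight_sum_row r (B M : nat) (tau : R) (v : nat -> int) :
  (forall z, z \in r -> z != 0) -> 0 <= tau < 1 ->
  \sum_(t : cells B M) tau ^+ t.1.1 *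
    ((selected r (idx B t.1.2) (idx B t.2))%:R * (v t.1.1 == idx B t.1.2)%:R)
  <= (grid_count r)%:R / (1 - tau) :> R.
Proof.
move=> rn0 tau01; have /andP[tau0 _] := tau01.
have -> : \sum_(t : cells B M) tau ^+ t.1.1 *
    ((selected r (idx B t.1.2) (idx B t.2))%:R * (v t.1.1 == idx B t.1.2)%:R) =
  \sum_(m < M) \sum_(k < B.*2) \sum_(l < B.*2) tau ^+ m *
    ((selected r (idx B k) (idx B l))%:R * (v m == idx B k)%:R) :> R.
  by rewrite pair_big/= pair_big/=.
apply: (@le_trans _ _ (\sum_(m < M) (grid_count r)%:R * tau ^+ m)); last first.
  rewrite -(big_mkord xpredT (fun m => (grid_count r)%:R * tau ^+ m)).
  exact: geometric_partial_le.
apply: ler_sum => m _.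
apply: (@le_trans _ _ (\sum_(k < B.*2)
    ((grid_count r)%:R * tau ^+ m) * (v m == idx B k)%:R)); last first.
  rewrite -mulr_sumr -[leRHS]mulr1 ler_wpM2l ?sum_idx_le1//.
  by rewrite mulr_ge0// exprn_ge0.
apply: ler_sum => k _; rewrite -mulr_sumr -mulr_suml mulrA ler_wpM2r//.
by rewrite mulrC ler_wpM2r ?exprn_ge0// selected_row.
Qed.

Lemma weight_sum_col r (B M : nat) (tau : R) (v : nat -> int) :
  (forall z, z \in r -> z != 0) -> 0 <= tau < 1 ->
  \sum_(t : cells B M) tau ^+ t.1.1 *
    ((selected r (idx B t.1.2) (idx B t.2))%:R * (v t.1.1 == idx B t.2)%:R)
  <= (grid_count r)%:R / (1 - tau) :> R.
Proof.
move=> rn0 tau01; have /andP[tau0 _] := tau01.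
have -> : \sum_(t : cells B M) tau ^+ t.1.1 *
    ((selected r (idx B t.1.2) (idx B t.2))%:R * (v t.1.1 == idx B t.2)%:R) =
  \sum_(m < M) \sum_(k < B.*2) \sum_(l < B.*2) tau ^+ m *
    ((selected r (idx B k) (idx B l))%:R * (v m == idx B l)%:R) :> R.
  by rewrite pair_big/= pair_big/=.
apply: (@le_trans _ _ (\sum_(m < M) (grid_count r)%:R * tau ^+ m)); last first.
  rewrite -(big_mkord xpredT (fun m => (grid_count r)%:R * tau ^+ m)).
  exact: geometric_partial_le.
apply: ler_sum => m _; rewrite exchange_big/=.
apply: (@le_trans _ _ (\sum_(l < B.*2)
    ((grid_count r)%:R * tau ^+ m) * (v m == idx B l)%:R)); last first.
  rewrite -mulr_sumr -[leRHS]mulr1 ler_wpM2l ?sum_idx_le1//.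
  by rewrite mulr_ge0// exprn_ge0.
apply: ler_sum => l _; rewrite -mulr_sumr -mulr_suml mulrA ler_wpM2r//.
by rewrite mulrC ler_wpM2r ?exprn_ge0// selected_col.
Qed.

Lemma indic_side_floor (i : int) (rho x : R) : 0 < rho ->
  \1_(side (i%:~R * rho) rho) x = (Num.floor (x / rho) == i)%:R :> R.
Proof.
move=> rho0; rewrite indicE; congr (_%:R); congr nat_of_bool.
have h : (x \in side (i%:~R * rho) rho) = (i%:~R <= x / rho < (i + 1)%:~R).
  apply/idP/idP.
    rewrite inE /side/= in_itv/= => /andP[h1 h2].
    by rewrite ler_pdivlMr// h1 ltr_pdivrMr// intrD mulrDl mul1r.
  rewrite ler_pdivlMr// ltr_pdivrMr// intrD mulrDl mul1r => h.
  by rewrite inE /side/= in_itv.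
rewrite h; apply/idP/idP; first by move=> h1; apply/eqP; exact: floor_def.
by move=> /eqP <-; exact: floor_itv.
Qed.

(** The upper bound on [p] gives the inequality for [p >= 2], as
    [n - 2 al < n]. For [p < 2] it reads [n < p (n - 1 + al)], and follows from the
    lower bound since [(n - 2 al) (n - 1 + al) - n (n - 1 - al) = 2 al (1 - al)]. *)
Lemma scaling_exponent (al p n : R) : 2 <= n -> 0 < al < 1 ->
  (n - 2 * al) / (n - 1 - al) <= p <= (n - 2 * al) / (1 - al) ->
  1 < p /\ (1 - al) * p < n * interp_exponent p.
Proof.
move=> n2 /andP[al0 al1] /andP[p1 p2].
have d1 : 0 < n - 1 - al by lra.
have d2 : 0 < 1 - al by lra.
move: p1 p2; rewrite ler_pdivrMr// ler_pdivlMr// => h1 h2.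
have aa : 0 < al * (1 - al) by rewrite mulr_gt0.
rewrite /interp_exponent; split; first by rewrite -(ltr_pM2r d1); lra.
case: ifP => _; first by lra.
suff : n * (n - 1 - al) < p * (n - (1 - al)) * (n - 1 - al).
  by rewrite ltr_pM2r//; lra.
apply: (@lt_le_trans _ _ ((n - 2 * al) * (n - (1 - al)))); first by lra.
by rewrite mulrAC ler_wpM2r//; lra.
Qed.

End Assembly.

(** * Summation over the dyadic squares *)

Section Pieces.
Context {R : realType}.
Local Notation mu := (@lebesgue_measure R).
Local Notation "x %:C" := (real_complex R x).
Implicit Types (r cs : seq R[i]) (f : R -> R) (al E w p delta lam : R).

Lemma exprn_powR (x : R) (m : nat) (e : R) : 0 <= x -> (x ^+ m) `^ e = (x `^ e) ^+ m.
Proof.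
by move=> x0; rewrite -powR_mulrn// -powRrM mulrC powRrM powR_mulrn ?powR_ge0.
Qed.

Lemma pow2_lt1 (e : R) : e < 0 -> 2 `^ e < 1.
Proof.
move=> e0; rewrite -[e]opprK powRN invf_lt1 ?powR_gt0//.
suff : 1 `^ (- e) < 2 `^ (- e) by rewrite powR1.
by rewrite gt0_ltr_powR ?oppr_gt0 ?nnegrE// ltr1n.
Qed.

Definition cell_kernel (trig : R -> R) lam (d : nat) (b : nat -> R) (u : R * R -> R)
    delta (m : nat) (i j : int) : R * R -> R :=
  osc_kernel trig lam d b u (i%:~R * (2 ^+ m * delta)) (j%:~R * (2 ^+ m * delta))
    (2 ^+ m * delta).

Definition cell_cut delta (m : nat) (j : int) f (y : R) : R :=
  \1_(side (j%:~R * (2 ^+ m * delta)) (2 ^+ m * delta)) y * f y.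

(** The function is cut to the side of the cell, although the kernel already is, so
    that the contributions of different cells are measured by disjoint parts of
    [f]. *)
Definition cell_op trig lam d b u delta m i j f : R -> R :=
  kernel_op mu (cell_kernel trig lam d b u delta m i j) (cell_cut delta m j f).

Lemma mesh_gt0 delta (m : nat) : 0 < delta -> 0 < 2 ^+ m * delta.
Proof. by move=> d0; rewrite mulr_gt0// exprn_gt0. Qed.

Lemma good_square r cs (i j : int) (rho x y : R) : r = 1 :: cs -> good r i j ->
  0 < rho ->
  x \in `[i%:~R * rho, i%:~R * rho + rho] ->
  y \in `[j%:~R * rho, j%:~R * rho + rho] ->
  rho <= `|x - y| /\ (forall z, z \in cs -> rho <= Normc.normc (y%:C - z * x%:C)).
Proof.
move=> -> g rho0 xI yJ; split.
  have h := good_far g rho0 xI yJ (mem_head _ _).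
  by move: h; rewrite mul1r -rmorphB normc_real distrC.
by move=> z zcs; apply: (good_far g rho0 xI yJ); rewrite inE zcs orbT.
Qed.

Lemma measurable_cell_cut delta m j f : measurable_fun setT f ->
  measurable_fun setT (cell_cut delta m j f).
Proof.
move=> mf; apply: measurable_funM => //.
exact: measurable_indic (measurable_side _ _).
Qed.

Lemma cell_cut_out delta m j f y :
  ~ side (j%:~R * (2 ^+ m * delta)) (2 ^+ m * delta) y -> cell_cut delta m j f y = 0.
Proof. by move=> nB; rewrite /cell_cut indicE memNset// mul0r. Qed.

Lemma cell_cut_powR delta m j f p y : 0 < delta -> p != 0 ->
  `|cell_cut delta m j f y| `^ p =
    (Num.floor (y / (2 ^+ m * delta)) == j)%:R * `|f y| `^ p.
Proof.
move=> d0 p0; rewrite /cell_cut indic_side_floor ?mesh_gt0//.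
by case: eqP => _; rewrite ?mul1r// !mul0r normr0 powR0.
Qed.

Lemma le_cell_cut_powR delta m j f p : 0 < delta -> p != 0 -> measurable_fun setT f ->
  (\int[mu]_y (`|cell_cut delta m j f y| `^ p)%:E <= \int[mu]_y (`|f y| `^ p)%:E)%E.
Proof.
move=> d0 p0 mf; apply: ge0_le_integral => //.
- by apply: measurable_powR_norm; exact: measurable_cell_cut.
- exact: measurable_powR_norm.
move=> y _; rewrite lee_fin cell_cut_powR// ler_piMl ?powR_ge0// lern1; exact: leq_b1.
Qed.

(** The estimate of [osc_square_Lp] at the dyadic scale [2 ^ m * delta], when
    [lam * delta ^ n = 1]. *)
Lemma cell_op_Lp (N : nat) (b : nat -> R) r cs (s p al E : R) :
  r = 1 :: cs ->
  form_roots N (formY N.+1 (formX N.+2 b)) cs ->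
  0 < s < 1 -> 1 < p -> 0 < al -> 0 < E ->
  exists2 K : R, 0 < K & forall (trig : R -> R) u (u1 : R * R -> R) lam delta f m i j,
  trig = cos \/ trig = sin ->
  singular_kernel al E u u1 -> 0 < delta -> lam * delta ^+ N.+2 = 1 ->
  measurable_fun setT f -> (\int[mu]_y (`|f y| `^ p)%:E < +oo)%E -> good r i j ->
  (\int[mu]_x (`|cell_op trig lam N.+2 b u delta m i j f x| `^ p)%:E <=
   (K * delta `^ ((1 - al) * p) *
     (2 `^ ((1 - al) * p - N.+2%:R * s * interp_exponent p)) ^+ m)%:E *
   \int[mu]_y ((Num.floor (y / (2 ^+ m * delta)) == j)%:R * `|f y| `^ p)%:E)%E.
Proof.
move=> rE croots s01 p1 al0 E0.
have [K K0 HK] := osc_square_Lp croots s01 p1 al0 E0; exists K => //.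
move=> trig u u1 lam delta f m i j trigE ku d0 lamd mf fp g.
have p0 : p != 0 by rewrite gt_eqF// (lt_trans _ p1).
have lam0 : 0 < lam.
  by rewrite -(pmulr_lgt0 lam (exprn_gt0 N.+2 d0)) lamd.
have := HK trig u u1 lam (2 ^+ m * delta) (i%:~R * (2 ^+ m * delta))
  (j%:~R * (2 ^+ m * delta)) (cell_cut delta m j f) trigE ku (mesh_gt0 m d0) lam0.
move=> H; have {}H := H (fun x y => good_square rE g (mesh_gt0 m d0))
  (measurable_cell_cut _ _ _ mf) (@cell_cut_out delta m j f)
  (le_lt_trans (le_cell_cut_powR m j d0 p0 mf) fp).
apply: (le_trans H).
under [in leLHS]eq_integral do rewrite cell_cut_powR//.
rewrite le_eqVlt; apply/orP; left; apply/eqP; congr (_%:E * _)%E.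
have -> : lam * (2 ^+ m * delta) ^+ N.+2 = (2 ^+ m) `^ N.+2%:R.
  by rewrite exprMn mulrCA lamd mulr1 powR_mulrn// exprn_ge0.
rewrite -powRrM exprn_powR// powRM ?exprn_ge0 ?(ltW d0)// exprn_powR//.
set e1 := (1 - al) * p; set e2 := N.+2%:R * _.
rewrite powRD; last by rewrite (_ : (2 : R) != 0) ?implybT.
rewrite (_ : e2 = - (N.+2%:R * s * interp_exponent p)); last by rewrite /e2; ring.
by rewrite exprMn; ring.
Qed.

Lemma measurable_cell_op (N : nat) (b : nat -> R) r cs (p al E : R) (trig : R -> R) u
    (u1 : R * R -> R) lam delta f m i j :
  r = 1 :: cs -> 1 <= p -> 0 < al -> 0 <= E ->
  trig = cos \/ trig = sin ->
  singular_kernel al E u u1 -> 0 < delta ->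
  measurable_fun setT f -> (\int[mu]_y (`|f y| `^ p)%:E < +oo)%E -> good r i j ->
  measurable_fun setT (cell_op trig lam N b u delta m i j f) /\
  forall x, mu.-integrable setT (fun y =>
    (cell_kernel trig lam N b u delta m i j (x, y) * cell_cut delta m j f y)%:E).
Proof.
move=> rE p1 al0 E0 trigE ku d0 mf fp g.
have [ctrig trig1] := trig_bounded trigE.
have p0 : p != 0 by rewrite gt_eqF// (lt_le_trans _ p1).
have rho0 := mesh_gt0 m d0.
have Afin (a : R) : (mu (side a (2 ^+ m * delta)) < +oo)%E by rewrite side_measure ?ltry.
have bk := box_osc_kernel lam N b ctrig trig1 ku al0 E0 rho0
  (fun x y xI yJ => (good_square rE g rho0 xI yJ).1).
have ci : mu.-integrable setT (EFin \o cell_cut delta m j f).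
  apply: (Lp_integrable (mu := mu) (measurable_side _ _) (Afin _) _ _ p1).
  - exact: measurable_cell_cut.
  - exact: cell_cut_out.
  - exact: le_lt_trans (le_cell_cut_powR m j d0 p0 mf) fp.
split; last by move=> x; have [mk kM _ _] := bk; exact: (kernel_op_integrand (mu := mu) mk kM x ci).
exact: integrable_measurable (integrable_kernel_op (mu := mu) bk (measurable_side _ _) (Afin _) ci).
Qed.

(** The sum over the dyadic levels is absorbed by weights decreasing geometrically;
    within a level, the squares meet each row and each column a bounded number of
    times. *)
Lemma far_part_Lp (N : nat) (b : nat -> R) r cs (s p al E : R) :
  r = 1 :: cs -> (forall z, z \in r -> z != 0) ->
  form_roots N (formY N.+1 (formX N.+2 b)) cs ->
  0 < s < 1 -> 1 < p -> 0 < al -> 0 < E ->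
  (1 - al) * p < N.+2%:R * s * interp_exponent p ->
  exists2 C : R, 0 < C & forall (trig : R -> R) u (u1 : R * R -> R) lam delta f (B M : nat),
  trig = cos \/ trig = sin ->
  singular_kernel al E u u1 -> 0 < delta -> lam * delta ^+ N.+2 = 1 ->
  measurable_fun setT f -> (\int[mu]_y (`|f y| `^ p)%:E < +oo)%E ->
  let F x := \sum_(t : cells B M)
    (selected r (idx B t.1.2) (idx B t.2))%:R *
    `|cell_op trig lam N.+2 b u delta t.1.1 (idx B t.1.2) (idx B t.2) f x| in
  measurable_fun setT F /\
  (\int[mu]_x (F x `^ p)%:E <=
   (C * delta `^ ((1 - al) * p))%:E * \int[mu]_y (`|f y| `^ p)%:E)%E.
Proof.
move=> rE rn0 croots s01 p1 al0 E0 sc.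
have p0 : 0 < p by exact: lt_trans p1.
have [K K0 HK] := cell_op_Lp rE croots s01 p1 al0 E0.
set e := (1 - al) * p - N.+2%:R * s * interp_exponent p in HK.
have e0 : e < 0 by rewrite /e subr_lt0.
(* [2 ^ e] is the ratio of consecutive levels: half of the decay pays for the weights
   of the sum of the operators, the other half remains for the sum over the levels *)
pose tau : R := 2 `^ (e / (2 * p)); pose theta : R := 2 `^ (e / 2).
have tau01 : 0 <= tau < 1.
  by rewrite powR_ge0 pow2_lt1// pmulr_llt0// invr_gt0 mulr_gt0.
have theta01 : 0 <= theta < 1 by rewrite powR_ge0 pow2_lt1// pmulr_llt0.
have tau0 : 0 < tau by rewrite powR_gt0.
have tauV m : (tau ^- m) `^ p * (2 `^ e) ^+ m = theta ^+ m.
  rewrite -exprVn exprn_powR ?invr_ge0 ?(ltW tau0)//.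
  rewrite -exprMn; congr (_ ^+ m).
  rewrite -powR_inv1 ?(ltW tau0)// -!powRrM -powRD; last first.
    by rewrite (_ : (2 : R) != 0) ?implybT.
  by congr powR; field; rewrite gt_eqF.
pose N0 : R := (grid_count r)%:R.
pose W := N0 / (1 - tau); pose W' := N0 / (1 - theta).
have W0 : 0 <= W by rewrite divr_ge0// subr_ge0 ltW//; case/andP: tau01.
have W'0 : 0 <= W' by rewrite divr_ge0// subr_ge0 ltW//; case/andP: theta01.
exists (W `^ p * K * W' + 1); first by rewrite ltr_wpDl// mulr_ge0// mulr_ge0 ?powR_ge0// ltW.
move=> trig u u1 lam delta f B M trigE ku d0 lamd mf fp F.
pose T (t : cells B M) :=
  cell_op trig lam N.+2 b u delta t.1.1 (idx B t.1.2) (idx B t.2) f.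
pose sel (t : cells B M) := selected r (idx B t.1.2) (idx B t.2).
pose fl (m : nat) y := Num.floor (y / (2 ^+ m * delta)).
pose J (t : cells B M) y : R := (fl t.1.1 y == idx B t.2)%:R * `|f y| `^ p.
have mT t : sel t -> measurable_fun setT (T t).
  move=> /andP[g _].
  by have [] := @measurable_cell_op N.+2 b r cs p al E trig u u1 lam delta f
    t.1.1 _ _ rE (ltW p1) al0 (ltW E0) trigE ku d0 mf fp g.
have mselT t : measurable_fun setT (fun x => (sel t)%:R * `|T t x|).
  case: (boolP (sel t)) => [st|_]; last first.
    by rewrite (_ : (fun x => _) = cst 0)//; apply/funext => x; rewrite mul0r.
  by apply: measurable_funM => //; apply: measurableT_comp => //; exact: mT.
have mF : measurable_fun setT F by apply: measurable_sum => t; exact: mselT.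
split => //.
have mJ t : measurable_fun setT (fun y => (J t y)%:E).
  under eq_fun do rewrite /J /fl -cell_cut_powR ?(gt_eqF p0)//.
  by apply: measurable_powR_norm; exact: measurable_cell_cut.
have mthJ (t : cells B M) : measurable_fun setT (fun y =>
    (theta ^+ t.1.1 * (sel t)%:R * J t y)%:E).
  by apply/measurable_EFinP; apply: measurable_funM => //; apply/measurable_EFinP; exact: mJ.
have J0 t y : 0 <= J t y by rewrite mulr_ge0// powR_ge0.
pose q t x := (sel t)%:R * (tau ^- t.1.1 * `|T t x|).
have q0 t x : 0 <= q t x by rewrite !mulr_ge0// invr_ge0 exprn_ge0// ltW.
have mq t : measurable_fun setT (fun x => (q t x `^ p)%:E).
  have e' : (fun x => (q t x `^ p)%:E) =
      (fun x => (`|tau ^- t.1.1 * ((sel t)%:R * `|T t x|)| `^ p)%:E).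
    apply/funext => x; rewrite ger0_norm; first by rewrite /q mulrCA.
    by rewrite !mulr_ge0// invr_ge0 exprn_ge0// ltW.
  by rewrite e'; apply: measurable_powR_norm; exact: measurable_funM.
have Fq x : F x `^ p <= W `^ p * \sum_t q t x `^ p.
  apply: (@powR_sum_weighted R _ (fun t => (sel t)%:R * `|T t x|) (fun t => tau ^+ t.1.1 *
    ((sel t)%:R * (fl t.1.1 x == idx B t.1.2)%:R)) (q^~ x) W p) => //.
  - exact: ltW.
  - by move=> t; rewrite !mulr_ge0// exprn_ge0// ltW.
  - move=> t; rewrite /q /sel; case: (boolP (selected _ _ _)) => [st|_]; last first.
      by rewrite !mul0r mulr0.
    rewrite !mul1r; case: eqP => [_|/eqP ne].
      by rewrite mulr1 mulrA mulfV ?mul1r// expf_neq0// gt_eqF.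
    rewrite mulr0 mul0r.
    rewrite (_ : T t x = 0) ?normr0//.
    rewrite /T /cell_op /kernel_op /Rintegral integral0_eq// => y _.
    rewrite /cell_kernel /osc_kernel [\1_(side _ _) (x, y).1]indic_side_floor ?mesh_gt0//.
    by rewrite -/(fl t.1.1 x) (negbTE ne) !mul0r.
  - exact: (@weight_sum_row R r B M tau (fl^~ x)).
have qT t : (\int[mu]_x (q t x `^ p)%:E <= ((sel t)%:R * (K * delta `^ ((1 - al) * p) *
     theta ^+ t.1.1))%:E * \int[mu]_y (J t y)%:E)%E.
  rewrite /q; case: (boolP (sel t)) => [st|_]; last first.
    under eq_integral do rewrite mul0r powR0 ?gt_eqF//.
    by rewrite integral0 mul0r mul0e.
  rewrite mul1r; under eq_integral do
    rewrite mul1r powRM ?invr_ge0 ?exprn_ge0 ?(ltW tau0)// EFinM.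
  rewrite ge0_integralZl ?lee_fin ?powR_ge0//; last first.
    by apply: measurable_powR_norm; exact: mT.
  have /andP[g _] := st.
  have := HK trig u u1 lam delta f t.1.1 _ _ trigE ku d0 lamd mf fp g.
  move=> /(lee_wpmul2l (_ : (0 <= ((tau ^- t.1.1) `^ p)%:E)%E)) H.
  apply: (le_trans (H _)); first by rewrite lee_fin powR_ge0.
  rewrite muleA -EFinM -tauV.
  by rewrite le_eqVlt; apply/orP; left; apply/eqP; congr (_%:E * _)%E; ring.
apply: (@le_trans _ _ (\int[mu]_x ((W `^ p)%:E * \sum_t (q t x `^ p)%:E))%E).
  apply: ge0_le_integral => //.
  - by move=> x _; rewrite lee_fin powR_ge0.
  - apply/measurable_EFinP; exact: (measurableT_comp (measurable_powR p) mF).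
  - by apply: emeasurable_funM => //; apply: emeasurable_sum => t; exact: mq.
  - by move=> x _; rewrite sumEFin -EFinM lee_fin.
rewrite ge0_integralZl ?lee_fin ?powR_ge0//; last 2 first.
- by apply: emeasurable_sum => t; exact: mq.
- by move=> x _; apply: sume_ge0 => t _; rewrite lee_fin powR_ge0.
rewrite ge0_integral_sum//; last by move=> t x _; rewrite lee_fin powR_ge0.
apply: (@le_trans _ _ ((W `^ p)%:E * ((K * delta `^ ((1 - al) * p))%:E *
    \int[mu]_y (\sum_(t : cells B M)
      (theta ^+ t.1.1 * (sel t)%:R * J t y)%:E)))%E).
  rewrite lee_wpmul2l ?lee_fin ?powR_ge0// ge0_integral_sum//; last first.
    by move=> t y _; rewrite lee_fin !mulr_ge0 ?exprn_ge0 ?powR_ge0.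
  rewrite ge0_sume_distrr; last first.
    move=> t _; apply: integral_ge0 => y _.
    by rewrite lee_fin !mulr_ge0 ?exprn_ge0 ?powR_ge0.
  apply: lee_sum => t _; apply: (le_trans (qT t)).
  under [in leRHS]eq_integral do rewrite EFinM.
  rewrite [in leRHS]ge0_integralZl; last 4 first.
  - exact: measurableT.
  - exact: mJ.
  - by move=> y _; rewrite lee_fin.
  - by rewrite lee_fin mulr_ge0 ?exprn_ge0 ?powR_ge0.
  by rewrite muleA -EFinM le_eqVlt; apply/orP; left; apply/eqP; congr (_%:E * _)%E; ring.
rewrite muleA -EFinM.
apply: (@le_trans _ _ ((W `^ p * (K * delta `^ ((1 - al) * p)))%:E *
    (W'%:E * \int[mu]_y (`|f y| `^ p)%:E))%E).
  rewrite lee_wpmul2l ?lee_fin ?mulr_ge0 ?powR_ge0 ?(ltW K0)//.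
  rewrite -ge0_integralZl ?lee_fin//; last exact: measurable_powR_norm.
  apply: ge0_le_integral => //.
  - move=> y _; apply: sume_ge0 => t _.
    by rewrite lee_fin !mulr_ge0 ?exprn_ge0 ?powR_ge0.
  - apply: emeasurable_sum => t; exact: mthJ.
  - by apply: emeasurable_funM => //; exact: measurable_powR_norm.
  move=> y _; rewrite sumEFin -EFinM lee_fin.
  under eq_bigr do rewrite /J mulrA.
  rewrite -mulr_suml ler_wpM2r ?powR_ge0//.
  under eq_bigr do rewrite -mulrA.
  exact: (@weight_sum_col R r B M theta (fl^~ y)).
rewrite muleA -EFinM lee_wpmul2r ?integral_ge0// lee_fin.
have := powR_ge0 delta ((1 - al) * p); set d := delta `^ _ => dge0.
have -> : W `^ p * (K * d) * W' = W `^ p * K * W' * d by ring.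
by rewrite mulrDl mul1r lerDl.
Qed.

End Pieces.

(** * The real operator *)

Section RealOperator.
Context {R : realType}.
Local Notation mu := (@lebesgue_measure R).
Local Notation "x %:C" := (real_complex R x).
Implicit Types (r cs : seq R[i]) (f : R -> R) (al E w p delta lam : R).

Lemma Rintegral_sum (I : Type) (s : seq I) (h : I -> R -> R) :
  (forall i, mu.-integrable setT (EFin \o h i)) ->
  mu.-integrable setT (EFin \o (fun y => \sum_(i <- s) h i y)) /\
  \int[mu]_y (\sum_(i <- s) h i y) = \sum_(i <- s) \int[mu]_y h i y.
Proof.
move=> hi; elim: s => [|i s [ih1 ih2]].
  have e0 : (fun y : R => \sum_(i <- [::]) h i y) = cst 0.
    by apply/funext => y; rewrite big_nil.
  split; first by rewrite e0; exact: (integrable0 mu).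
  rewrite big_nil /Rintegral integral0_eq// => y _; by rewrite big_nil.
have eS : (fun y : R => \sum_(j <- i :: s) h j y) = (fun y => h i y + \sum_(j <- s) h j y).
  by apply/funext => y; rewrite big_cons.
rewrite big_cons -ih2 eS; split; last by rewrite RintegralD.
have := integrableD measurableT (hi i) ih1; exact: eq_integrable.
Qed.

Lemma poweRD_le (a b : \bar R) p : (0 <= a)%E -> (0 <= b)%E -> 0 <= p ->
  ((a + b) `^ p <= (2 `^ p)%:E * (a `^ p + b `^ p))%E.
Proof.
move=> + + p0; wlog ab : a b / (a <= b)%E.
  move=> H a0 b0; have [ab|ba] := leP a b; first exact: H.
  by rewrite addeC [X in (_ * X)%E]addeC; apply: H => //; exact: ltW.
move=> a0 b0; apply: (@le_trans _ _ ((2%:E * b) `^ p)%E).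
  apply: gt0_ler_poweR => //; rewrite ?in_itv/= ?leey ?andbT.
  - by rewrite adde_ge0.
  - by rewrite mule_ge0 ?lee_fin.
  - by rewrite (_ : 2%:E = 1 + 1)%E// ge0_muleDl// !mul1e leeD2r.
rewrite poweRM ?lee_fin// poweR_EFin lee_wpmul2l ?lee_fin ?powR_ge0//.
by rewrite leeDr// poweR_ge0.
Qed.

Lemma grid_width_gt0 r : 0 < grid_width r.
Proof.
rewrite /grid_width mulr_gt0//.
  by rewrite mulr_gt0// (lt_le_trans _ (grid_gap_ge2 r)).
by rewrite ltr_pwDl//; apply: sumr_ge0 => z _; exact: normc_ge0.
Qed.

Lemma not_good_near_kernel r al E delta (x y : R) : 0 <= E -> 0 < delta ->
  (forall z, z \in r -> z != 0) ->
  ~~ good r (Num.floor (x / delta)) (Num.floor (y / delta)) ->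
  E * `|x - y| `^ (- al) <= near_kernel r al E (grid_width r * delta) (x, y).
Proof.
move=> E0 d0 rn0 /(not_good_near d0)[z zr zxy].
have g0 : 0 < grid_gap r by exact: lt_le_trans (grid_gap_ge2 r).
have [w1 w2] := grid_width_ge zr.
have [h1 h2] := normc_band (rn0 _ zr) zxy.
rewrite /near_kernel (big_rem z)//=; apply: ler_wpDr.
  by apply: sumr_ge0 => z' _; exact: near_line_ge0.
rewrite /near_line/= !indicE !mem_set ?mulr1//= in_itv/= -ler_norml.
  apply: (le_trans (ltW h2)); rewrite mulrAC ler_wpM2r ?(ltW d0)//.
  apply: le_trans w2; rewrite ler_wpM2r ?normc_ge0// ler_wpM2r ?(ltW g0)//.
  by rewrite ler_nat.
apply: (le_trans (ltW h1)); rewrite ler_wpM2r ?(ltW d0)//.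
by apply: le_trans w1; rewrite ler_wpM2r ?(ltW g0)// ler_nat.
Qed.

(** Where the near part converges absolutely, the oscillatory integral splits
    according to the partition of unity [grid_partition]. *)
Lemma osc_decomposition (N : nat) (b : nat -> R) r cs p al E (trig : R -> R) u
    (u1 : R * R -> R) lam delta (D : R) (B M : nat) f x :
  r = 1 :: cs -> (forall z, z \in r -> z != 0) -> 1 <= p -> 0 < al -> 0 <= E ->
  trig = cos \/ trig = sin -> singular_kernel al E u u1 ->
  (forall x, u (x, x) = 0) ->
  (forall x y, u (x, y) != 0 -> `|x| < D /\ `|y| < D) ->
  0 < delta -> D <= B%:R * delta -> D <= 2 ^+ M * delta ->
  measurable_fun setT f -> (\int[mu]_y (`|f y| `^ p)%:E < +oo)%E ->
  let near := (\int[mu]_y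
    (near_kernel r al E (grid_width r * delta) (x, y) * `|f y|)%:E)%E in
  (near < +oo)%E ->
  let g y := trig (lam * form N b x y) * u (x, y) * f y in
  mu.-integrable setT (EFin \o g) /\
  (`|\int[mu]_y g y|%:E <= near + (\sum_(t : cells B M)
    (selected r (idx B t.1.2) (idx B t.2))%:R *
    `|cell_op trig lam N b u delta t.1.1 (idx B t.1.2) (idx B t.2) f x|)%:E)%E.
Proof.
move=> rE rn0 p1 al0 E0 trigE ku udiag usupp d0 DB DM mf fp near nearoo g.
have [mu_ uE _ _ _] := ku.
have [ctrig trig1] := trig_bounded trigE.
pose fl (m : nat) t := Num.floor (t / (2 ^+ m * delta)).
pose sel (t : cells B M) := selected r (idx B t.1.2) (idx B t.2).
pose h (t : cells B M) y :=
  cell_kernel trig lam N b u delta t.1.1 (idx B t.1.2) (idx B t.2) (x, y) *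
  cell_cut delta t.1.1 (idx B t.2) f y.
pose ng y := (~~ good r (fl 0%N x) (fl 0%N y))%:R * g y.
have hE t y : h t y = (fl t.1.1 x == idx B t.1.2)%:R * (fl t.1.1 y == idx B t.2)%:R * g y.
  rewrite /h /cell_kernel /osc_kernel /cell_cut !indic_side_floor ?mesh_gt0//= /g.
  rewrite -/(fl t.1.1 x) -/(fl t.1.1 y).
  by case: (fl t.1.1 y == _); rewrite ?mul1r ?mul0r ?mulr0 ?mul0r// mulrA.
have gE y : g y = ng y + \sum_t (sel t)%:R * h t y.
  (* the partition of unity is only available on the support of the kernel *)
  have [u0|un0] := eqVneq (u (x, y)) 0.
    have g0 : g y = 0 by rewrite /g u0 mulr0 mul0r.
    by rewrite /ng g0 mulr0 add0r big1// => t _; rewrite hE g0 !mulr0.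
  have [xD yD] := usupp _ _ un0.
  have r1 : 1 \in r by rewrite rE mem_head.
  have := grid_partition r1 d0 xD yD DB DM; rewrite /= => part.
  transitivity (1 * g y); first by rewrite mul1r.
  rewrite -[X in X * _ = _]part mulrDl; congr (_ + _).
  by rewrite mulr_suml; apply: eq_bigr => t _; rewrite hE !mulrA.
have ngE y : `|ng y| <= near_kernel r al E (grid_width r * delta) (x, y) * `|f y|.
  have n0 : 0 <= near_kernel r al E (grid_width r * delta) (x, y).
    exact: near_kernel_ge0.
  rewrite /ng /fl expr0 mul1r; case: (boolP (good _ _ _)) => [_|ngood].
    by rewrite mul0r normr0 mulr_ge0.
  rewrite mul1r /g !normrM ler_wpM2r//.
  have [exy|xy] := eqVneq x y.
    by rewrite -exy in n0 *; rewrite udiag normr0 mulr0.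
  apply: le_trans (not_good_near_kernel al E0 d0 rn0 ngood).
  by rewrite -[leRHS]mul1r ler_pM// uE.
have hi t : mu.-integrable setT (EFin \o (fun y => (sel t)%:R * h t y)).
  case: (boolP (sel t)) => [st|_]; last first.
    rewrite (_ : (fun y => _) = cst 0); first exact: (integrable0 mu).
    by apply/funext => y; rewrite mul0r.
  rewrite (_ : (fun y => _) = h t); last by apply/funext => y; rewrite mul1r.
  have /andP[gd _] := st.
  have [_ H] := @measurable_cell_op R N b r cs p al E trig u u1 lam delta f
    t.1.1 _ _ rE p1 al0 E0 trigE ku d0 mf fp gd.
  exact: H.
have [Si SE] := Rintegral_sum (index_enum _) hi.
have mg : measurable_fun setT g.
  apply: measurable_funM => //; apply: measurable_funM.
    apply: (measurableT_comp (continuous_measurable_fun ctrig)).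
    apply: measurable_funM => //.
    exact: (measurableT_comp (measurable_form N b) (pair1_measurable x)).
  exact: (measurableT_comp mu_ (pair1_measurable x)).
have ngB : ng = (fun y => g y - \sum_t (sel t)%:R * h t y).
  by apply/funext => y; rewrite gE addrK.
have mng : measurable_fun setT ng.
  by rewrite ngB; apply: measurable_funB => //; exact: integrable_measurable Si.
have mnk : measurable_fun setT
    (fun y => (near_kernel r al E (grid_width r * delta) (x, y) * `|f y|)%:E).
  apply/measurable_EFinP; apply: measurable_funM; last exact: measurableT_comp.
  exact: (measurableT_comp (measurable_near_kernel _ _ _ _) (pair1_measurable x)).
have ngint : (\int[mu]_y `|(ng y)%:E| <= near)%E.
  apply: ge0_le_integral => //.
  - by apply: measurableT_comp => //; exact/measurable_EFinP.
  - by move=> y _; rewrite abse_EFin lee_fin.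
have ngi : mu.-integrable setT (EFin \o ng).
  apply/integrableP; split; first exact/measurable_EFinP.
  exact: le_lt_trans nearoo.
have gi : mu.-integrable setT (EFin \o g).
  have := integrableD measurableT ngi Si; apply: eq_integrable => // y _.
  by rewrite /= -EFinD gE.
split => //.
have -> : \int[mu]_y g y = \int[mu]_y ng y + \sum_t (sel t)%:R *
    cell_op trig lam N b u delta t.1.1 (idx B t.1.2) (idx B t.2) f x.
  under eq_Rintegral do rewrite gE.
  rewrite RintegralD// SE; congr (_ + _); apply: eq_bigr => t _.
  case: (boolP (sel t)) => [st|_]; last first.
    by rewrite mul0r /Rintegral integral0_eq// => y _; rewrite mul0r.
  by rewrite mul1r; apply: eq_Rintegral => y _; rewrite mul1r.
apply: (@le_trans _ _ (`|\int[mu]_y ng y|%:E + (\sum_t (sel t)%:R *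
    `|cell_op trig lam N b u delta t.1.1 (idx B t.1.2) (idx B t.2) f x|)%:E)%E).
  rewrite -EFinD lee_fin; apply: (le_trans (ler_normD _ _)); rewrite lerD2l.
  apply: (le_trans (ler_norm_sum _ _ _)); apply: ler_sum => t _.
  by rewrite normrM ger0_norm.
apply: leeD => //; apply: le_trans ngint.
rewrite -abse_EFin /Rintegral fineK.
  by apply: le_abse_integral => //; exact/measurable_EFinP.
exact: integrable_fin_num.
Qed.

(** A pointwise majorization with [L^p] control. Values of [V] in the extended reals
    spare a separate discussion of the points where the integral does not
    converge. *)
Lemma real_osc_Lp (N : nat) (b : nat -> R) al E p :
  let c := formY N.+1 (formX N.+2 b) in
  c 0%N != 0 -> c N != 0 -> 0 < al < 1 -> 0 < E ->
  (N.+2%:R - 2 * al) / (N.+2%:R - 1 - al) <= p <= (N.+2%:R - 2 * al) / (1 - al) ->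
  exists2 C : R, 0 < C & forall (trig : R -> R) u (u1 : R * R -> R) lam (D : R) f,
  trig = cos \/ trig = sin -> singular_kernel al E u u1 ->
  (forall x, u (x, x) = 0) ->
  (forall x y, u (x, y) != 0 -> `|x| < D /\ `|y| < D) ->
  0 < lam -> measurable_fun setT f -> (\int[mu]_y (`|f y| `^ p)%:E < +oo)%E ->
  exists V : R -> \bar R, [/\ measurable_fun setT V, forall x, (0 <= V x)%E,
    (\int[mu]_x (V x `^ p) <=
     (C * lam `^ (- ((1 - al) * p / N.+2%:R)))%:E * \int[mu]_y (`|f y| `^ p)%:E)%E &
    forall x, (V x < +oo)%E ->
      mu.-integrable setT (fun y => (trig (lam * form N.+2 b x y) * u (x, y) * f y)%:E) /\
      (`|\int[mu]_y (trig (lam * form N.+2 b x y) * u (x, y) * f y)|%:E <= V x)%E].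
Proof.
move=> c c0 cN al01 E0 pr.
have n2 : 2 <= N.+2%:R :> R by rewrite ler_nat.
have [p1 sc] := scaling_exponent n2 al01 pr.
have p0 : 0 < p by exact: lt_trans p1.
have [cs croots csn0] := form_factor c0 cN.
pose r : seq R[i] := 1 :: cs.
have rn0 z : z \in r -> z != 0.
  by rewrite inE => /orP[/eqP ->|/csn0//]; exact: oner_neq0.
have /andP[al0 al1] := al01.
have sg0 : 0 < interp_exponent p by rewrite /interp_exponent; case: ifP => // _; lra.
set q := (1 - al) * p in sc *.
have q0 : 0 < q by rewrite mulr_gt0// subr_gt0.
set ns := N.+2%:R * interp_exponent p in sc.
have ns0 : 0 < ns by rewrite mulr_gt0// (lt_le_trans _ n2).
have qns : 0 < q / ns < 1 by rewrite divr_gt0// ltr_pdivrMr// mul1r.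
(* any [s < 1] with [q < ns * s] would do *)
pose s := (1 + q / ns) / 2.
have s01 : 0 < s < 1 by rewrite /s; lra.
have qs : q < N.+2%:R * s * interp_exponent p.
  rewrite mulrAC -/ns mulrC -ltr_pdivrMr//; rewrite /s; lra.
have [C1 C10 HC1] := far_part_Lp (erefl r) rn0 croots s01 p1 al0 E0 qs.
have [K K0 HK] := near_kernel_Lp r al01 E0 p1.
pose gw := grid_width r.
have gw0 : 0 < gw := grid_width_gt0 r.
exists (2 `^ p * (K * gw `^ q + C1)).
  by rewrite mulr_gt0 ?powR_gt0// addr_gt0// mulr_gt0// powR_gt0.
move=> trig u u1 lam D f trigE ku udiag usupp lam0 mf fp.
(* the scale at which the phase is of order one *)
pose delta := lam `^ (- (N.+2%:R)^-1).
have d0 : 0 < delta by rewrite powR_gt0.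
have lamd : lam * delta ^+ N.+2 = 1.
  rewrite -powR_mulrn ?(ltW d0)// -powRrM mulNr mulVf ?gt_eqF ?(lt_le_trans _ n2)//.
  by rewrite powR_inv1 ?(ltW lam0)// mulfV// gt_eqF.
(* number of cells, and of levels, that suffice to cover the support *)
pose B := Num.bound (`|D| / delta).
have DB : D <= B%:R * delta.
  rewrite -ler_pdivrMr//; apply: (@le_trans _ _ (`|D| / delta)).
    by rewrite ler_wpM2r ?invr_ge0 ?(ltW d0)// ler_norm.
  by apply/ltW/archi_boundP; rewrite divr_ge0// ltW.
have DM : D <= 2 ^+ B * delta.
  apply: (le_trans DB); rewrite ler_wpM2r ?(ltW d0)// -natrX ler_nat ltnW//.
  exact: ltn_expl.
have [mF FLp] := HC1 trig u u1 lam delta f B B trigE ku d0 lamd mf fp.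
set F := (fun x => \sum_t _) in mF FLp.
pose nk x y := (near_kernel r al E (gw * delta) (x, y) * `|f y|)%:E.
pose nf x := (\int[mu]_y nk x y)%E.
have mnk : measurable_fun setT (fun z : R * R => nk z.1 z.2).
  apply/measurable_EFinP; apply: measurable_funM; last first.
    by apply: measurableT_comp => //; exact: (measurableT_comp mf measurable_snd).
  under eq_fun do rewrite -surjective_pairing; exact: measurable_near_kernel.
have nk0 (z : R * R) : (0 <= nk z.1 z.2)%E.
  by rewrite lee_fin mulr_ge0// near_kernel_ge0// ltW.
have mnf : measurable_fun setT nf.
  exact: (measurable_fun_fubini_tonelli_F (m2 := mu) _ mnk nk0).
have nf0 x : (0 <= nf x)%E by apply: integral_ge0 => y _; exact: (nk0 (x, y)).
have F0 x : 0 <= F x by apply: sumr_ge0 => t _; rewrite mulr_ge0.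
exists (fun x => nf x + (F x)%:E)%E; split.
- by apply: emeasurable_funD => //; exact/measurable_EFinP.
- by move=> x; rewrite adde_ge0// lee_fin.
- have mp1 : measurable_fun setT (fun x => nf x `^ p)%E.
    exact: (measurableT_comp (measurable_poweR p) mnf).
  have mp2 : measurable_fun setT (fun x => (F x `^ p)%:E).
    apply/measurable_EFinP; exact: (measurableT_comp (measurable_powR p) mF).
  apply: (@le_trans _ _ (\int[mu]_x ((2 `^ p)%:E * (nf x `^ p + (F x `^ p)%:E)))%E).
    apply: ge0_le_integral => //.
    + by move=> x _; exact: poweR_ge0.
    + apply: (measurableT_comp (measurable_poweR p)).
      by apply: emeasurable_funD => //; exact/measurable_EFinP.
    + by apply: emeasurable_funM => //; exact: emeasurable_funD.
    + move=> x _; rewrite -poweR_EFin; apply: poweRD_le => //; last exact: ltW.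
      by rewrite lee_fin.
  rewrite ge0_integralZl ?lee_fin ?powR_ge0//; last 2 first.
  + exact: emeasurable_funD.
  + by move=> x _; rewrite adde_ge0 ?poweR_ge0// lee_fin powR_ge0.
  rewrite ge0_integralD//; last 2 first.
  + by move=> x _; exact: poweR_ge0.
  + by move=> x _; rewrite lee_fin powR_ge0.
  have -> : 2 `^ p * (K * gw `^ q + C1) * lam `^ (- (q / N.+2%:R)) =
      2 `^ p * ((K * (gw * delta) `^ q) + C1 * delta `^ q).
    rewrite powRM ?(ltW gw0) ?(ltW d0)// /delta -powRrM.
    rewrite (_ : - (N.+2%:R)^-1 * q = - (q / N.+2%:R)); last by ring.
    by ring.
  rewrite EFinM -muleA lee_wpmul2l ?lee_fin ?powR_ge0// EFinD ge0_muleDl; last 2 first.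
  + by rewrite lee_fin mulr_ge0 ?powR_ge0// ltW.
  + by rewrite lee_fin mulr_ge0 ?powR_ge0// ltW.
  by apply: leeD => //; apply: HK => //; rewrite mulr_gt0.
- move=> x Vx; have nfoo : (nf x < +oo)%E.
    by apply: le_lt_trans Vx; rewrite leeDl// lee_fin.
  have [gi gV] := osc_decomposition N.+2 b lam (erefl r) rn0 (ltW p1) al0 (ltW E0) trigE ku
    udiag usupp d0 DB DM mf fp nfoo.
  by split; [exact: gi|exact: gV].
Qed.

End RealOperator.

(** * Real and imaginary parts of the complex kernel *)

Section ProductKernels.
Context {R : realType}.
Local Notation mu := (@lebesgue_measure R).
Implicit Types (k phi : R * R -> R) (al E P D : R).

Lemma derivable_ex k (x y : R) : derivable k (x, y) ex <->
  derivable (fun s => k (s, y)) x 1.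
Proof.
rewrite /derivable (_ : (fun h => h^-1 *: ((k \o shift (x, y)) (h *: ex) - k (x, y))) =
  (fun h => h^-1 *: (((fun s => k (s, y)) \o shift x) (h *: 1) - k (x, y))))//.
apply/funext => h /=; congr (_ *: (k _ - _)).
transitivity (h * 1 + x, h * 0 + y); first exact: erefl.
by rewrite mulr0 add0r.
Qed.

Lemma derive_ex k (x y : R) : 'D_ex k (x, y) = 'D_1 (fun s => k (s, y)) x.
Proof.
rewrite /derive (_ : (fun h => h^-1 *: ((k \o shift (x, y)) (h *: ex) - k (x, y))) =
  (fun h => h^-1 *: (((fun s => k (s, y)) \o shift x) (h *: 1) - k (x, y))))//.
apply/funext => h /=; congr (_ *: (k _ - _)).
transitivity (h * 1 + x, h * 0 + y); first exact: erefl.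
by rewrite mulr0 add0r.
Qed.

Lemma is_derive_ex k (x y : R) : derivable k (x, y) ex ->
  is_derive x (1 : R) (fun s => k (s, y)) ('D_ex k (x, y)).
Proof.
by move=> /derivable_ex h; rewrite derive_ex; exact: DeriveDef.
Qed.

Lemma continuous_pair_left (y : R) : continuous (fun s : R => (s, y)).
Proof. by move=> x; exact: (cvg_pair (f := id) (g := cst y) cvg_id (cvg_cst y)). Qed.

Lemma continuous_slice k (x y : R) : {for (x, y), continuous k} ->
  {for x, continuous (fun s => k (s, y))}.
Proof. by move=> ck; apply: continuous_comp => //; exact: continuous_pair_left. Qed.

Lemma open_off_diagonal : open (@off_diagonal R).
Proof.
have -> : @off_diagonal R = (fun z : R * R => z.1 - z.2) @^-1` [set t : R | t != 0].
  by apply/seteqP; split => z /=; rewrite /off_diagonal/= subr_eq0.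
apply: open_comp; last exact: open_neq.
by move=> z _; apply: cvgB; [exact: cvg_fst|exact: cvg_snd].
Qed.

(** The value on the diagonal is fixed so that measurability can be tested on the open
    set where [k] is continuous. *)
Definition off_diagonal_product k phi (z : R * R) : R :=
  if z.1 == z.2 then 0 else k z * phi z.

(** The derivative of the cut-off carries no singularity of its own, but only on its
    support, where [|x - y| <= 2 * D], is the missing power of [|x - y|] bounded. *)
Lemma singular_kernel_product k phi al E P D : 0 <= E -> 0 <= D -> 0 <= P ->
  Ck_on 1 off_diagonal k ->
  (forall x y, x != y -> `|k (x, y)| <= E * `|x - y| `^ (- al)) ->
  (forall x y, x != y -> `|'D_ex k (x, y)| <= E * `|x - y| `^ (- al - 1)) ->
  Ck_on 1 setT phi ->
  (forall z, `|phi z| <= P) -> (forall z, `|'D_ex phi z| <= P) ->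
  (forall x y, 'D_ex phi (x, y) != 0 -> `|x| <= D /\ `|y| <= D) ->
  singular_kernel al (E * P * (1 + 2 * D)) (off_diagonal_product k phi)
    (fun z => 'D_ex k z * phi z + k z * 'D_ex phi z).
Proof.
move=> E0 D0 P0 [ck [dk [cdk _] _]] kE k1E [cphi [dphi [cdphi _] _]] phiP phi1P supp.
have D1 : 1 <= 1 + 2 * D by rewrite lerDl mulr_ge0.
have EP0 : 0 <= E * P by rewrite mulr_ge0.
split.
- have oU := open_off_diagonal; have mU := open_measurable_prod oU.
  have -> : off_diagonal_product k phi = (fun z => k z * phi z) \_ (@off_diagonal R).
    apply/funext => z; rewrite patchE /off_diagonal_product.
    have -> : (z \in @off_diagonal R) = (z.1 != z.2).
      by apply/idP/idP; rewrite inE.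
    by case: eqP.
  apply/(measurable_restrictT _ mU); apply: open_continuous_measurable_prod => // z zU.
  by apply: continuousM; [exact: ck|exact: cphi].
- move=> x y xy; rewrite /off_diagonal_product/= (negbTE xy) normrM.
  apply: (@le_trans _ _ (E * `|x - y| `^ (- al) * P)); first by rewrite ler_pM// kE.
  rewrite mulrAC ler_wpM2r ?powR_ge0//.
  by rewrite -[leLHS]mulr1 ler_wpM2l.
- move=> x y xy.
  have [dkx _] := dk (x, y) xy; have [dphix _] := dphi (x, y) I.
  have H := is_deriveM (is_derive_ex dkx) (is_derive_ex dphix).
  have -> : 'D_ex k (x, y) * phi (x, y) + k (x, y) * 'D_ex phi (x, y) =
    k (x, y) *: 'D_ex phi (x, y) + phi (x, y) *: 'D_ex k (x, y).
    by rewrite /GRing.scale/=; ring.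
  apply: near_eq_is_derive H.
  have : \forall s \near x, s != y by apply: open_nbhs_nbhs; split => //; exact: open_neq.
  by apply: filterS => s sy; rewrite /off_diagonal_product/= (negbTE sy).
- move=> x y xy.
  have d0 : 0 < `|x - y| by rewrite normr_gt0 subr_eq0.
  apply: (le_trans (ler_normD _ _)); rewrite !normrM.
  set d := `|x - y| in d0 *.
  have -> : E * P * (1 + 2 * D) * d `^ (- al - 1) =
     E * d `^ (- al - 1) * P + E * (2 * D * d `^ (- al - 1)) * P by ring.
  apply: lerD; first by rewrite ler_pM// k1E.
  have [->|n0] := eqVneq ('D_ex phi (x, y)) 0.
    by rewrite normr0 mulr0 !mulr_ge0 ?powR_ge0.
  rewrite ler_pM//; apply: (le_trans (kE _ _ xy)); rewrite ler_wpM2l//.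
  have [xD yD] := supp _ _ n0.
  have dD : d <= 2 * D.
    by apply: (le_trans (ler_normB _ _)); rewrite mulr_natl mulr2n lerD.
  have -> : d `^ (- al) = d * d `^ (- al - 1).
    rewrite -[X in X * _]powRr1 ?(ltW d0)// -powRD; last by rewrite (gt_eqF d0) implybT.
    by congr powR; ring.
  by rewrite ler_wpM2r ?powR_ge0.
- move=> x y xy.
  have c1 := continuous_slice (cdk (x, y) xy); have c2 := continuous_slice (cphi (x, y) I).
  have c3 := continuous_slice (ck (x, y) xy); have c4 := continuous_slice (cdphi (x, y) I).
  exact: continuousD (continuousM c1 c2) (continuousM c3 c4).
Qed.

End ProductKernels.

Section Assembly2.
Context {R : realType}.
Local Notation mu := (@lebesgue_measure R).
Implicit Types (al E P D p : R).

Lemma test_function_bounds (phi : R * R -> R) (A : set (R * R)) :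
  compact A -> closed A -> (forall z, ~ A z -> phi z = 0) -> Ck_on 1 setT phi ->
  exists2 P : R, 0 < P & forall z, [/\ `|phi z| <= P, `|'D_ex phi z| <= P &
    'D_ex phi z != 0 -> A z].
Proof.
move=> cA clA phi0 [cphi [_ [cd _] _]].
have d0 z : ~ A z -> 'D_ex phi z = 0.
  move=> nA; rewrite (@near_eq_derive _ _ _ phi (cst 0)) ?derive_cst//.
  have : \forall w \near z, ~ A w by apply: open_nbhs_nbhs; split => //; rewrite openC.
  by apply: filterS => w /phi0.
have bd (g : R * R -> R) : (forall z, {for z, continuous g}) ->
    exists2 P : R, 0 < P & forall z, A z -> `|g z| <= P.
  move=> cg.
  have : compact (g @` A).
    by apply: continuous_compact => //; apply: continuous_subspaceT => z; exact: cg.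
  move=> /compact_bounded[M [_ HM]]; exists (`|M| + 1); first by rewrite ltr_wpDl.
  move=> z Az; apply: HM; last by exists z.
  by rewrite (le_lt_trans (ler_norm M))// ltrDl.
have [P1 P10 H1] := bd phi (fun z => cphi z I).
have [P2 P20 H2] := bd _ (fun z => cd z I).
exists (P1 + P2) => [|z]; first exact: addr_gt0.
have [Az|nA] := pselect (A z).
  by split => //; [rewrite (le_trans (H1 _ Az))// lerDl ltW|
    rewrite (le_trans (H2 _ Az))// lerDr ltW].
have PP : 0 <= P1 + P2 by rewrite addr_ge0// ltW.
by rewrite phi0// d0// normr0 eqxx; split => // /negP /(_ isT).
Qed.

Lemma compact_box (A : set (R * R)) : compact A ->
  exists2 D : R, 0 < D & forall x y, A (x, y) -> `|x| < D /\ `|y| < D.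
Proof.
move=> /compact_bounded[M [_ HM]]; exists (`|M| + 2); first by rewrite ltr_wpDl.
move=> x y Axy; have : `|(x, y)| <= `|M| + 1.
  by apply: HM => //; rewrite (le_lt_trans (ler_norm M))// ltrDl.
rewrite prod_normE ge_max => /andP[h1 h2].
by split; [apply: (le_lt_trans h1)|apply: (le_lt_trans h2)]; rewrite ltrD2l; lra.
Qed.

Lemma phase_form (n : nat) (a : nat -> R) (x y : R) : (2 <= n)%N ->
  phase n a x y = form n (fun k => if (0 < k < n)%N then a k else 0) x y.
Proof.
case: n => [|n] n2; first by move: n2; rewrite ltn0.
set b := (fun k => _); have b0 : b 0%N = 0 by [].
have bn : b n.+1 = 0 by rewrite /b ltnn andbF.
rewrite /phase /form -(big_mkord xpredT (fun k => b k * x ^+ (n.+1 - k) * y ^+ k)).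
rewrite [RHS]big_nat_recr//= bn !mul0r addr0 [RHS]big_nat_recl//= b0 !mul0r add0r big_add1.
rewrite /= big_nat [RHS]big_nat; apply: eq_bigr => k /andP[_ kn].
by rewrite /b (_ : (0 < k.+1 < n.+1)%N)//; exact: kn.
Qed.

(** The integral of a nonnegative function is a supremum over the simple functions below
    it, so that monotonicity extends to the operator, whose measurability in [x] is
    not at hand. *)
Lemma le_integral_mono (f g : R -> \bar R) : (forall x, 0 <= f x)%E ->
  (forall x, f x <= g x)%E -> (\int[mu]_x f x <= \int[mu]_x g x)%E.
Proof.
move=> f0 fg; rewrite !ge0_integralTE//; last by move=> x; exact: le_trans (fg x).
apply: le_ereal_sup => _ [h hf <-]; exists h => // x; exact: le_trans (fg x).
Qed.

Lemma poweR_sum_le (I : Type) (s : seq I) (V : I -> \bar R) p : 0 < p ->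
  (forall i, 0 <= V i)%E ->
  ((\sum_(i <- s) V i) `^ p <= ((2 `^ p) ^+ size s)%:E * \sum_(i <- s) (V i `^ p))%E.
Proof.
move=> p0 V0; elim: s => [|i s ih]; first by rewrite !big_nil poweR0r ?gt_eqF// mule0.
have S0 : (0 <= \sum_(j <- s) V j `^ p)%E by apply: sume_ge0 => j _; exact: poweR_ge0.
rewrite !big_cons; apply: (le_trans (poweRD_le _ _ _)) => //; [exact: sume_ge0|exact: ltW|].
rewrite /= exprS EFinM -muleA lee_wpmul2l ?lee_fin ?powR_ge0//.
have two1 : 1 <= (2 `^ p) ^+ size s :> R.
  by apply: exprn_ege1; have := ler_powR (ler1n R 2) (ltW p0); rewrite powRr0.
rewrite ge0_muleDr ?poweR_ge0//; apply: leeD => //.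
by rewrite -[leLHS]mul1e lee_wpmul2r ?poweR_ge0// lee_fin.
Qed.

(** Real and imaginary parts indexed by booleans, so that the terms of a product of
    four complex numbers can be enumerated. *)
Definition part (b : bool) (z : R[i]) : R := if b then complex.Im z else complex.Re z.

Lemma le_part_normc (b : bool) (z : R[i]) : `|part b z| <= Normc.normc z.
Proof.
case: z => x y; case: b; rewrite /Normc.normc/= -sqrtr_sqr ler_wsqrtr//.
  by rewrite lerDr sqr_ge0.
by rewrite lerDl sqr_ge0.
Qed.

Lemma normc_le_parts (z : R[i]) : Normc.normc z <= `|part false z| + `|part true z|.
Proof.
case: z => x y; rewrite /Normc.normc/= -[leRHS]ger0_norm ?addr_ge0//.
rewrite -sqrtr_sqr ler_wsqrtr// sqrrD !real_normK ?num_real//.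
by rewrite lerD2r lerDl mulrn_wge0// mulr_ge0.
Qed.

Definition quads : seq (bool * bool * bool * bool) :=
  let B := [:: false; true] in
  [seq (x, d) | x <- [seq (x, c) | x <- [seq (a, b) | a <- B, b <- B], c <- B], d <- B].

(** The coefficient of a product of parts in the part [b] of a product: the
    corresponding part of a power of the imaginary unit. *)
Definition part_coef (b : bool) (t : bool * bool * bool * bool) : R :=
  part b (\prod_(c <- [:: t.1.1.1; t.1.1.2; t.1.2; t.2]) if c then 'i%C else 1).

Lemma part_prod4 (b : bool) (z1 z2 z3 z4 : R[i]) :
  part b (z1 * z2 * z3 * z4) = \sum_(t <- quads) part_coef b t *
    (part t.1.1.1 z1 * part t.1.1.2 z2 * part t.1.2 z3 * part t.2 z4).
Proof.
case: z1 z2 z3 z4 => [x1 y1] [x2 y2] [x3 y3] [x4 y4].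
rewrite /quads /part_coef /= !(big_cons, big_nil).
by case: b; rewrite /part/= ; ring.
Qed.

Lemma le_part_coef (b : bool) t : `|part_coef b t| <= 1.
Proof.
apply: (le_trans (le_part_normc _ _)); case: t => [[[b1 b2] b3] b4].
rewrite !(big_cons, big_nil) !Normc.normcM.
have n1 c : Normc.normc (if c then 'i%C else 1 : R[i]) = 1.
  by case: c; rewrite /Normc.normc/= ?expr0n ?expr1n/= ?add0r ?addr0 sqrtr1.
by rewrite !n1 Normc.normc1 !mulr1.
Qed.

End Assembly2.

(** * The complex operator *)

Section ComplexOperator.
Context {R : realType}.
Local Notation leb := (@lebesgue_measure R).

Lemma Rintegral_eq_except (g h : R -> R) (x : R) : measurable_fun setT g ->
  (forall y, y != x -> h y = g y) ->
  Rintegral leb setT h = Rintegral leb setT g.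
Proof.
move=> mg hg; congr fine; have mD : measurable ([set: R] `\ x) by exact: measurableD.
have mgD : measurable_fun ([set: R] `\ x) (EFin \o g).
  by apply: measurable_funTS; exact/measurable_EFinP.
have e : {in [set: R] `\ x, EFin \o h =1 EFin \o g}.
  by move=> y; rewrite inE => -[_ /= /eqP yx]; rewrite /= hg.
rewrite -(integral_setD1 mD mgD) -(integral_setD1 mD); last first.
  by apply: eq_measurable_fun mgD => y yD; exact: esym (e y yD).
by apply: eq_integral => y yD; exact: e.
Qed.

Lemma Ck_on_pred (k : nat) (U : set (R * R)) (g : R * R -> R) :
  Ck_on k.+1 U g -> Ck_on k U g.
Proof.
elim: k g => [|k ih] g [cg dg]; first exact: (conj cg I).
by case: dg => h1 h2 h3; exact: (conj cg (And3 h1 (ih _ h2) (ih _ h3))).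
Qed.

Lemma Ck_on_part (k : nat) (U : set (R * R)) (g : R * R -> R[i]) (b : bool) :
  complex_Ck_on k U g -> Ck_on k U (fun z => part b (g z)).
Proof. by move=> [h1 h2]; case: b; [exact: h2|exact: h1]. Qed.

Lemma part_partial (v : R * R) (g : R * R -> R[i]) z (b : bool) :
  part b (complex_partial v g z) = 'D_v (fun w => part b (g w)) z.
Proof. by case: b. Qed.

Definition trig_part (b : bool) : R -> R := if b then sin else cos.

Lemma part_expi (b : bool) (t : R) : part b (expi t) = trig_part b t.
Proof. by case: b. Qed.

Lemma ge0_ler_poweR (r : R) (x y : \bar R) : 0 <= r -> (0 <= x)%E -> (x <= y)%E ->
  (x `^ r <= y `^ r)%E.
Proof.
move=> r0 x0 xy; apply: gt0_ler_poweR => //; rewrite in_itv/= leey andbT//.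
exact: le_trans xy.
Qed.

Lemma complex_LnormE (p : R) (g : R -> R[i]) :
  complex_Lnorm p g = ((\int[leb]_x ((Normc.normc (g x))%:E `^ p)) `^ p^-1)%E.
Proof.
rewrite /complex_Lnorm unlock; congr poweR; apply: eq_integral => x _.
by rewrite abse_EFin ger0_norm// normc_ge0.
Qed.

(** The imaginary and the real part each expand into the sixteen real integrals, hence
    the list [quads] taken twice. *)
Lemma le_osc_op (lam : R) (S : R -> R -> R) (K psi : R * R -> R[i]) (f : R -> R[i])
    (x : R) (V : bool * bool * bool * bool -> \bar R) :
  (forall t, 0 <= V t)%E ->
  (forall t, (V t < +oo)%E ->
    let g y := trig_part t.1.1.1 (lam * S x y) *
      off_diagonal_product (fun z => part t.1.1.2 (K z)) (fun z => part t.1.2 (psi z))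
        (x, y) * part t.2 (f y) in
    leb.-integrable setT (EFin \o g) /\ (`|Rintegral leb setT g|%:E <= V t)%E) ->
  ((Normc.normc (osc_op lam S K psi f x))%:E <= \sum_(t <- quads ++ quads) V t)%E.
Proof.
move=> V0 HV.
have [Voo|] := eqVneq (\sum_(t <- quads) V t)%E +oo%E.
  by rewrite big_cat/= Voo addye ?leey// gt_eqF// (lt_le_trans _ (leey _)).
move=> Vfin; have {}Vfin : (\sum_(t <- quads) V t < +oo)%E by rewrite lt_neqAle Vfin leey.
pose g (t : bool * bool * bool * bool) y := trig_part t.1.1.1 (lam * S x y) *
  off_diagonal_product (fun z => part t.1.1.2 (K z)) (fun z => part t.1.2 (psi z))
    (x, y) * part t.2 (f y).
have Vt t : (V t < +oo)%E.
  apply: le_lt_trans Vfin; have tq : t \in quads by case: t => [[[[] []] []] []].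
  by rewrite (big_rem t)//= leeDl//; apply: sume_ge0.
have gi t : leb.-integrable setT (EFin \o g t) by have [] := HV t (Vt t).
have gV t : (`|Rintegral leb setT (g t)|%:E <= V t)%E by have [] := HV t (Vt t).
have key b : (`|part b (osc_op lam S K psi f x)|%:E <= \sum_(t <- quads) V t)%E.
  have ci t : leb.-integrable setT (EFin \o (fun y => part_coef b t * g t y)).
    have := integrableZl measurableT (part_coef b t) (gi t); exact: eq_integrable.
  have [si sE] := Rintegral_sum quads ci.
  have -> : part b (osc_op lam S K psi f x) =
      Rintegral leb setT (fun y => \sum_(t <- quads) part_coef b t * g t y).
    transitivity (Rintegral leb setT (fun y =>
        part b (expi (lam * S x y) * K (x, y) * psi (x, y) * f y))).
      by rewrite /osc_op /complex_integral; case: (b).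
    apply: (@Rintegral_eq_except _ _ x); first exact: integrable_measurable si.
    move=> y yx; rewrite part_prod4; apply: eq_bigr => t _.
    rewrite part_expi /g /off_diagonal_product/= eq_sym (negbTE yx).
    by rewrite !mulrA.
  rewrite sE; apply: (@le_trans _ _ (\sum_(t <- quads) `|Rintegral leb setT (g t)|%:E)%E).
    rewrite sumEFin lee_fin; apply: (le_trans (ler_norm_sum _ _ _)).
    apply: ler_sum => t _; rewrite RintegralZl// normrM.
    by rewrite -[leRHS]mul1r ler_wpM2r// le_part_coef.
  by apply: lee_sum.
apply: (@le_trans _ _ (`|part false (osc_op lam S K psi f x)|%:E +
    `|part true (osc_op lam S K psi f x)|%:E)%E).
  by rewrite -EFinD lee_fin normc_le_parts.
by rewrite big_cat; exact: leeD (key false) (key true).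
Qed.

End ComplexOperator.

Theorem theorem1p1 (R : realType) (n : nat) (mu : R) (a : nat -> R)
    (psi : R * R -> R[i]) (E p : R) :
  (2 <= n)%N ->
  0 < mu < 1 ->
  a 1%N * a n.-1 != 0 ->
  test_function psi ->
  0 < E ->
  (n%:R - 2 * mu) / (n%:R - 1 - mu) <= p <= (n%:R - 2 * mu) / (1 - mu) ->
  exists C : R, forall K : R * R -> R[i],
    complex_Ck_on 2 off_diagonal K ->
    (forall x y : R, x != y -> Normc.normc (K (x, y)) <= E * `|x - y| `^ (- mu)) ->
    (forall (i : nat) (x y : R), (1 <= i <= 2)%N -> x != y ->
       Normc.normc (iter i (complex_partial ey) K (x, y))
         <= E * `|x - y| `^ (- mu - i%:R)) ->
    (forall (i : nat) (x y : R), (1 <= i <= 2)%N -> x != y ->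
       Normc.normc (iter i (complex_partial ex) K (x, y))
         <= E * `|x - y| `^ (- mu - i%:R)) ->
    forall (lambda : R) (f : R -> R[i]),
      0 < lambda ->
      in_complex_Lp p f ->
      (complex_Lnorm p (osc_op lambda (phase n a) K psi f)
         <= (C * lambda `^ (- ((1 - mu) / n%:R)))%:E * complex_Lnorm p f)%E.
Proof.
move=> n2 mu01 aa [smooth cpt] E0 pr.
pose leb := @lebesgue_measure R.
have [p1 _] : 1 < p /\ (1 - mu) * p < n%:R * interp_exponent p.
  by apply: scaling_exponent pr => //; rewrite ler_nat.
have p0 : 0 < p by exact: lt_trans p1.
set A := closure _ in cpt.
have clA : closed A by exact: closed_closure.
have psiA z : ~ A z -> psi z = 0.
  by move=> nA; apply/eqP/negPn/negP => h; apply: nA; exact: subset_closure.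
have [D D0 HD] := compact_box cpt.
have phi0 b z : ~ A z -> part b (psi z) = 0 by move=> /psiA ->; case: b.
have Cphi b : Ck_on 1 setT (fun z => part b (psi z)) := Ck_on_part b (smooth 1%N).
have [P1 P10 HP1] := test_function_bounds cpt clA (phi0 false) (Cphi false).
have [P2 P20 HP2] := test_function_bounds cpt clA (phi0 true) (Cphi true).
pose P := P1 + P2; have P0 : 0 < P by exact: addr_gt0.
have HP b z : [/\ `|part b (psi z)| <= P, `|'D_ex (fun w => part b (psi w)) z| <= P &
    'D_ex (fun w => part b (psi w)) z != 0 -> A z].
  case: b; [have [h1 h2 h3] := HP2 z|have [h1 h2 h3] := HP1 z]; split => //.
  - by rewrite (le_trans h1)// lerDr ltW.
  - by rewrite (le_trans h2)// lerDr ltW.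
  - by rewrite (le_trans h1)// lerDl ltW.
  - by rewrite (le_trans h2)// lerDl ltW.
pose E' := E * P * (1 + 2 * D).
have E'0 : 0 < E' by rewrite !mulr_gt0// ltr_pwDl// mulr_ge0// ltW.
case: n n2 aa pr => [|[|N]] n2 aa pr; [by move: n2; rewrite ltn0|by move: n2; rewrite ltnn|].
pose b (k : nat) := if (0 < k < N.+2)%N then a k else 0.
have /andP[a1 aN] : (a 1%N != 0) && (a N.+1 != 0).
  by move: aa; rewrite mulf_eq0 negb_or.
have c0 : formY N.+1 (formX N.+2 b) 0%N != 0.
  rewrite /formY /formX /b/= mulf_neq0 ?pnatr_eq0// mulf_neq0// pnatr_eq0//.
have cN : formY N.+1 (formX N.+2 b) N != 0.
  rewrite /formY /formX /b ltnSn [(_ && _)]/= ltnSn subSnn mul1r.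
  by rewrite mulf_neq0// pnatr_eq0.
have [C C0 HC] := real_osc_Lp c0 cN mu01 E'0 pr.
pose C2 := (2 `^ p) ^+ size (quads ++ quads) * ((size (quads ++ quads))%:R * C).
have C20 : 0 <= C2.
  by rewrite mulr_ge0 ?exprn_ge0 ?powR_ge0// mulr_ge0// ltW.
exists (C2 `^ p^-1) => K CK K0 _ K1 lam f lam0 [mf1 mf2 fp].
have mf c : measurable_fun setT (fun y => part c (f y)) by case: c.
pose If := (\int[leb]_x ((Normc.normc (f x))%:E `^ p))%E.
have Ifoo : (If < +oo)%E.
  by move: fp; rewrite complex_LnormE; apply: lty_poweRy; rewrite invr_eq0 gt_eqF.
have If_fin : If \is a fin_num.
  by rewrite ge0_fin_numE//; apply: integral_ge0 => x _; exact: poweR_ge0.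
have le_If c : (\int[leb]_y (`|part c (f y)| `^ p)%:E <= If)%E.
  apply: le_integral_mono => y; first by rewrite lee_fin powR_ge0.
  rewrite poweR_EFin lee_fin ge0_ler_powR ?nnegrE ?normc_ge0 ?(ltW p0)//.
  exact: le_part_normc.
pose u (c d : bool) := off_diagonal_product (fun z => part c (K z)) (fun z => part d (psi z)).
have ku c d : singular_kernel mu E' (u c d)
    (fun z => 'D_ex (fun w => part c (K w)) z * part d (psi z) +
              part c (K z) * 'D_ex (fun w => part d (psi w)) z).
  apply: singular_kernel_product; rewrite ?(ltW E0) ?(ltW D0) ?(ltW P0)//.
  - exact: Ck_on_pred (Ck_on_part c CK).
  - by move=> x y xy; exact: le_trans (le_part_normc _ _) (K0 _ _ xy).
  - move=> x y xy; rewrite -part_partial; apply: (le_trans (le_part_normc _ _)).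
    exact: (K1 1%N x y).
  - by move=> z; have [] := HP d z.
  - by move=> z; have [] := HP d z.
  - by move=> x y h; have [_ _ /(_ h)/HD[/ltW ? /ltW ?]] := HP d (x, y).
have udiag c d x : u c d (x, x) = 0 by rewrite /u /off_diagonal_product eqxx.
have usupp c d x y : u c d (x, y) != 0 -> `|x| < D /\ `|y| < D.
  move=> h; apply: HD; apply: contrapT => nA; move: h; apply/negP/negPn.
  rewrite /u /off_diagonal_product; case: ifP => // _.
  by rewrite psiA//; case: d; rewrite mulr0.
have trigE c : @trig_part R c = cos \/ @trig_part R c = sin by case: c; [right|left].
pose e := lam `^ (- ((1 - mu) * p / N.+2%:R)).
have /choice[V HV] : forall t : bool * bool * bool * bool, exists V : R -> \bar R,
  [/\ measurable_fun setT V, forall x, (0 <= V x)%E,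
    (\int[leb]_x (V x `^ p) <= (C * e)%:E * If)%E &
    forall x, (V x < +oo)%E ->
      let g y := trig_part t.1.1.1 (lam * phase N.+2 a x y) * u t.1.1.2 t.1.2 (x, y) *
        part t.2 (f y) in
      leb.-integrable setT (EFin \o g) /\ (`|Rintegral leb setT g|%:E <= V x)%E].
  move=> t.
  have [V [mV V0 Vp Vx]] := HC _ _ _ lam D _ (trigE t.1.1.1) (ku t.1.1.2 t.1.2)
    (udiag t.1.1.2 t.1.2) (usupp t.1.1.2 t.1.2) lam0 (mf t.2)
    (le_lt_trans (le_If t.2) Ifoo).
  exists V; split => //.
    apply: (le_trans Vp); rewrite lee_wpmul2l// lee_fin.
    by rewrite mulr_ge0 ?powR_ge0// ltW.
  move=> x /Vx[gi gV]; have gE y : trig_part t.1.1.1 (lam * phase N.+2 a x y) =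
      trig_part t.1.1.1 (lam * form N.+2 b x y) by rewrite phase_form.
  have -> : (fun y => trig_part t.1.1.1 (lam * phase N.+2 a x y) *
      u t.1.1.2 t.1.2 (x, y) * part t.2 (f y)) =
    (fun y => trig_part t.1.1.1 (lam * form N.+2 b x y) *
      u t.1.1.2 t.1.2 (x, y) * part t.2 (f y)) by apply/funext => y; rewrite gE.
  by split; [exact: gi|exact: gV].
pose T := osc_op lam (phase N.+2 a) K psi f.
have TV x : ((Normc.normc (T x))%:E <= \sum_(t <- quads ++ quads) V t x)%E.
  apply: le_osc_op => t; first by have [_ V0 _ _] := HV t.
  by move=> Vt; have [_ _ _ /(_ x Vt)] := HV t.
have V0 t x : (0 <= V t x)%E by have [_ V0 _ _] := HV t.
have mVp t : measurable_fun setT (fun x => V t x `^ p)%E.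
  by have [mV _ _ _] := HV t; exact: (measurableT_comp (measurable_poweR p) mV).
have main : (\int[leb]_x ((Normc.normc (T x))%:E `^ p) <= (C2 * e)%:E * If)%E.
  apply: (@le_trans _ _ (\int[leb]_x (((2 `^ p) ^+ size (quads ++ quads))%:E *
      \sum_(t <- quads ++ quads) (V t x `^ p)))%E).
    apply: le_integral_mono => x; first exact: poweR_ge0.
    apply: (@le_trans _ _ ((\sum_(t <- quads ++ quads) V t x) `^ p)%E).
      apply: ge0_ler_poweR; [exact: ltW| |exact: TV].
      by rewrite lee_fin normc_ge0.
    exact: poweR_sum_le.
  rewrite ge0_integralZl ?lee_fin ?exprn_ge0 ?powR_ge0//; last 2 first.
  - exact: emeasurable_sum.
  - by move=> x _; apply: sume_ge0 => t _; exact: poweR_ge0.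
  rewrite ge0_integral_sum//; last by move=> t x _; exact: poweR_ge0.
  have -> : ((C2 * e)%:E * If = ((2 `^ p) ^+ size (quads ++ quads))%:E *
      \sum_(t <- quads ++ quads) ((C * e)%:E * If))%E.
    rewrite -(fineK If_fin) -!EFinM sumEFin big_const_seq count_predT iter_addr_0.
    by rewrite -EFinM -[_ *+ size _]mulr_natl /C2 !mulrA.
  rewrite lee_wpmul2l ?lee_fin ?exprn_ge0 ?powR_ge0//; apply: lee_sum => t _.
  by have [_ _ Vp _] := HV t.
rewrite !complex_LnormE -/If.
apply: (@le_trans _ _ (((C2 * e)%:E * If) `^ p^-1)%E).
  apply: ge0_ler_poweR => //; first by rewrite invr_ge0 ltW.
  by apply: integral_ge0 => x _; exact: poweR_ge0.
have If0 : (0 <= If)%E by apply: integral_ge0 => x _; exact: poweR_ge0.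
have Ce0 : (0 <= (C2 * e)%:E)%E by rewrite lee_fin mulr_ge0 ?powR_ge0.
rewrite (poweRM _ Ce0 If0).
rewrite poweR_EFin powRM ?powR_ge0// /e -powRrM.
rewrite (_ : - ((1 - mu) * p / N.+2%:R) * p^-1 = - ((1 - mu) / N.+2%:R))//.
by rewrite mulNr [(1 - mu) * p / _]mulrAC mulfK// gt_eqF.
Qed.
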